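(* Let $(X,\theta,\mu,\alpha)$ be a Gibbs-Markov map with full branches and $\theta$-invariant probability $\mu$, and let $(Y,T,\kappa)$ be a topologically transitive extension of it by a graph $\mathcal{G}=(\mathbf{V},\mathbf{E})$, $Y=X\times\mathbf{V}$, $T(x,g)=(\theta(x),\kappa_x(g))$. Assume that there exists $n\in\mathbb{N}$ such that $T^n$ has uniform loops. Then the following assertions are equivalent. (i) The graph $\mathcal{G}$ is $\mu$-amenable. (ii) The spectral radius $\rho(\widehat{T})$ of $\widehat{T}:\mathcal{H}_\infty\to\mathcal{H}_\infty$ is equal to $1$. (iii) For each $\epsilon>0$ there exists $A\subset\mathbf{V}$ finite and nonempty such that $\int|\widehat{T}(\mathbf{1}_{X\times A})-\mathbf{1}_{X\times A}|\,d(\mu\otimes m_{\mathbf{V}})\le\epsilon\cdot\#(A)$. (iv) For each $\epsilon>0$ there exists $A\subset\mathbf{V}$ finite and nonempty such that $\llbracket\widehat{T}(\mathbf{1}_{X\times A})-\mathbf{1}_{X\times A}\rrbracket_1\le\epsilon\,\llbracket\mathbf{1}_{X\times A}\rrbracket_1$.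
   Context: Markov map. $(X,\theta,\mu,\alpha)$ consists of a standard probability space $(X,\mathcal{B},\mu)$, an at most countable partition $\alpha$ of $X$ into measurable sets of positive measure, and $\theta:X\to X$ such that for all $a,b\in\alpha$: $\theta|_a:a\to\theta(a)$ is invertible, bimeasurable and non-singular; and either $\mu(a\cap\theta(b))=0$ or $\mu(a\cap\theta(b)^c)=0$; moreover the sets $[w_1\ldots w_n]=\bigcap_{k=1}^n\theta^{-k+1}(w_k)$, $w_i\in\alpha$, $n\ge1$, generate $\mathcal{B}$ mod $\mu$. $\mathcal{W}^1=\alpha$; $\mathcal{W}^n$ is the set of admissible words $w=(w_1\ldots w_n)$, $w_i\in\alpha$, i.e. $\theta(w_i)\supset w_{i+1}$ (mod $\mu$); $\mathcal{W}^\infty=\bigcup_{n\ge1}\mathcal{W}^n$. For $w\in\mathcal{W}^n$, $\tau_w:\theta^n([w])\to[w]$ is the inverse of $\theta^n|_{[w]}$ and $\varphi_w=\frac{d\mu\circ\tau_w}{d\mu}$. It is a Gibbs-Markov map with full branches if $\theta([w])=X$ mod $\mu$ for all $w\in\mathcal{W}^1$ and there are $C>0$, $r\in(0,1)$ with $|\log\varphi_w(x)-\log\varphi_w(y)|\le C\,d_r(x,y)$ for all $w\in\mathcal{W}^\infty$ and a.e. $x,y\in X$, where $d_r(x,y)=r^{\min\{i:x_i\ne y_i\}}$ and $(x_i),(y_i)$ are the itineraries of $x,y$ with respect to $\alpha$. Graph extension. A graph is directed, $\mathbf{V}$ at most countable, $\mathbf{E}\subset\mathbf{V}\times\mathbf{V}$,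 $s(e),t(e)$ denote source and target of $e$. $\kappa:X\times\mathbf{V}\to\mathbf{V}$ is a nearest neighbour cocycle: each $\kappa_x$ is a bijection of $\mathbf{V}$, $(g,\kappa_x(g))\in\mathbf{E}$, and $\kappa_x$ is constant for $x$ in an element of $\alpha$. Put $\kappa_x^n=\kappa_{\theta^{n-1}(x)}\circ\cdots\circ\kappa_x$, so that $T^n(x,g)=(\theta^n(x),\kappa_x^n(g))$. $m_{\mathbf{V}}$ is counting measure on $\mathbf{V}$. $T$ is topologically transitive if for all $a,b\in\alpha$, $g,h\in\mathbf{V}$ there is $k\ge1$ with $(\mu\otimes m_{\mathbf{V}})(T^k(a\times\{g\})\cap(b\times\{h\}))>0$. $T^n$ has uniform loops if there is a finite set $\mathcal{J}\subset X$ with $g\in\{\kappa_x^n(g):x\in\mathcal{J}\}$ for all $g\in\mathbf{V}$. $\mu$-amenability: with $p(e)=\mu(\{x\in X:\kappa_x(s(e))=t(e)\})$ and $\partial^\epsilon K=\{v\in K:\exists e\in\mathbf{E}, s(e)=v, t(e)\notin K, p(e)>\epsilon\}$, $\mathcal{G}$ is $\mu$-amenable if $\lim_{\epsilon\to0}\inf\{|\partial^\epsilon K|/|K|:K\subset\mathbf{V},0<|K|<\infty\}=0$. Operator and spaces. $\widehat{T}$ is the transfer operator of $T$ with respect to $\mu\otimes m_{\mathbf{V}}$, i.e. $\int\widehat{T}(f)\,g\,d(\mu\otimes m_{\mathbf{V}})=\int f\,(g\circ T)\,d(\mu\otimes m_{\mathbf{V}})$ for $f\in L^1$, $g\in L^\infty$;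 explicitly $\widehat{T}(f)(x,g)=\sum_{w\in\mathcal{W}^1}\varphi_w(x)f(\tau_w(x),\kappa_w^{-1}(g))$, where $\kappa_w=\kappa_y$ for $y\in[w]$. For $p\in\{1,\infty\}$ and measurable $f:Y\to\mathbb{R}$, $\llbracket f\rrbracket_p=\big(\sum_{g\in\mathbf{V}}\|f(\cdot,g)\|_p^2\big)^{1/2}$ with $\|\cdot\|_p$ the $L^p(X,\mu)$-norm, and $\mathcal{H}_p=\{f:\llbracket f\rrbracket_p<\infty\}$. $(\mathcal{H}_\infty,\llbracket\cdot\rrbracket_\infty)$ is a Banach space on which $\widehat{T}$ is bounded, and $\rho(\widehat T)=\lim_k\|\widehat{T}^k\|^{1/k}$ with the operator norm on $\mathcal{H}_\infty$. *)

(* Defs.v *)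
From HB Require Import structures.
From mathcomp Require Import all_boot all_order all_algebra finmap.
From mathcomp Require Import all_classical all_reals all_analysis.

Set Implicit Arguments.
Unset Strict Implicit.
Unset Printing Implicit Defensive.

Import Order.TTheory GRing.Theory Num.Theory.
Import numFieldNormedType.Exports.

Local Open Scope classical_set_scope.
Local Open Scope ring_scope.

(* Copy of [V] carrying the sigma-algebra of all subsets. *)
Definition discrete_mtype (V : Type) : Type := V.

HB.instance Definition _ (V : pointedType) :=
  Pointed.copy (discrete_mtype V) V.
HB.instance Definition _ (V : pointedType) :=
  @isMeasurable.Build default_measure_display (discrete_mtype V)
    (@discrete_measurable V) discrete_measurable0
    discrete_measurableC discrete_measurableU.

(* The measurable sets are the Borel sets of a Polish metric on [X]. *)
Definition standard_borel (R : realType) (d : measure_display)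
    (X : measurableType d) : Prop :=
  exists (P : metricType R) (f : X -> P),
    [/\ set_bij [set: X] [set: P] f,
        forall F : set_system P, ProperFilter F -> cauchy F -> exists l : P, F --> l,
        exists2 S : set P, countable S & dense S &
        forall A : set X, measurable A <-> <<s @open P >> (f @` A)].

Section MarkovMap.
Context {R : realType} {d : measure_display} {X : measurableType d}.
Variables (mu : probability X R) (alpha : set (set X)) (theta : X -> X).

(* [[w_1 ... w_n]]; words are stored with 0-based positions. *)
Definition cylinder (w : seq (set X)) : set X :=
  \bigcap_(k in `I_(size w)) (iter k theta @^-1` nth set0 w k).

Definition word (w : seq (set X)) : Prop :=
  (0 < size w)%N /\ forall k, (k < size w)%N -> alpha (nth set0 w k).

(* The elements of W^oo; those of W^n are the ones with [size w = n]. *)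
Definition admissible (w : seq (set X)) : Prop :=
  word w /\
  forall k, (k.+1 < size w)%N ->
    mu (nth set0 w k.+1 `\` theta @` nth set0 w k) = 0%E.

Record markov_map : Prop := MarkovMap {
  mm_standard : standard_borel R X;
  mm_countable : countable alpha;
  mm_partition : partition alpha id [set: X];
  mm_measurable : forall a, alpha a -> measurable a;
  mm_pos : forall a, alpha a -> (0 < mu a)%E;
  mm_inj : forall a, alpha a -> set_inj a theta;
  mm_preimage : forall a B, alpha a -> measurable B ->
    measurable (a `&` theta @^-1` B);
  mm_image : forall a B, alpha a -> measurable B -> B `<=` a ->
    measurable (theta @` B);
  mm_nonsingular : forall a B, alpha a -> measurable B -> B `<=` a ->
    (mu B = 0%E <-> mu (theta @` B) = 0%E);
  mm_markov : forall a b, alpha a -> alpha b ->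
    mu (a `&` theta @` b) = 0%E \/ mu (a `&` ~` (theta @` b)) = 0%E;
  mm_generating : forall B, measurable B ->
    exists2 B', <<s [set cylinder w | w in word] >> B' &
      mu ((B `\` B') `|` (B' `\` B)) = 0%E }.

(* Inverse of [theta^n] restricted to [[w]], n = size w; the identity is a
   dummy value outside theta^n([w]). *)
Definition tau (w : seq (set X)) (x : X) : X :=
  xget x [set y | cylinder w y /\ iter (size w) theta y = x].

(* Density of A |-> mu (tau_w (A)) on theta^n([w]), extended by 0. *)
Definition is_density (w : seq (set X)) (f : X -> R) : Prop :=
  [/\ measurable_fun [set: X] f,
      forall x, 0 <= f x &
      forall A, measurable A ->
        (\int[mu]_(x in A) (f x)%:E =
           mu (tau w @` (A `&` iter (size w) theta @` cylinder w)))%E].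

(* A version of d(mu o tau_w)/d(mu), unique up to mu-null sets. *)
Definition phi (w : seq (set X)) : X -> R := xget (cst 0) (is_density w).

(* [differ x y n] says that x_(n+1) <> y_(n+1), itineraries being indexed
   from 1 as in [[w_1 ... w_n]]. *)
Definition differ (x y : X) (n : nat) : bool :=
  `[< forall a, alpha a -> ~ (a (iter n theta x) /\ a (iter n theta y)) >].

Definition d_r (r : R) (x y : X) : R :=
  if pselect (exists n, differ x y n) is left h then r ^+ (ex_minn h).+1
  else 0.

Definition gibbs_markov_full_branches : Prop :=
  [/\ markov_map,
      forall a, alpha a -> mu (~` (theta @` a)) = 0%E &
      exists C r : R, [/\ 0 < C, 0 < r < 1 &
        forall w, admissible w ->
          \forall x & y \near almost_everywhere mu,
            `|ln (phi w x) - ln (phi w y)| <= C * d_r r x y]].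

Definition invariant_measure : Prop :=
  forall A, measurable A -> mu (theta @^-1` A) = mu A.

End MarkovMap.

Section GraphExtension.
Context {R : realType} {d : measure_display} {X : measurableType d}.
Variables (mu : probability X R) (alpha : set (set X)) (theta : X -> X).
Context {V : pointedType}.
(* An edge [e : V * V] has source [e.1] and target [e.2]. *)
Variables (E : set (V * V)) (kappa : X -> V -> V).

Local Notation Y := (X * discrete_mtype V)%type.

Definition nearest_neighbour_cocycle : Prop :=
  [/\ forall x, bijective (kappa x),
      forall x g, E (g, kappa x g) &
      forall a x y, alpha a -> a x -> a y -> kappa x = kappa y].

Definition skew_product (y : Y) : Y := (theta y.1, kappa y.1 y.2).

Fixpoint kappa_iter (n : nat) (x : X) (g : V) : V :=
  if n is n'.+1 then kappa (iter n' theta x) (kappa_iter n' x g) else g.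

Definition mY : set Y -> \bar R :=
  (mu \x^ @counting (discrete_mtype V) R)%E.

Definition topologically_transitive : Prop :=
  forall a b (g h : V), alpha a -> alpha b ->
    exists2 k, (0 < k)%N &
      (0 < mY ((iter k skew_product @` (a `*` [set g])) `&` (b `*` [set h])))%E.

Definition uniform_loops (n : nat) : Prop :=
  exists2 J : set X, finite_set J &
    forall g : V, [set kappa_iter n x g | x in J] g.

Definition edge_prob (e : V * V) : \bar R := mu [set x | kappa x e.1 = e.2].

Definition boundary (eps : R) (K : {fset V}) : {fset V} :=
  [fset v in K | `[< exists e, [/\ E e, e.1 = v, e.2 \notin K &
                                   (eps%:E < edge_prob e)%E] >]]%fset.

Definition isoperimetric_ratio (eps : R) : \bar R :=
  ereal_inf [set (#|` boundary eps K|%:R / #|` K|%:R : R)%:E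
            | K in [set K : {fset V} | K != fset0]].

Definition mu_amenable : Prop :=
  isoperimetric_ratio eps @[eps --> 0^'+] --> 0%E.

(* The inverse of the common value of [kappa y], y in a. *)
Definition kappa_inv (a : set X) (g : V) : V :=
  xget g [set h | forall y, a y -> kappa y h = g].

(* The sum over alpha of the terms [F a], of arbitrary sign, is the difference
   of the sums of positive and negative parts; [fine] only affects points where
   the family is not summable. *)
Definition transfer (f : Y -> R) (y : Y) : R :=
  let F a := (phi mu theta [:: a] y.1 *
              f (tau theta [:: a] y.1, kappa_inv a y.2))%:E in
  fine (\esum_(a in alpha) F^\+ a - \esum_(a in alpha) F^\- a)%E.

Definition mixed_norm (p : \bar R) (f : Y -> R) : \bar R :=
  ((\esum_(g in [set: discrete_mtype V])
      'N[mu]_p[(fun x => (f (x, g))%:E)] ^+ 2) `^ 2^-1)%E.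

Definition Hspace (p : \bar R) : set (Y -> R) :=
  [set f | measurable_fun [set: Y] f /\ (mixed_norm p f < +oo)%E].

(* Norm of the k-th power of the transfer operator on H_oo. *)
Definition opnorm_transfer (k : nat) : \bar R :=
  ereal_sup [set mixed_norm +oo%E (iter k transfer f)
            | f in [set f | Hspace +oo%E f /\ (mixed_norm +oo%E f <= 1)%E]].

Definition spectral_radius : \bar R :=
  limn (fun k => (opnorm_transfer k `^ k%:R^-1)%E).

End GraphExtension.

Definition indic_fiber (R : realType) (X : Type) (V : pointedType)
    (A : {fset V}) : X * discrete_mtype V -> R :=
  \1_([set: X] `*` [set` A]).

Arguments indic_fiber R X {V} A.

(* Main.v *)
From HB Require Import structures.
From mathcomp Require Import all_boot all_order all_algebra finmap.
From mathcomp Require Import all_classical all_reals all_analysis.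
From mathcomp Require Import measurable_realfun ess_sup_inf.
From mathcomp Require Import ring lra.
Require Import Defs.

Set Implicit Arguments.
Unset Strict Implicit.
Unset Printing Implicit Defensive.

Import Order.TTheory GRing.Theory Num.Theory.
Import numFieldNormedType.Exports.

Local Open Scope classical_set_scope.
Local Open Scope ring_scope.

(* Write m(w) for the measure of the cylinder [w], kappa_w for the bijection of V
   attached to a word w, and P_k F (g) = sum_(|w| = k) m(w) F(kappa_w^-1 g).  For
   a full-branched Gibbs-Markov map bounded distortion compares the k-th power of
   the transfer operator with P_k up to a constant, and all four assertions are
   equivalent to the existence of finite sets A with small escape, i.e.
     sum_(|w| = 1) m(w) #{g in A : kappa_w^-1 g notin A} <= e #A.
   Such sets give (iii) and (iv) by computing fibrewise, and spectral radius 1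
   because the escape along words of length k is at most k times the escape
   along letters.  Conversely, if the escape along words of length n is at least
   c #A for every A, Cheeger's inequality bounds the Dirichlet form of P_n from
   below; the uniform loops give every g a mass at least delta of staying put,
   so the variance controls the Dirichlet form and P_n contracts l^2 strictly.
   P_k is not the k-th power of P_1, since letters are not independent, but the
   law of N + n letters dominates a fixed multiple of a product law, on which one
   gains by the contraction, and conditionally on N letters the earlier ones
   depend on the later ones only up to a factor K N, which tends to 1; hence the
   norms decay exponentially and the spectral radius is less than 1.
   Finally sets with small escape along words of length n yield such sets for
   letters by uniting translates. *)

(** * Sums over words *)

(** Since the letters are dependent, a bound on words alone does not iterate: the law of the first
    letters has to be controlled whatever follows. Hence the induction for the decay carries an
    arbitrary suffix [z], with bounds proportional to [m z ^+ 2]. One step multiplies the squared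
    norm by [K N ^+ 2 * (1 - eta / K 0 ^+ 2)]. The gain in the second factor does not depend on the
    length [N] of the buffer between the two blocks, so [N] can be chosen after it, with [K N] close
    enough to 1. Loops are available only for [T^n], so the spectral argument speaks of words of
    length [n], while the other assertions speak of letters. Over an infinite alphabet the union of
    all translates of a finite set may be infinite. The threshold in the definition of the boundary
    resolves this: finitely many letters carry every edge of probability larger than [eps], and
    conversely the rare letters have small total mass, so that amenability is the bridge from length
    [n] back to length 1. Sums are taken in [\bar R] over nonnegative terms, so that Tonelli applies
    throughout, and identities are arranged so as to avoid subtraction there. *)

Section esum_extra.
Local Open Scope ereal_scope.
Context {R : realType}.

Lemma esum_ge_term (T : choiceType) (S : set T) (a : T -> \bar R) (t : T) :
  S t -> 0 <= a t -> a t <= \esum_(i in S) a i.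
Proof.
move=> St a0; apply: esum_ge; exists [set t]; last by rewrite fsbig_set1.
by split=> // _ ->.
Qed.

(** Only [<=] needs an argument; [>=] is the same inequality for the inverse scalar and the scaled
    family. *)
Lemma esumZl (T : choiceType) (S : set T) (a : T -> \bar R) (c : R) :
  (0 <= c)%R -> (forall i, S i -> 0 <= a i) ->
  \esum_(i in S) (c%:E * a i) = c%:E * \esum_(i in S) a i.
Proof.
rewrite le_eqVlt => /predU1P[<- a0|c0 a0].
  by rewrite mul0e esum1// => i _; rewrite mul0e.
have half (d : R) (b : T -> \bar R) : (0 < d)%R -> (forall i, S i -> 0 <= b i) ->
    \esum_(i in S) (d%:E * b i) <= d%:E * \esum_(i in S) b i.
  move=> d0 b0; apply: ge_ereal_sup => _ [F [finF FS] <-].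
  rewrite fsbig_finite//= big_seq_cond -ge0_sume_distrr; last first.
    by move=> i; rewrite andbT in_fset_set// inE => /FS/b0.
  rewrite lee_pmul2l// -big_seq_cond; apply: esum_ge; exists F => //.
  by rewrite fsbig_finite.
apply/le_anti/andP; split; first exact: half.
rewrite -lee_pdivlMl//; apply: le_trans (half _ _ _ _); last 2 first.
- by rewrite invr_gt0.
- by move=> i Si; rewrite mule_ge0// ?a0// lee_fin ltW.
apply: le_esum => i Si.
by rewrite muleA -EFinM mulVf ?mul1e// gt_eqF.
Qed.

Lemma esumC (T1 T2 : choiceType) (I : set T1) (J : set T2)
    (a : T1 -> T2 -> \bar R) : (forall i j, I i -> J j -> 0 <= a i j) ->
  \esum_(i in I) \esum_(j in J) a i j = \esum_(j in J) \esum_(i in I) a i j.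
Proof.
move=> a0; rewrite !esum_esum//; last by move=> j i ? ?; exact: a0.
rewrite (reindex_esum (J `*`` (fun=> I)) _ (fun x => (x.2, x.1)))//; split=> //=.
- by move=> [j i] [].
- by move=> [i1 i2] [j1 j2] /= _ _ [] -> ->.
- by move=> [i j] [Ii Jj] /=; exists (j, i).
Qed.

Lemma esum_bij (T : choiceType) (b : T -> T) (a : T -> \bar R) : bijective b ->
  \esum_(i in [set: T]) a (b i) = \esum_(i in [set: T]) a i.
Proof.
move=> [c bK cK]; rewrite [RHS](reindex_esum [set: T] _ b)//; split => //.
- by move=> x y _ _; exact: (can_inj bK).
- by move=> y _; exists (c y).
Qed.

Lemma esum_fsetE (T : choiceType) (K : {fset T}) (a : T -> \bar R) :
  (forall i, 0 <= a i) -> \esum_(i in [set` K]) a i = \sum_(i <- K) a i.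
Proof.
move=> a0; rewrite esum_fset//.
by rewrite fsbig_finite//= set_fsetK.
Qed.

Lemma esum_supp (T : choiceType) (S : set T) (a : T -> \bar R) :
  (forall i, ~ S i -> a i = 0) ->
  \esum_(i in [set: T]) a i = \esum_(i in S) a i.
Proof.
move=> a0; rewrite [RHS]esum_mkcond; apply: eq_esum => i _.
by case: ifPn => // /negP; rewrite inE => /a0.
Qed.

End esum_extra.

Section words.
Local Open Scope ereal_scope.
Context {R : realType} {L : choiceType} (A : set L).

Definition words (k : nat) : set (seq L) :=
  [set w | size w = k /\ all (fun a => a \in A) w].

Lemma words0 : words 0 = [set [::]].
Proof.
by apply/seteqP; split=> [w [/size0nil]|_ ->].
Qed.

Lemma words_cat k l u v : words k u -> words l v -> words (k + l) (u ++ v).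
Proof. by move=> [<- Au] [<- Av]; split; rewrite ?size_cat// all_cat Au. Qed.

Lemma words1P w : words 1 w <-> exists2 a, A a & w = [:: a].
Proof.
split=> [[+ +]|[a Aa ->]]; last by split => //=; rewrite mem_set.
by case: w => [//|a [|//]] _ /=; rewrite andbT inE => Aa; exists a.
Qed.

Lemma esum_words_cat k l (f : seq L -> \bar R) : (forall w, 0 <= f w) ->
  \esum_(w in words (k + l)) f w =
  \esum_(u in words k) \esum_(v in words l) f (u ++ v).
Proof.
move=> f0; rewrite esum_esum//.
apply: (reindex_esum _ _ (fun x : seq L * seq L => x.1 ++ x.2)); split.
- by move=> [u v] [/=]; exact: words_cat.
- move=> [u v] [u' v']; rewrite !inE => -[/= [su _] [sv _]] [[/= su' _] _].
  move=> /eqP; rewrite eqseq_cat ?su ?su'// => /andP[/eqP -> /eqP ->//].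
- move=> w [sw Aw]; exists (take k w, drop k w); rewrite /= ?cat_take_drop//.
  move: Aw; rewrite -{1}(cat_take_drop k w) all_cat => /andP[Ak Al].
  split; split=> //; first by rewrite size_takel// sw leq_addr.
  by rewrite size_drop sw addKn.
Qed.

Lemma esum_words1 (f : seq L -> \bar R) :
  \esum_(w in words 1) f w = \esum_(a in A) f [:: a].
Proof.
apply: (reindex_esum _ _ (fun a : L => [:: a])); split.
- by move=> a Aa; apply/words1P; exists a.
- by move=> a b _ _ [].
- by move=> w /words1P[a Aa ->]; exists a.
Qed.

Lemma esum_words_cons k (f : seq L -> \bar R) : (forall w, 0 <= f w) ->
  \esum_(w in words k.+1) f w =
  \esum_(a in A) \esum_(w in words k) f (a :: w).
Proof. by move=> f0; rewrite -add1n esum_words_cat// esum_words1. Qed.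

Lemma esum_words_rcons k (f : seq L -> \bar R) : (forall w, 0 <= f w) ->
  \esum_(w in words k.+1) f w =
  \esum_(w in words k) \esum_(a in A) f (rcons w a).
Proof.
move=> f0; rewrite -addn1 esum_words_cat//; apply: eq_esum => w _.
by rewrite esum_words1; apply: eq_esum => a _; rewrite cats1.
Qed.

Section mass.
Variable m : seq L -> R.
Hypothesis m_ge0 : forall w, (0 <= m w)%R.

(** For cylinder masses, consistency under a new first letter is invariance of the measure, and
    consistency under a new last letter is additivity over the partition. *)
Lemma esum_words_massl k z :
  (forall z, all (fun a => a \in A) z ->
    \esum_(a in A) (m (a :: z))%:E = (m z)%:E) ->
  all (fun a => a \in A) z ->
  \esum_(w in words k) (m (w ++ z))%:E = (m z)%:E.
Proof.
move=> massl; elim: k z => [|k IH] z Az.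
  by rewrite words0 esum_set1// lee_fin.
(* The letter split off is the one next to [z], so that the induction hypothesis applies to
   [a :: z]. *)
rewrite esum_words_rcons => [|w]; last by rewrite lee_fin.
rewrite esumC => [|i j _ _]; last by rewrite lee_fin.
rewrite -massl//; apply: eq_esum => a Aa; rewrite -IH/= ?mem_set//.
by apply: eq_esum => w _; rewrite cat_rcons.
Qed.

Lemma esum_words_massr k z :
  (forall z, all (fun a => a \in A) z ->
    \esum_(a in A) (m (rcons z a))%:E = (m z)%:E) ->
  all (fun a => a \in A) z ->
  \esum_(w in words k) (m (z ++ w))%:E = (m z)%:E.
Proof.
move=> massr; elim: k z => [|k IH] z Az.
  by rewrite words0 esum_set1 ?cats0// lee_fin.
rewrite esum_words_cons => [|w]; last by rewrite lee_fin.
rewrite -massr//; apply: eq_esum => a Aa.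
rewrite -IH ?all_rcons ?mem_set//.
by apply: eq_esum => w _; rewrite cat_rcons.
Qed.

End mass.

End words.

(** * Cheeger's inequality *)

Section layer_cake.
Local Open Scope ereal_scope.
Context {R : realType} {T V : choiceType}.
Variables (J : set T) (p : T -> R) (b : T -> V -> V).
Hypothesis p_ge0 : forall j, (0 <= p j)%R.

(** This is [ascent] of the indicator of [K], so that the layer cake turns lower bounds on flows
    into lower bounds on [ascent]. *)
Definition flow (K : {fset V}) : \bar R :=
  \esum_(j in J) ((p j)%:E *
    \esum_(g in [set: V]) ((b j g \in K) && (g \notin K))%:R%:E).

Definition ascent (G : V -> R) : \bar R :=
  \esum_(j in J) ((p j)%:E *
    \esum_(g in [set: V]) (Num.max (G (b j g) - G g) 0)%:E).

(** Subtracting the minimum of [G] on [K] peels off the bottom layer, which is worth that minimum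
    times [flow K]. What remains vanishes at the minimiser, hence is supported on a smaller set. *)
Lemma layer_cake_fin (c : R) (K : {fset V}) (G : V -> R) :
  (forall K : {fset V}, (c * #|` K|%:R)%:E <= flow K) ->
  (forall g, 0 <= G g)%R -> (forall g, g \notin K -> G g = 0%R) ->
  (c * \sum_(g <- K) G g)%:E <= ascent G.
Proof.
move=> flow_ge; move: {2}#|` K| (erefl #|` K|) => n.
elim: n => [|n IH] in K G *.
  move=> /cardfs0_eq -> _ _; rewrite big_seq_fset0 mulr0 esum_ge0// => j _.
  by rewrite mule_ge0 ?lee_fin ?p_ge0// esum_ge0// => g _; rewrite lee_fin le_max lexx orbT.
move=> cardK G0 GK.
have [k0 k0K] : exists k, k \in K.
  by apply/fset0Pn; rewrite -cardfs_gt0 cardK.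
have [g0 g0K g0min] : exists2 g0, g0 \in K & forall g, g \in K -> (G g0 <= G g)%R.
  case: (@arg_minP _ _ K [` k0K]%fset xpredT (fun k => G (val k))) => // k _ kmin.
  exists (val k); first exact: valP.
  by move=> g gK; exact: (kmin [` gK]%fset).
pose G' g := if g \in K then (G g - G g0)%R else 0%R.
pose K' := (K `\ g0)%fset.
have cardK' : #|` K'| = n.
  by have := cardfsD1 g0 K; rewrite g0K cardK add1n => -[].
have G'0 g : (0 <= G' g)%R by rewrite /G'; case: ifPn => // /g0min; rewrite subr_ge0.
have G'K g : g \notin K' -> G' g = 0%R.
  rewrite !inE negb_and negbK /G' => /orP[/eqP ->|/negbTE ->//].
  by rewrite subrr if_same.
have {}IH := IH K' G' cardK' G'0 G'K.
have -> : (\sum_(g <- K) G g = \sum_(g <- K') G' g + G g0 * #|` K|%:R)%R.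
  have -> : (\sum_(g <- K') G' g = \sum_(g <- K) G' g)%R.
    by rewrite [RHS](big_fsetD1 g0)//= /G' g0K subrr add0r.
  rewrite card_fset_sum1 natr_sum mulr_sumr !big_seq_fsetE/= -big_split/=.
  by apply: eq_bigr => k _; rewrite /G' (valP k) mulr1 subrK.
rewrite mulrDr mulrCA EFinD.
have -> : (G g0 * (c * #|` K|%:R))%:E = (G g0)%:E * (c * #|` K|%:R)%:E by [].
have max_ge0 (x : R) : 0 <= (Num.max x 0)%:E by rewrite lee_fin le_max lexx orbT.
apply: (@le_trans _ _ (ascent G' + (G g0)%:E * flow K)).
  by rewrite leeD// lee_wpmul2l// lee_fin.
rewrite /flow -esumZl//; last first.
  by move=> j _; rewrite mule_ge0 ?lee_fin// esum_ge0// => g _; rewrite lee_fin.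
rewrite -esumD//; last 2 first.
- by move=> j _; rewrite mule_ge0 ?lee_fin// esum_ge0.
- move=> j _; rewrite !mule_ge0 ?lee_fin//.
  by rewrite esum_ge0// => g _; rewrite lee_fin.
apply: le_esum => j _; rewrite muleCA -ge0_muleDr; last 2 first.
- by rewrite esum_ge0.
- by rewrite mule_ge0 ?lee_fin// esum_ge0// => g _; rewrite lee_fin.
rewrite lee_wpmul2l ?lee_fin// -esumZl// -?esumD//; first last.
- by move=> g _; rewrite lee_fin mulr_ge0.
(* Pointwise, an ascent of [G] is at least that of [G'], plus [G g0] if the step enters [K]. *)
- apply: le_esum => g _; rewrite -EFinM -EFinD lee_fin /G'.
  case: ifPn => bK; case: ifPn => gK /=; rewrite ?mulr0 ?addr0 ?mulr1.
  + by rewrite opprB addrA subrK.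
  + have -> : G g = 0%R by exact: GK.
    rewrite !subr0; have := g0min _ bK; have := G0 g0.
    by rewrite !maxEle; case: ifPn; case: ifPn; lra.
  + rewrite (GK _ bK) sub0r opprB; have := g0min _ gK; have := G0 g0.
    by rewrite !maxEle; case: ifPn; case: ifPn; lra.
  + by rewrite (GK _ bK) (GK _ gK).
Qed.

Lemma finite_superlevel (G : V -> R) (t : R) : (0 < t)%R ->
  (forall g, 0 <= G g)%R -> \esum_(g in [set: V]) (G g)%:E < +oo ->
  finite_set [set g | (t < G g)%R].
Proof.
move=> t0 G0 Goo; apply: contrapT => inf.
set M := \esum_(g in _) _ in Goo.
have M0 : 0 <= M by apply: esum_ge0 => g _; rewrite lee_fin.
have [B Bt cardB] := infinite_set_fset (Num.truncn (fine M / t)).+1 inf.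
have : (t * #|` B|%:R)%:E <= M.
  apply: le_trans (_ : \esum_(g in [set` B]) (G g)%:E <= _); last first.
    rewrite esum_mkcond; apply: le_esum => g _; case: ifP => // _.
    by rewrite lee_fin.
  rewrite esum_fsetE => [|g]; last by rewrite lee_fin.
  rewrite sumEFin lee_fin card_fset_sum1 natr_sum mulr_sumr.
  by rewrite !big_seq; apply: ler_sum => g /Bt/ltW; rewrite mulr1.
have Mfin : M \is a fin_num by rewrite ge0_fin_numE.
rewrite -(fineK Mfin) lee_fin mulrC -ler_pdivlMr//.
rewrite leNgt => /negP; apply.
apply: lt_le_trans (truncnS_gt _) _.
by rewrite ler_nat.
Qed.

(** Reduction to finite support: the positive part of [G - t] lives on a superlevel set, which is
    finite by Markov's inequality, and its ascent is at most that of [G]. *)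
Lemma layer_cake (c : R) (G : V -> R) : (0 <= c)%R ->
  (forall K : {fset V}, (c * #|` K|%:R)%:E <= flow K) ->
  (forall g, 0 <= G g)%R -> \esum_(g in [set: V]) (G g)%:E < +oo ->
  c%:E * (\esum_(g in [set: V]) (G g)%:E) <= ascent G.
Proof.
move=> c0 flow_ge G0 Goo.
rewrite -esumZl// => [|g _]; last by rewrite lee_fin.
apply: ge_ereal_sup => _ [X [finX _] <-].
rewrite fsbig_finite//=; set F := fset_set X.
apply/lee_addgt0Pr => e e0.
(* Lowering [G] by [t] on [F] costs [c * t * #F], which is at most [e]. *)
pose t := (e / (c * #|` F|%:R + 1))%R.
have cF : (0 < c * #|` F|%:R + 1)%R by rewrite ltr_wpDl// mulr_ge0.
have t0 : (0 < t)%R by rewrite divr_gt0.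
pose Gt g := Num.max (G g - t)%R 0%R.
have Gt0 g : (0 <= Gt g)%R by rewrite le_max lexx orbT.
have fint := finite_superlevel t0 G0 Goo.
pose K := fset_set [set g | (t < G g)%R].
have GtK g : g \notin K -> Gt g = 0%R.
  rewrite in_fset_set// notin_setE /= => /negP; rewrite -leNgt => Ggt.
  by rewrite /Gt max_r// subr_le0.
have := layer_cake_fin flow_ge Gt0 GtK.
have : ascent Gt <= ascent G.
  apply: le_esum => j _; rewrite lee_wpmul2l ?lee_fin//.
  apply: le_esum => g _; rewrite lee_fin /Gt !maxEle.
  by do 4 case: ifPn; lra.
move=> /[swap] /le_trans/[apply] => h.
apply: le_trans (_ : (c * \sum_(g <- K) Gt g)%:E + e%:E <= _); last first.
  by rewrite leeD2r.
under eq_bigr do rewrite -EFinM.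
rewrite sumEFin -EFinD lee_fin -mulr_sumr.
apply: le_trans (_ : c * \sum_(g <- F) (Gt g + t) <= _)%R.
  apply: ler_wpM2l => //; apply: ler_sum => g _; rewrite /Gt maxEle.
  by case: ifPn; lra.
rewrite big_split/= mulrDr lerD//.
  apply: ler_wpM2l => //; rewrite (bigID (fun g => g \in K))/=.
  rewrite [X in (_ + X)%R]big1 ?addr0; last by move=> g; exact: GtK.
  rewrite -big_filter; set s := [seq _ <- _ | _].
  rewrite (big_fsetID _ (fun g => g \in F))/=.
  rewrite -[leLHS]addr0 lerD//; last by apply: sumr_ge0.
  rewrite le_eqVlt; apply/orP; left; apply/eqP.
  apply: perm_big; apply: uniq_perm; rewrite ?filter_uniq ?fset_uniq//.
  by move=> g; rewrite mem_filter !inE.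
have -> : (\sum_(g <- F) t = t * #|` F|%:R)%R.
  by rewrite card_fset_sum1 natr_sum mulr_sumr !big_seq_fsetE;
    apply: eq_bigr => g _; rewrite mulr1.
rewrite mulrCA -[leRHS](@divfK _ (c * #|` F|%:R + 1)) ?gt_eqF// -/t.
by rewrite ler_wpM2l ?ltW// ltrDl.
Qed.

End layer_cake.

(** * Variance of a random variable with a heavy atom *)

Section expectation.
Local Open Scope ereal_scope.
Context {R : realType} {T : choiceType}.
Variables (J : set T) (p : T -> R).
Hypothesis p_ge0 : forall j, (0 <= p j)%R.
Hypothesis p_mass : \esum_(j in J) (p j)%:E = 1.

Definition expect (h : T -> R) : \bar R := \esum_(j in J) (p j * h j)%:E.

Lemma expect_ge0 h : (forall j, 0 <= h j)%R -> 0 <= expect h.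
Proof. by move=> h0; apply: esum_ge0 => j _; rewrite lee_fin mulr_ge0. Qed.

Lemma le_expect h k : (forall j, J j -> (h j <= k j)%R) -> expect h <= expect k.
Proof. by move=> hk; apply: le_esum => j /hk; rewrite lee_fin; exact: ler_wpM2l. Qed.

Lemma expectD h k : (forall j, 0 <= h j)%R -> (forall j, 0 <= k j)%R ->
  expect (fun j => h j + k j)%R = expect h + expect k.
Proof.
move=> h0 k0; rewrite /expect -esumD => [|j _|j _]; first last.
- by rewrite lee_fin mulr_ge0.
- by rewrite lee_fin mulr_ge0.
by apply: eq_esum => j _; rewrite mulrDr EFinD.
Qed.

Lemma expectZ c h : (0 <= c)%R -> (forall j, 0 <= h j)%R ->
  expect (fun j => c * h j)%R = c%:E * expect h.
Proof.
move=> c0 h0; rewrite /expect -esumZl// => [|j _]; last by rewrite lee_fin mulr_ge0.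
by apply: eq_esum => j _; rewrite mulrCA EFinM.
Qed.

Lemma expect_cst c : (0 <= c)%R -> expect (fun=> c) = c%:E.
Proof.
move=> c0; rewrite -[RHS]mule1 -p_mass -esumZl// => [|j _]; last by rewrite lee_fin.
by apply: eq_esum => j _; rewrite mulrC EFinM.
Qed.

Lemma expect_ge_term h j : J j -> (forall j, 0 <= h j)%R ->
  (p j * h j)%:E <= expect h.
Proof.
by move=> Jj h0; apply: (@esum_ge_term _ _ J (fun j => (p j * h j)%:E)) => //;
  rewrite lee_fin mulr_ge0.
Qed.

Lemma expect_fin_num h M : (forall j, 0 <= h j <= M)%R -> expect h \is a fin_num.
Proof.
move=> hM.
have h0 j : (0 <= h j)%R by case/andP: (hM j).
rewrite ge0_fin_numE ?expect_ge0//.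
apply: le_lt_trans (_ : expect (fun=> `|M|%R) < +oo).
  by apply: le_expect => j _; case/andP: (hM j) => _ /le_trans -> //; exact: ler_norm.
by rewrite expect_cst// ltry.
Qed.

(* [E(h - h(j0))^2 <= 2 E(h - s)^2 + 2 (s - h(j0))^2] with [s = E h], and the
   atom [j0] itself shows that [(s - h(j0))^2] is at most [Var h / delta]. *)
Lemma variance_atom (delta M : R) (h : T -> R) (j0 : T) :
  (0 < delta)%R -> J j0 -> (delta <= p j0)%R -> (forall j, 0 <= h j <= M)%R ->
  (delta / (2 + 2 * delta))%:E * expect (fun j => (h j0 - h j) ^+ 2)%R
    + expect h ^+ 2 <= expect (fun j => h j ^+ 2)%R.
Proof.
move=> d0 Jj0 dp hM.
have h0 j : (0 <= h j)%R by case/andP: (hM j).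
have fh := expect_fin_num hM.
have [s sE] : exists s, expect h = s%:E by exists (fine (expect h)); rewrite fineK.
have s0 : (0 <= s)%R by rewrite -lee_fin -sE expect_ge0.
have fh2 : expect (fun j => h j ^+ 2)%R \is a fin_num.
  apply: (@expect_fin_num _ (M ^+ 2)%R) => j; rewrite sqr_ge0/= lerXn2r// ?nnegrE//.
    by apply: le_trans (h0 j) _; case/andP: (hM j).
  by case/andP: (hM j).
(* The expanded square with its cross term moved to the other side, so that only nonnegative terms
   occur in [\bar R]. *)
have key : expect (fun j => h j ^+ 2)%R + (s ^+ 2)%:E =
    expect (fun j => (h j - s) ^+ 2)%R + (2 * s * s)%:E.
  rewrite -[in LHS](expect_cst (sqr_ge0 s)) -expectD//; last 2 first.
  - by move=> j; exact: sqr_ge0.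
  - by move=> j; exact: sqr_ge0.
  rewrite EFinM -sE -expectZ// ?mulr_ge0// -expectD//; last 2 first.
  - by move=> j; exact: sqr_ge0.
  - by move=> j; rewrite !mulr_ge0.
  by apply: eq_esum => j _; congr (_%:E); ring.
have fv : expect (fun j => (h j - s) ^+ 2)%R \is a fin_num.
  rewrite ge0_fin_numE ?expect_ge0// => [|j]; last exact: sqr_ge0.
  apply: le_lt_trans (_ : _ <= expect (fun j => (h j - s) ^+ 2)%R + (2 * s * s)%:E) _.
    by rewrite leeDl// lee_fin !mulr_ge0.
  by rewrite -key lte_add_pinfty ?ltry// -ge0_fin_numE// expect_ge0// => j; exact: sqr_ge0.
have atom : (p j0 * (h j0 - s) ^+ 2)%:E <= expect (fun j => (h j - s) ^+ 2)%R.
  by apply: (@expect_ge_term (fun j => (h j - s) ^+ 2)%R) => // j; exact: sqr_ge0.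
have dev : expect (fun j => (h j0 - h j) ^+ 2)%R <=
    2%:E * expect (fun j => (h j - s) ^+ 2)%R + (2 * (h j0 - s) ^+ 2)%:E.
  rewrite -expectZ// => [|j]; last exact: sqr_ge0.
  have q0 x : (0 <= 2 * x ^+ 2 :> R)%R by apply: mulr_ge0 => //; exact: sqr_ge0.
  rewrite -[X in _ + X]expect_cst// -expectD//.
  apply: le_expect => j _.
  have := sqr_ge0 (h j0 + h j - 2 * s)%R; nra.
have fd : expect (fun j => (h j0 - h j) ^+ 2)%R \is a fin_num.
  rewrite ge0_fin_numE ?expect_ge0// => [|j]; last exact: sqr_ge0.
  by apply: le_lt_trans dev _; rewrite -(fineK fv) -EFinM -EFinD ltry.
move: key atom dev; rewrite sE -(fineK fh2) -(fineK fv) -(fineK fd).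
move: (fine _) (fine _) (fine _) => d v q.
rewrite -!EFinM -!EFinD !lee_fin => -[key] atom dev.
have atom' : (delta * (h j0 - s) ^+ 2 <= v)%R.
  by apply: le_trans atom; rewrite ler_wpM2r ?sqr_ge0.
have : (delta / (2 + 2 * delta) * d <= v)%R.
  rewrite mulrAC ler_pdivrMr ?addr_gt0 ?mulr_gt0//.
  have := ler_wpM2l (ltW d0) dev; rewrite mulrDr; lra.
lra.
Qed.
End expectation.

(** * From isoperimetry and loops to a contraction of l^2 *)

Section gap.
Local Open Scope ereal_scope.
Context {R : realType} {T V : choiceType}.
Variables (J : set T) (p : T -> R) (b : T -> V -> V).
Hypothesis p_ge0 : forall j, (0 <= p j)%R.
Hypothesis p_mass : \esum_(j in J) (p j)%:E = 1.
Hypothesis b_bij : forall j, J j -> bijective (b j).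

(** Each [b j] preserves counting measure, hence so does their average. *)
Lemma esum_expect_bij (h : V -> R) : (forall g, 0 <= h g)%R ->
  \esum_(g in [set: V]) expect J p (fun j => h (b j g)) =
  \esum_(g in [set: V]) (h g)%:E.
Proof.
move=> h0; rewrite /expect esumC => [|g j _ _]; last by rewrite lee_fin mulr_ge0.
transitivity (\esum_(j in J) ((p j)%:E * \esum_(g in [set: V]) (h g)%:E)).
  apply: eq_esum => j Jj; rewrite -(esum_bij (fun g => (h g)%:E) (b_bij Jj)).
  by rewrite -esumZl// => g _; rewrite lee_fin.
have H0 : 0 <= \esum_(g in [set: V]) (h g)%:E.
  by apply: esum_ge0 => g _; rewrite lee_fin.
case: (\esum_(g in _) _) H0 => [r|_|//].
  rewrite lee_fin => r0; under eq_esum do rewrite muleC.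
  rewrite esumZl// => [|j _]; last by rewrite lee_fin.
  by rewrite p_mass mule1.
(* If the total is infinite, a single index of positive weight already makes the average
   infinite. *)
have [j [Jj pj]] : exists j, J j /\ (0 < p j)%R.
  apply: contrapT => npos; have : \esum_(j in J) (p j)%:E = 0.
    apply: esum1 => j Jj; congr (_%:E); apply/le_anti; rewrite p_ge0 andbT leNgt.
    by apply/negP => pj; apply: npos; exists j.
  by rewrite p_mass => /eqP; rewrite onee_eq0.
apply/eqP; rewrite -leye_eq.
apply: le_trans (esum_ge_term Jj _); last by rewrite mule_ge0// lee_fin.
by rewrite gt0_muley.
Qed.

(* Cheeger's argument: the layer cake inequality for [f ^ 2] bounds below the
   Dirichlet form, which is at most [1/(2 tau) E(f - f o b)^2 + 2 tau |f|^2]. *)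
Lemma energy_ge (c : R) (f : V -> R) : (0 < c)%R ->
  (forall K : {fset V}, (c * #|` K|%:R)%:E <= flow J p b K) ->
  (forall g, 0 <= f g)%R -> \esum_(g in [set: V]) (f g ^+ 2)%:E < +oo ->
  (c ^+ 2 / 4)%:E * (\esum_(g in [set: V]) (f g ^+ 2)%:E) <=
  \esum_(g in [set: V]) expect J p (fun j => (f g - f (b j g)) ^+ 2)%R.
Proof.
move=> c0 flow_ge f0 foo.
have lc := layer_cake p_ge0 (ltW c0) flow_ge (fun g => sqr_ge0 (f g)) foo.
set N := \esum_(g in _) _ in foo lc *; set D := \esum_(g in _) _.
have N0 : 0 <= N by apply: esum_ge0 => g _; rewrite lee_fin sqr_ge0.
(* This is the choice [tau = c / 4]: the term [(c / 2) N] is absorbed by half of the lower bound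
   [c N], which leaves [D >= (c ^+ 2 / 4) N]. *)
have DN : ascent J p b (fun g => f g ^+ 2)%R <= (2 / c)%:E * D + (c / 2)%:E * N.
  have q0 (x : R) : (0 <= x ^+ 2)%R by exact: sqr_ge0.
  have ic0 : (0 <= 2 / c)%R by rewrite divr_ge0// ltW.
  have c40 : (0 <= c / 4)%R by rewrite divr_ge0// ltW.
  pose U1 g j := ((f g - f (b j g)) ^+ 2)%R.
  pose U2 g j := (f g ^+ 2 + f (b j g) ^+ 2)%R.
  have U10 g j : (0 <= U1 g j)%R by exact: q0.
  have U20 g j : (0 <= U2 g j)%R by exact: addr_ge0.
  have -> : (2 / c)%:E * D = \esum_(g in [set: V]) expect J p (fun j => 2 / c * U1 g j)%R.
    rewrite /D -esumZl// => [|g _]; last exact: expect_ge0.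
    by apply: eq_esum => g _; rewrite expectZ.
  have -> : (c / 2)%:E * N = \esum_(g in [set: V]) expect J p (fun j => c / 4 * U2 g j)%R.
    transitivity ((c / 4)%:E * (N + N)).
      have -> : (c / 2 = c / 4 + c / 4)%R by field.
      by rewrite EFinD ge0_muleDl ?lee_fin// ge0_muleDr.
    rewrite -[X in _ * (_ + X)]esum_expect_bij// -esumD => [|g _|g _]; last 2 first.
    - by rewrite lee_fin.
    - exact: expect_ge0.
    rewrite -esumZl// => [|g _]; last by rewrite adde_ge0 ?lee_fin// expect_ge0.
    apply: eq_esum => g _; rewrite expectZ//; congr (_ * _).
    by rewrite /U2 expectD// expect_cst.
  rewrite -esumD => [|g _|g _]; last 2 first.
  - by apply: expect_ge0 => // j; exact: mulr_ge0.
  - by apply: expect_ge0 => // j; exact: mulr_ge0.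
  rewrite /ascent; under eq_esum.
    move=> j _; rewrite -esumZl//; last by move=> g _; rewrite lee_fin le_max lexx orbT.
    over.
  rewrite esumC => [|j g _ _]; last by rewrite mule_ge0// lee_fin// le_max lexx orbT.
  apply: le_esum => g _; rewrite -expectD// => [|j|j]; last 2 first.
  - by rewrite mulr_ge0.
  - by rewrite mulr_ge0.
  rewrite /expect; apply: le_esum => j _.
  rewrite -EFinM lee_fin ler_wpM2l// /U1 /U2.
  move: (f g) (f (b j g)) (f0 g) (f0 (b j g)) => x y x0 y0.
  rewrite ge_max; apply/andP; split; last first.
    by apply: addr_ge0; apply: mulr_ge0 => //; apply: addr_ge0.
  (* Completing the square in [(y - x) (y + x)]; the last term comes from the parallelogram law. *)
  have -> : (2 / c * (x - y) ^+ 2 + c / 4 * (x ^+ 2 + y ^+ 2) =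
     y ^+ 2 - x ^+ 2 + (2 / c) * ((x - y) + c / 4 * (x + y)) ^+ 2
      + c / 8 * (x - y) ^+ 2)%R by field; rewrite gt_eqF.
  rewrite -addrA lerDl; apply: addr_ge0; apply: mulr_ge0 => //.
  by rewrite divr_ge0// ltW.
have {lc DN} := le_trans lc DN.
have Nfin : N \is a fin_num by rewrite ge0_fin_numE.
have [->|] := eqVneq D +oo; first by rewrite leey.
rewrite -ltey => Doo.
have D0 : 0 <= D.
  by apply: esum_ge0 => g _; apply: expect_ge0 => // j; exact: sqr_ge0.
have Dfin : D \is a fin_num by rewrite ge0_fin_numE.
rewrite -(fineK Nfin) -(fineK Dfin) -!EFinM -EFinD !lee_fin.
move: (fine N) (fine D) => n d h.
rewrite -subr_ge0.
have -> : (d - c ^+ 2 / 4 * n = c / 2 * ((2 / c * d + c / 2 * n) - c * n))%R.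
  by field; rewrite gt_eqF.
by rewrite mulr_ge0 ?subr_ge0// divr_ge0// ltW.
Qed.

(** The loop at [g] is an atom at which [j |-> f (b j g)] takes the value [f g]. By [variance_atom]
    the variance, which is what averaging removes from the l^2 norm, then controls the Dirichlet
    form at [g], and [energy_ge] bounds that form below. *)
Lemma spectral_gap (c delta : R) (f : V -> R) :
  (0 < c)%R -> (0 < delta)%R ->
  (forall K : {fset V}, (c * #|` K|%:R)%:E <= flow J p b K) ->
  (forall g, exists j, [/\ J j, (delta <= p j)%R & b j g = g]) ->
  (forall g, 0 <= f g)%R -> \esum_(g in [set: V]) (f g ^+ 2)%:E < +oo ->
  \esum_(g in [set: V]) expect J p (fun j => f (b j g)) ^+ 2 <=
  (1 - delta / (2 + 2 * delta) * (c ^+ 2 / 4))%:E *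
    (\esum_(g in [set: V]) (f g ^+ 2)%:E).
Proof.
move=> c0 d0 flow_ge loops f0 foo.
have energy := energy_ge c0 flow_ge f0 foo.
set N := \esum_(g in _) _ in foo energy *; set D := \esum_(g in _) _ in energy.
have N0 : 0 <= N by apply: esum_ge0 => g _; rewrite lee_fin sqr_ge0.
have Nfin : N \is a fin_num by rewrite ge0_fin_numE.
set e := (delta / (2 + 2 * delta))%R.
have e0 : (0 <= e)%R by rewrite divr_ge0 ?addr_ge0 ?mulr_ge0// ltW.
have fM g : (0 <= f g <= fine N + 1)%R.
  rewrite f0/=; have : (f g ^+ 2 <= fine N)%R.
    rewrite -lee_fin fineK//.
    by apply: (@esum_ge_term _ _ _ (fun g => (f g ^+ 2)%:E)) => //; rewrite lee_fin sqr_ge0.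
  have := f0 g; have : (0 <= fine N)%R by rewrite fine_ge0.
  nra.
have var : e%:E * D + \esum_(g in [set: V]) expect J p (fun j => f (b j g)) ^+ 2 <= N.
  rewrite -esumZl//; last by move=> g _; apply: expect_ge0 => // j; exact: sqr_ge0.
  rewrite -esumD; last 2 first.
  - move=> g _; rewrite mule_ge0 ?lee_fin//.
    by apply: expect_ge0 => // j; exact: sqr_ge0.
  - by move=> g _; rewrite expe_ge0// expect_ge0.
  rewrite /N -(esum_expect_bij (h := fun g => (f g ^+ 2)%R)); last first.
    by move=> g; exact: sqr_ge0.
  apply: le_esum => g _; have [j [Jj dp bj]] := loops g.
  have := variance_atom p_ge0 p_mass (h := fun j => f (b j g)) d0 Jj dp (fun j => fM (b j g)).
  by rewrite bj.
have [W WE] : exists W, W = \esum_(g in [set: V]) expect J p (fun j => f (b j g)) ^+ 2 by eexists.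
rewrite -WE in var *.
have W0 : 0 <= W by rewrite WE esum_ge0// => g _; rewrite expe_ge0// expect_ge0.
have : (e * (c ^+ 2 / 4))%:E * N + W <= N.
  apply: le_trans var; rewrite leeD2r// EFinM -muleA lee_wpmul2l// lee_fin//.
case: W W0 {WE var} => [w| |] //= w0; last first.
  by rewrite -(fineK Nfin) -EFinM addey// leye_eq.
rewrite -(fineK Nfin) -!EFinM -EFinD !lee_fin; lra.
Qed.
End gap.

(** * Expectations for several weights, and Jensen by linearisation *)

Section jensen.
Local Open Scope ereal_scope.
Context {R : realType} {T : choiceType}.
Variables (J : set T).

Lemma expect_weightD (q r : T -> R) h : (forall j, 0 <= q j)%R ->
  (forall j, 0 <= r j)%R -> (forall j, 0 <= h j)%R ->
  expect J (fun j => q j + r j)%R h = expect J q h + expect J r h.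
Proof.
move=> q0 r0 h0; rewrite /expect -esumD => [|j _|j _]; first last.
- by rewrite lee_fin mulr_ge0.
- by rewrite lee_fin mulr_ge0.
by apply: eq_esum => j _; rewrite mulrDl EFinD.
Qed.

Lemma eq_expect_weight (p q : T -> R) h : (forall j, J j -> p j = q j) ->
  expect J p h = expect J q h.
Proof. by move=> pq; apply: eq_esum => j Jj; rewrite pq. Qed.

Lemma expect_cst_mass (p : T -> R) c M : (forall j, 0 <= p j)%R -> (0 <= c)%R ->
  \esum_(j in J) (p j)%:E = M -> expect J p (fun=> c) = c%:E * M.
Proof.
move=> p0 c0 <-; rewrite -esumZl// => [|j _]; last by rewrite lee_fin.
by apply: eq_esum => j _; rewrite mulrC EFinM.
Qed.

(* Optimizing [2 t s <= t ^ 2 + X] over [t]. *)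
Lemma sqr_le_young (s X : \bar R) : 0 <= s -> 0 <= X ->
  (forall t : R, (0 <= t)%R -> (2 * t)%:E * s <= (t ^+ 2)%:E + X) ->
  s ^+ 2 <= X.
Proof.
case: s => [s| |//] s0 X0; last first.
  move=> /(_ 1%R ler01); rewrite gt0_muley ?lte_fin//.
  by case: X X0 => [r| |//] _; [rewrite leye_eq|rewrite !leey].
move=> /(_ _ s0); case: X X0 => [x| |//] _; last by rewrite !leey.
rewrite -EFinM -EFinD !lee_fin; lra.
Qed.
End jensen.

(** * Exponential decay under bounded distortion *)

Section symbolic.
Local Open Scope ereal_scope.
Context {R : realType} {L V : choiceType}.
Variables (A : set L) (m : seq L -> R) (K : nat -> R) (kb : L -> V -> V).

(** [kappa_w] applies the first letter of [w] first, so its inverse undoes that letter last. *)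
Definition kinv (w : seq L) (g : V) : V := foldr kb g w.

Lemma kinv_cat u v g : kinv (u ++ v) g = kinv u (kinv v g).
Proof. exact: foldr_cat. Qed.

Let inA := fun a => a \in A.

Hypothesis m_ge0 : forall w, (0 <= m w)%R.
Hypothesis m_gt0 : forall w, all inA w -> (0 < m w)%R.
Hypothesis m_nil : m [::] = 1%R.
Hypothesis m_massl : forall z, all inA z -> \esum_(a in A) (m (a :: z))%:E = (m z)%:E.
(** Given [z], the past [w] and the future [z'] are independent up to the factor [K (size z)]. *)
Hypothesis distortion : forall w z z', all inA w -> all inA z -> all inA z' ->
  (m (w ++ z ++ z') * m z <= K (size z) * (m (w ++ z) * m (z ++ z')))%R.
Hypothesis distortion_rev : forall w z, all inA w -> all inA z ->
  (m w * m z <= K 0 * m (w ++ z))%R.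
Hypothesis kb_bij : forall a, A a -> bijective (kb a).

Lemma kinv_bij w : all inA w -> bijective (kinv w).
Proof.
elim: w => [_|a w IH /= /andP[/set_mem Aa /IH]]; first by exists id.
by apply: bij_comp; exact: kb_bij.
Qed.

Lemma distortion0_gt0 : (0 < K 0)%R.
Proof.
have := @distortion_rev [::] [::] isT isT; rewrite m_nil !mulr1 => h.
exact: lt_le_trans h.
Qed.

Lemma distortion_ge0 z : all inA z -> (0 <= K (size z))%R.
Proof.
move=> Az; have := @distortion [::] z [::] isT Az isT.
rewrite /= cats0; have m0 := m_gt0 Az.
by rewrite -[leLHS]mul1r ler_pM2r ?mulr_gt0// => /(le_trans ler01).
Qed.

(** After division by [m z], the conditional expectation of [F (kinv w g)] over the [k] letters [w]
    that precede [z]. *)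
Definition sums (k : nat) (F : V -> R) (z : seq L) (g : V) : \bar R :=
  \esum_(w in words A k) (m (w ++ z) * F (kinv w g))%:E.

(** The factor [m z ^+ 2] makes this a bound on conditional expectations, uniform in what follows
    the first [k] letters. *)
Definition ell2_bound (F : V -> R) (k : nat) (a : R) : Prop :=
  forall z, all inA z ->
    \esum_(g in [set: V]) sums k F z g ^+ 2 <= (a * m z ^+ 2)%:E.

Lemma mass_words k : \esum_(w in words A k) (m w)%:E = 1.
Proof.
have := esum_words_massl m_ge0 k m_massl (isT : all inA [::]).
by under eq_esum do rewrite cats0; rewrite m_nil.
Qed.

Lemma sums_ge0 k F z g : (forall g, 0 <= F g)%R -> 0 <= sums k F z g.
Proof. by move=> F0; apply: esum_ge0 => w _; rewrite lee_fin mulr_ge0. Qed.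

Lemma sums_split k N n F z g : (forall g, 0 <= F g)%R ->
  sums (k + (N + n)) F z g =
  \esum_(x in words A (N + n)) sums k F (x ++ z) (kinv x g).
Proof.
move=> F0; rewrite /sums esum_words_cat; last by move=> w; rewrite lee_fin mulr_ge0.
rewrite esumC; last by move=> *; rewrite lee_fin mulr_ge0.
by apply: eq_esum => x _; apply: eq_esum => w _; rewrite catA kinv_cat.
Qed.

Section step.
Variables (n N k : nat) (F : V -> R) (a eta : R).
Hypothesis F_ge0 : forall g, (0 <= F g)%R.
Hypothesis a_ge0 : (0 <= a)%R.
Hypothesis eta01 : (0 <= eta <= 1)%R.
Hypothesis gap : forall f : V -> R, (forall g, 0 <= f g)%R ->
  \esum_(g in [set: V]) (f g ^+ 2)%:E < +oo ->
  \esum_(g in [set: V]) expect (words A n) m (fun u => f (kinv u g)) ^+ 2 <=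
  (1 - eta)%:E * (\esum_(g in [set: V]) (f g ^+ 2)%:E).
Hypothesis bound : ell2_bound F k a.

(** Conditional expectation over the first [k] letters given that [v] follows, as a function of the
    point before [v] is undone. *)
Let b v g : R := (m v)^-1 * fine (sums k F v (kinv v g)).

Let b_ge0 v g : (0 <= b v g)%R.
Proof. by rewrite mulr_ge0 ?invr_ge0// fine_ge0// sums_ge0. Qed.

Let sums_fin v g : all inA v -> sums k F v g \is a fin_num.
Proof.
move=> Av; have s0 := sums_ge0 k v g F_ge0.
rewrite ge0_fin_numE//.
have : sums k F v g ^+ 2 < +oo.
  apply: le_lt_trans (ltry (a * m v ^+ 2)); apply: le_trans (bound Av).
  by apply: (@esum_ge_term _ _ _ (fun g => sums k F v g ^+ 2)) => //; exact: expe_ge0.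
by rewrite !ltey; apply: contra => /eqP ->.
Qed.

Let b_sum v : words A N v -> \esum_(g in [set: V]) (b v g ^+ 2)%:E <= a%:E.
Proof.
move=> [_ Av].
rewrite (esum_bij (fun g => (((m v)^-1 * fine (sums k F v g)) ^+ 2)%:E) (kinv_bij Av)).
have m0 := m_gt0 Av.
have -> : a%:E = ((m v)^-1 ^+ 2)%:E * (a * m v ^+ 2)%:E.
  by rewrite -EFinM mulrCA -exprMn mulVf ?gt_eqF// expr1n mulr1.
apply: le_trans (lee_wpmul2l _ (bound Av)); last by rewrite lee_fin sqr_ge0.
rewrite -esumZl ?sqr_ge0//; last by move=> g _; rewrite expe_ge0// sums_ge0.
apply: le_esum => g _; rewrite exprMn EFinM.
by rewrite -[in leRHS](fineK (sums_fin g Av)).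
Qed.

(* The law [p] of the words of length [N + n] before [z] dominates [K 0 ^- 2]
   times a product law [q], to which the gap applies, and the remainder [r] does
   not increase norms; given the next [N] letters, the first [k] letters depend
   on the following ones only up to the factor [K N]. *)
Lemma ell2_bound_step :
  ell2_bound F (k + (N + n)) (a * (K N ^+ 2 * (1 - eta / K 0 ^+ 2))).
Proof.
move=> z Az.
have mz := m_gt0 Az.
have K0 := distortion0_gt0.
have KN : (0 <= K N)%R.
  have [N_words|noN] := pselect (exists v, words A N v); last first.
    have := mass_words N; rewrite esum1 => [/eqP|v Nv]; first by rewrite eq_sym onee_eq0.
    by case: noN; exists v.
  by case: N_words => v [<- Av]; exact: distortion_ge0.
(* [distortion_rev] is used twice, to detach the first [N] letters from the rest and the next [n]
   letters from [z]; each use costs a factor [K 0]. *)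
pose c := (K 0 ^- 2)%R.
have c0 : (0 <= c)%R by rewrite invr_ge0 sqr_ge0.
pose p x := (m (x ++ z) / m z)%R.
pose q x := (c * (m (take N x) * m (drop N x)))%R.
(* The maximum makes [r] nonnegative on all sequences; on words of length [N + n] it is just
   [p - q]. *)
pose r x := Num.max (p x - q x)%R 0%R.
have p0 x : (0 <= p x)%R by rewrite divr_ge0.
have q0 x : (0 <= q x)%R by rewrite !mulr_ge0.
have r0 x : (0 <= r x)%R by rewrite le_max lexx orbT.
have pqr x : words A (N + n) x -> p x = (q x + r x)%R.
  move=> [sx Ax]; rewrite /r max_l ?subrKC// subr_ge0.
  have [At Ad] : all inA (take N x) /\ all inA (drop N x).
    by apply/andP; rewrite -all_cat cat_take_drop.
  have h1 := distortion_rev Ad Az.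
  have Adz : all inA (drop N x ++ z) by rewrite all_cat Ad.
  have h2 := distortion_rev At Adz.
  rewrite catA cat_take_drop in h2.
  rewrite /q /c /p ler_pdivlMr// mulrC mulrCA ler_pdivrMl ?exprn_gt0//.
  rewrite expr2 -mulrA; apply: le_trans (ler_wpM2l (ltW K0) h2).
  rewrite mulrCA [leRHS]mulrCA; apply: ler_wpM2l => //.
  by rewrite mulrC.
have p_mass : \esum_(x in words A (N + n)) (p x)%:E = 1.
  rewrite -[RHS](_ : (m z)^-1%:E * (m z)%:E = 1); last first.
    by rewrite -EFinM mulVf// gt_eqF.
  rewrite -(esum_words_massl m_ge0 (N + n) m_massl Az) -esumZl ?invr_ge0//.
    by apply: eq_esum => x _; rewrite -EFinM mulrC.
  by move=> x _; rewrite lee_fin.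
have expect_q H : (forall v u, 0 <= H v u)%R ->
    expect (words A (N + n)) q (fun x => H (take N x) (drop N x)) =
    \esum_(v in words A N) ((c * m v)%:E * expect (words A n) m (H v)).
  move=> H0; rewrite /expect esum_words_cat; last first.
    by move=> w; rewrite lee_fin mulr_ge0.
  apply: eq_esum => v [sv _]; rewrite -esumZl ?mulr_ge0//; last first.
    by move=> u _; rewrite lee_fin mulr_ge0.
  apply: eq_esum => u _; rewrite -EFinM /q.
  by rewrite -sv take_size_cat// drop_size_cat// !mulrA.
have q_mass : \esum_(x in words A (N + n)) (q x)%:E = c%:E.
  transitivity (expect (words A (N + n)) q (fun=> 1%R)).
    by apply: eq_esum => x _; rewrite mulr1.
  rewrite (expect_q (fun _ _ => 1%R))//.
  under eq_esum do rewrite (expect_cst_mass m_ge0 ler01 (mass_words n)) mule1 mule1 EFinM.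
  by rewrite esumZl ?mass_words ?mule1// => v _; rewrite lee_fin.
have r_mass : \esum_(x in words A (N + n)) (r x)%:E = (1 - c)%:E.
  have : 1 = c%:E + \esum_(x in words A (N + n)) (r x)%:E :> \bar R.
    rewrite -p_mass -q_mass -esumD; last 2 first.
    - by move=> x _; rewrite lee_fin.
    - by move=> x _; rewrite lee_fin.
    by apply: eq_esum => x Nx; rewrite pqr// EFinD.
  case: (\esum_(x in _) _) => [s| |]//.
  by rewrite -EFinD => -[->]; rewrite addrC addKr.
pose h g x := b (take N x) (kinv (drop N x) g).
have h0 g x : (0 <= h g x)%R by exact: b_ge0.
have sums_le g : sums (k + (N + n)) F z g <=
    (K N * m z)%:E * expect (words A (N + n)) p (h g).
  rewrite sums_split// -esumZl ?mulr_ge0//; last first.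
    by move=> x _; rewrite lee_fin mulr_ge0.
  apply: le_esum => x [sx Ax].
  have [At Ad] : all inA (take N x) /\ all inA (drop N x).
    by apply/andP; rewrite -all_cat cat_take_drop.
  have st : size (take N x) = N by rewrite size_takel// sx leq_addr.
  rewrite /h /b; set v := take N x; set u := drop N x.
  have xE : x = v ++ u by rewrite cat_take_drop.
  have mv := m_gt0 At.
  rewrite -kinv_cat -xE -EFinM.
  have -> : (K N * m z * (p x * ((m v)^-1 * fine (sums k F v (kinv x g)))) =
      (K N * m (x ++ z) / m v) * fine (sums k F v (kinv x g)))%R.
    by rewrite /p; field; rewrite !gt_eqF.
  rewrite EFinM fineK ?sums_fin//.
  rewrite -esumZl ?divr_ge0 ?mulr_ge0//; last first.
    by move=> w _; rewrite lee_fin mulr_ge0.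
  apply: le_esum => w [_ Aw]; rewrite -EFinM lee_fin mulrA ler_wpM2r//.
  rewrite mulrAC ler_pdivlMr// -mulrA [(m (x ++ z) * _)%R]mulrC.
  rewrite xE -!catA -st; apply: distortion => //.
  by rewrite all_cat Ad.
pose Q v g := expect (words A n) m (fun u => b v (kinv u g)).
have Q0 v g : 0 <= Q v g by exact: expect_ge0.
have cm0 v : (0 <= c * m v)%R by rewrite mulr_ge0.
pose X1 g := \esum_(v in words A N) ((c * m v)%:E * Q v g ^+ 2).
pose X2 g := expect (words A (N + n)) r (fun x => h g x ^+ 2)%R.
have X10 g : 0 <= X1 g.
  by apply: esum_ge0 => v _; rewrite mule_ge0 ?lee_fin// expe_ge0.
have X20 g : 0 <= X2 g by apply: expect_ge0 => // x; exact: sqr_ge0.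
(* Jensen for [p = q + r], except that on the [q] part the average over the last [n] letters is
   taken before squaring, so that the gap applies to it. *)
have young g : expect (words A (N + n)) p (h g) ^+ 2 <= X1 g + X2 g.
  apply: sqr_le_young; [exact: expect_ge0|exact: adde_ge0|move=> t t0].
  have t20 : (0 <= 2 * t)%R by rewrite mulr_ge0.
  rewrite -expectZ// (eq_expect_weight _ pqr) expect_weightD//; last first.
    by move=> x; exact: mulr_ge0.
  have -> : (t ^+ 2)%:E = (t ^+ 2)%:E * c%:E + (t ^+ 2)%:E * (1 - c)%:E.
    by rewrite -!EFinM -EFinD; congr (_%:E); ring.
  rewrite addeACA leeD//.
    rewrite (expect_q (fun v u => 2 * t * b v (kinv u g))%R); last first.
      by move=> v u; exact: mulr_ge0.
    have -> : c%:E = \esum_(v in words A N) (c * m v)%:E.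
      under eq_esum do rewrite EFinM.
      by rewrite esumZl ?mass_words ?mule1// => v _; rewrite lee_fin.
    rewrite -esumZl ?sqr_ge0//; last by move=> v _; rewrite lee_fin.
    rewrite -esumD; last 2 first.
    - by move=> v _; rewrite mule_ge0 ?lee_fin// sqr_ge0.
    - by move=> v _; rewrite mule_ge0 ?lee_fin// expe_ge0.
    apply: le_esum => v _; rewrite [(t ^+ 2)%:E * _]muleC -ge0_muleDr; last 2 first.
    - by rewrite lee_fin sqr_ge0.
    - exact: expe_ge0.
    rewrite lee_wpmul2l ?lee_fin// expectZ// -/(Q v g).
    case: (Q v g) (Q0 v g) => [s s0| |//].
      by rewrite -EFinM -EFinD lee_fin; have := sqr_ge0 (t - s)%R; lra.
    by move=> _; rewrite leey.
  rewrite -(expect_cst_mass r0 (sqr_ge0 t) r_mass) -expectD//; last 2 first.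
  - by move=> x; exact: sqr_ge0.
  - by move=> x; exact: sqr_ge0.
  apply: le_expect => // x _; have := sqr_ge0 (t - h g x)%R; lra.
have [/= e0 e1] := andP eta01.
have X1_sum : \esum_(g in [set: V]) X1 g <= (c * ((1 - eta) * a))%:E.
  rewrite esumC => [|g v _ _]; last by rewrite mule_ge0 ?lee_fin// expe_ge0.
  apply: le_trans (_ : \esum_(v in words A N) ((c * ((1 - eta) * a))%:E * (m v)%:E) <= _).
    apply: le_esum => v Nv; rewrite esumZl// => [|g _]; last exact: expe_ge0.
    rewrite -[leRHS]EFinM mulrAC [leRHS]EFinM lee_wpmul2l ?lee_fin//.
    have bv := b_sum Nv.
    apply: le_trans (gap (b_ge0 v) (le_lt_trans bv (ltry a))) _.
    by rewrite EFinM lee_wpmul2l// lee_fin subr_ge0.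
  rewrite esumZl ?mass_words ?mule1// => [|v _]; last by rewrite lee_fin.
  by rewrite !mulr_ge0// subr_ge0.
have X2_sum : \esum_(g in [set: V]) X2 g <= ((1 - c) * a)%:E.
  rewrite /X2 /expect esumC => [|g x _ _]; last by rewrite lee_fin mulr_ge0// sqr_ge0.
  rewrite EFinM -r_mass muleC -esumZl => [||x _]//; last by rewrite lee_fin.
  apply: le_esum => x [sx Ax].
  have [At Ad] : all inA (take N x) /\ all inA (drop N x).
    by apply/andP; rewrite -all_cat cat_take_drop.
  under eq_esum do rewrite EFinM.
  rewrite esumZl// => [|g _]; last by rewrite lee_fin sqr_ge0.
  rewrite muleC lee_wpmul2r ?lee_fin// /h.
  rewrite (esum_bij (fun g => (b (take N x) g ^+ 2)%:E) (kinv_bij Ad)).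
  by apply: b_sum; split => //; rewrite size_takel// sx leq_addr.
have Km0 : (0 <= K N * m z)%R by rewrite mulr_ge0.
apply: le_trans (_ : ((K N * m z) ^+ 2)%:E * ((c * ((1 - eta) * a))%:E + ((1 - c) * a)%:E) <= _).
  apply: le_trans (_ : ((K N * m z) ^+ 2)%:E * (\esum_(g in [set: V]) (X1 g + X2 g)) <= _).
    rewrite -esumZl ?sqr_ge0// => [|g _]; last exact: adde_ge0.
    apply: le_esum => g _.
    apply: le_trans (_ : ((K N * m z)%:E * expect (words A (N + n)) p (h g)) ^+ 2 <= _).
      by rewrite lee_sqr ?sums_ge0// mule_ge0 ?lee_fin// expect_ge0.
    rewrite expe2 muleACA -EFinM -expr2 lee_wpmul2l ?lee_fin ?sqr_ge0//.
    exact: young.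
  rewrite lee_wpmul2l ?lee_fin ?sqr_ge0// esumD//.
  exact: leeD.
rewrite -EFinD -EFinM lee_fin /c; lra.
Qed.
End step.

Lemma ell2_bound0 (F : V -> R) (a : R) : (forall g, 0 <= F g)%R ->
  \esum_(g in [set: V]) (F g ^+ 2)%:E <= a%:E -> ell2_bound F 0 a.
Proof.
move=> F0 Fa z Az; have mz := m_gt0 Az.
rewrite mulrC EFinM; apply: le_trans (lee_wpmul2l _ Fa); last by rewrite lee_fin sqr_ge0.
rewrite -esumZl ?sqr_ge0// => [|g _]; last by rewrite lee_fin sqr_ge0.
apply: le_esum => g _; rewrite /sums words0.
rewrite esum_set1 ?lee_fin ?mulr_ge0//=.
by rewrite mulrACA -!expr2.
Qed.

(** Iteration of [ell2_bound_step], in blocks of [s = N + n] letters, for an [N] at which the gain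
    beats the distortion. *)
Lemma ell2_decay (n : nat) (eta : R) : (0 < n)%N -> (0 < eta <= 1)%R ->
  (forall e : R, (0 < e)%R -> exists N, (K N <= 1 + e)%R) ->
  (forall f : V -> R, (forall g, 0 <= f g)%R ->
    \esum_(g in [set: V]) (f g ^+ 2)%:E < +oo ->
    \esum_(g in [set: V]) expect (words A n) m (fun u => f (kinv u g)) ^+ 2 <=
    (1 - eta)%:E * (\esum_(g in [set: V]) (f g ^+ 2)%:E)) ->
  exists s lam, [/\ (0 < s)%N, (0 <= lam < 1)%R &
    forall F a j, (forall g, 0 <= F g)%R ->
      \esum_(g in [set: V]) (F g ^+ 2)%:E <= a%:E ->
      \esum_(g in [set: V]) sums (j * s) F [::] g ^+ 2 <= (lam ^+ j * a)%:E].
Proof.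
move=> n0 /andP[eta0 eta1] Klim gap.
have K1 : (1 <= K 0)%R.
  by have := @distortion_rev [::] [::] isT isT; rewrite m_nil !mulr1.
have K0 := distortion0_gt0.
(* With [K N <= 1 + e] the rate is at most [(1 + e) ^+ 2 * (1 - 4 * e)], which is less than 1. *)
pose e := (eta / K 0 ^+ 2 / 4)%R.
have e0 : (0 < e)%R by rewrite !divr_gt0// exprn_gt0.
have e1 : (e <= 4^-1)%R.
  rewrite /e ler_pdivrMr// mulVf// ler_pdivrMr ?exprn_gt0// mul1r.
  by apply: le_trans eta1 _; rewrite exprn_ege1.
have [N KN] := Klim _ e0.
have KN0 : (0 <= K N)%R.
  have [[v [<- Av]]|noN] := pselect (exists v, words A N v); first exact: distortion_ge0.
  have := mass_words N; rewrite esum1 => [/eqP|v Nv]; first by rewrite eq_sym onee_eq0.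
  by case: noN; exists v.
have eE : (eta / K 0 ^+ 2 = 4 * e)%R by rewrite /e [RHS]mulrC divfK.
have q0 : (0 <= 1 - eta / K 0 ^+ 2)%R by rewrite eE; lra.
exists (N + n)%N, (K N ^+ 2 * (1 - eta / K 0 ^+ 2))%R; split.
- by rewrite addn_gt0 n0 orbT.
- rewrite mulr_ge0 ?sqr_ge0//=.
  apply: le_lt_trans (_ : _ <= (1 + e) ^+ 2 * (1 - eta / K 0 ^+ 2))%R _.
    by rewrite ler_wpM2r// ler_sqr ?nnegrE// addr_ge0// ltW.
  by rewrite eE; nra.
move=> F a j F0 Fa.
have a0 : (0 <= a)%R.
  by rewrite -lee_fin; apply: le_trans Fa; apply: esum_ge0 => g _; rewrite lee_fin sqr_ge0.
set lam := (K N ^+ 2 * _)%R.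
have lam0 : (0 <= lam)%R by rewrite mulr_ge0 ?sqr_ge0//.
suff : ell2_bound F (j * (N + n)) (a * lam ^+ j).
  by move=> /(_ [::] isT); rewrite m_nil expr1n mulr1 mulrC.
elim: j => [|j IH]; first by rewrite mul0n mulr1; exact: ell2_bound0.
rewrite mulSnr exprSr mulrA; apply: ell2_bound_step => //.
- by rewrite mulr_ge0// exprn_ge0.
- by rewrite ltW.
Qed.
End symbolic.

(** * Sets with small flow *)

Section boundary_flow.
Local Open Scope ereal_scope.
Context {R : realType} {V : choiceType}.

Lemma esum_indic_fset (K : {fset V}) (P : pred V) :
  \esum_(g in [set: V]) ((g \in K) && P g)%:R%:E =
  (#|` [fset g in K | P g]%fset|%:R)%:E :> \bar R.
Proof.
rewrite (esum_supp (S := [set` K])) => [|g /negP/negbTE ->//].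
rewrite esum_fsetE => [|g]; last by rewrite lee_fin.
rewrite sumEFin -natr_sum; congr (_%:R%:E).
rewrite card_fset_sum1 -[RHS]big_fset_condE/= [RHS]big_mkcond/=.
by apply: eq_big_seq => g ->; case: (P g).
Qed.

(** Both sides complete the number of [g] with [g] and [b g] in [K] to [#K], because [b] preserves
    counting measure. *)
Lemma inflow_outflow (b : V -> V) (K : {fset V}) : bijective b ->
  \esum_(g in [set: V]) ((b g \in K) && (g \notin K))%:R%:E =
  \esum_(g in [set: V]) ((g \in K) && (b g \notin K))%:R%:E :> \bar R.
Proof.
move=> bb.
pose both := \esum_(g in [set: V]) ((b g \in K) && (g \in K))%:R%:E : \bar R.
have ind0 (P : pred V) g : 0 <= (P g)%:R%:E :> \bar R by rewrite lee_fin.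
have total : \esum_(g in [set: V]) (g \in K)%:R%:E = (#|` K|%:R)%:E :> \bar R.
  rewrite (esum_supp (S := [set` K])) => [|g /negP/negbTE ->//].
  rewrite esum_fsetE => [|g]; last by rewrite lee_fin.
  rewrite sumEFin -natr_sum card_fset_sum1 !big_seq_fsetE/=.
  by congr (_%:R%:E); apply: eq_bigr => g _; rewrite (valP g).
have totalb : \esum_(g in [set: V]) (b g \in K)%:R%:E = (#|` K|%:R)%:E :> \bar R.
  by rewrite (esum_bij (fun g => (g \in K)%:R%:E) bb).
have e1 : (#|` K|%:R)%:E =
    both + \esum_(g in [set: V]) ((b g \in K) && (g \notin K))%:R%:E.
  rewrite -totalb -esumD//; apply: eq_esum => g _.
  by rewrite -EFinD -natrD; case: (b g \in K); case: (g \in K).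
have e2 : (#|` K|%:R)%:E =
    both + \esum_(g in [set: V]) ((g \in K) && (b g \notin K))%:R%:E.
  rewrite -total -esumD//; apply: eq_esum => g _.
  by rewrite -EFinD -natrD; case: (b g \in K); case: (g \in K).
have bfin : both \is a fin_num.
  rewrite ge0_fin_numE ?esum_ge0//.
  apply: le_lt_trans (_ : _ <= (#|` K|%:R)%:E) (ltry _).
  by rewrite e1 leeDl// esum_ge0.
have cancel (x : \bar R) : (#|` K|%:R)%:E = both + x -> x = (#|` K|%:R - fine both)%:E.
  move: bfin; case: both {e1 e2} => // r _.
  by case: x => // x [->]; congr (_%:E) => /=; ring.
by rewrite (cancel _ e1) (cancel _ e2).
Qed.

End boundary_flow.

(** * Thickening a set: from words of length n to single letters *)

Section thick_set.
Local Open Scope ereal_scope.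
Context {R : realType} {L V : choiceType}.
Variables (A : set L) (m : seq L -> R) (kb kf : L -> V -> V).
Hypothesis m_ge0 : forall w, (0 <= m w)%R.
Hypothesis m_gt0 : forall w, all (fun a => a \in A) w -> (0 < m w)%R.
Hypothesis kfK : forall a, A a -> cancel (kf a) (kb a).
Hypothesis kbK : forall a, A a -> cancel (kb a) (kf a).

Definition fwd (w : seq L) (g : V) : V := foldl (fun g a => kf a g) g w.

Lemma fwdK w : all (fun a => a \in A) w -> cancel (fwd w) (kinv kb w).
Proof.
elim: w => [//|a w IH] /= /andP[/set_mem Aa Aw] g.
by rewrite /fwd /= -/(fwd w _) IH// kfK.
Qed.

Lemma kinvK w : all (fun a => a \in A) w -> cancel (kinv kb w) (fwd w).
Proof.
elim: w => [//|a w IH] /= /andP[/set_mem Aa Aw] g.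
by rewrite /fwd /= -/(fwd w _) kbK// IH.
Qed.

(** Substituting [g = fwd w h] turns the points that [kinv w] brings into [K] into those of [K] that
    [fwd w] takes out. *)
Lemma flow_fwd n (K : {fset V}) :
  flow (words A n) m (kinv kb) K =
  \esum_(w in words A n) ((m w)%:E * (#|` [fset h in K | fwd w h \notin K]%fset|%:R)%:E).
Proof.
apply: eq_esum => w [_ Aw]; rewrite -esum_indic_fset; congr (_ * _).
rewrite -(esum_bij _ (Bijective (fwdK Aw) (kinvK Aw))).
by apply: eq_esum => h _; rewrite fwdK.
Qed.

Fixpoint seqs (s : seq L) (j : nat) : seq (seq L) :=
  if j is j'.+1 then [seq a :: w | a <- s, w <- seqs s j'] else [:: [::]].

Lemma mem_seqs s j w : (w \in seqs s j) = (size w == j) && all [in s] w.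
Proof.
elim: j w => [|j IH] w; first by case: w.
apply/allpairsP/idP => [[[a u] [/= sa]]|].
  by rewrite IH => /andP[/eqP <- su] ->; rewrite /= eqxx sa.
case: w => //= a w /andP[sw /andP[sa wa]]; exists (a, w); split => //=.
by rewrite IH wa -eqSS sw.
Qed.

(* [K'] is the union of the translates of [K] by the words over [s] of length
   less than [n]; a point of [K'] that leaves [K'] in one step over [s] was
   reached by a word of length exactly [n.-1]. *)
Lemma thicken (n : nat) (s : seq L) (delta : R) :
  (0 < n)%N -> all (fun a => a \in A) s -> (0 < delta)%R ->
  (forall c, (0 < c)%R -> exists K : {fset V},
     flow (words A n) m (kinv kb) K < (c * #|` K|%:R)%:E) ->
  exists2 K' : {fset V}, K' != fset0 &
   exists2 B : {fset V}, (#|` B|%:R <= delta * #|` K'|%:R)%R &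
   forall h a, h \in K' -> a \in s -> kf a h \notin K' -> h \in B.
Proof.
move=> n0 sA d0 small.
have As w j : w \in seqs s j -> words A j w.
  rewrite mem_seqs => /andP[/eqP <- ws]; split => //.
  by apply/allP => a /(allP ws)/(allP sA).
(* The flow bounds the term of a single word [u], so at most [c * #K / m u] points leave along [u];
   [c] is chosen so that these bounds add up to at most [delta * #K]. *)
pose S := (\sum_(u <- seqs s n) (m u)^-1)%R.
have S0 : (0 <= S)%R by apply: sumr_ge0 => u _; rewrite invr_ge0.
pose c := (delta / (S + 1))%R.
have S1 : (0 < S + 1)%R by rewrite ltr_wpDl.
have [K KK] := small c (divr_gt0 d0 S1).
pose out u := [fset h in K | fwd u h \notin K]%fset.
have out_le u : u \in seqs s n -> (#|` out u|%:R <= c * #|` K|%:R * (m u)^-1)%R.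
  move=> /As un; have mu0 := m_gt0 un.2.
  rewrite ler_pdivlMr// mulrC -lee_fin EFinM; apply: le_trans (ltW KK).
  rewrite flow_fwd.
  apply: (@esum_ge_term _ _ _ (fun w => (m w)%:E * (#|` out w|%:R)%:E)) => //.
  by rewrite mule_ge0 ?lee_fin.
pose near j := [seq fwd w g | w <- seqs s j, g <- K].
pose K' := [fset x in flatten [seq near j | j <- iota 0 n]]%fset.
have nearK' j h : (j < n)%N -> h \in near j -> h \in K'.
  move=> jn hj; rewrite !inE; apply/flattenP; exists (near j) => //.
  by apply: map_f; rewrite mem_iota.
have KK' : {subset K <= K'}.
  move=> g gK; apply: (nearK' 0%N) => //.
  by apply/allpairsP; exists ([::], g); rewrite mem_seqs.
(* The points reached one letter before the end of a word of length [n] that leads out of [K]. *)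
pose Bs := [seq fwd (take n.-1 u) g | u <- seqs s n, g <- out u].
exists K'.
  (* The empty set cannot satisfy the strict inequality on the flow, so [K], and with it [K'], is
     nonempty. *)
  apply/eqP => K'0.
  have K0 : K = fset0.
    by apply/eqP; rewrite -fsubset0 -K'0; apply/fsubsetP.
  move: KK; rewrite K0 cardfs0 mulr0 ltNge => /negP; apply.
  apply: esum_ge0 => w _; rewrite mule_ge0 ?lee_fin//.
  by apply: esum_ge0 => g _; rewrite lee_fin.
exists [fset x in Bs]%fset.
  apply: le_trans (_ : c * #|` K|%:R * S <= _)%R; last first.
    have cS : (c * S <= delta)%R.
      by rewrite /c mulrAC ler_pdivrMr// ler_pM2l// lerDl.
    have c0 : (0 <= c)%R by rewrite divr_ge0// ltW.
    have cS0 : (0 <= c * S)%R by exact: mulr_ge0.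
    rewrite mulrAC ler_pM//.
    by rewrite ler_nat; apply: fsubset_leq_card; apply/fsubsetP.
  rewrite card_fseq.
  apply: le_trans (_ : (size Bs)%:R <= _)%R; first by rewrite ler_nat size_undup.
  rewrite size_allpairs_dep sumnE big_map natr_sum mulr_sumr !big_seq.
  by apply: ler_sum => u /out_le.
move=> h a hK' sa notK'.
have /flattenP[_ /mapP[j + ->]] : h \in flatten [seq near j | j <- iota 0 n].
  by move: hK'; rewrite !inE.
rewrite mem_iota add0n => /= jn /allpairsP[[w g] /= [wj gK hE]].
rewrite {h}hE in hK' notK' *.
have wa : rcons w a \in seqs s j.+1.
  move: wj; rewrite !mem_seqs size_rcons all_rcons eqSS => /andP[-> ->].
  by rewrite andbT.
have kE : kf a (fwd w g) = fwd (rcons w a) g by rewrite /fwd foldl_rcons.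
rewrite kE in notK'.
have [jn1|jn1] := ltnP j.+1 n.
  case/negP: notK'; apply: (nearK' j.+1) => //.
  by apply/allpairsP; exists (rcons w a, g).
have {jn jn1} nE : n = j.+1 by apply/eqP; rewrite eqn_leq jn jn1.
rewrite !inE; apply/allpairsPdep; exists (rcons w a), g; split => //.
- by rewrite nE.
- by rewrite !inE gK; apply: contra notK'; exact: KK'.
- rewrite nE /= -cats1 take_size_cat//.
  by move: wj; rewrite mem_seqs => /andP[/eqP].
Qed.

End thick_set.

(** * Densities and distortion of Markov maps *)

Section countable_sums.
Local Open Scope ereal_scope.
Context {R : realType}.

(** The indices that name no element are sent to [None] and contribute 0; the sum becomes a series,
    which can be integrated term by term. *)
Lemma esum_enum (T : choiceType) (A : set T) : countable A ->
  exists2 c : nat -> option T, forall n a, c n = Some a -> A a &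
    forall f : T -> \bar R, (forall a, A a -> 0 <= f a) ->
      \esum_(a in A) f a = \sum_(0 <= n <oo) oapp f 0 (c n).
Proof.
move=> /countable_injP[e einj].
have inj a b : A a -> A b -> e a = e b -> a = b.
  by move=> Aa Ab; apply: einj; rewrite inE.
pose c n := if pselect (exists a, A a /\ e a = n) is left h
  then Some (projT1 (cid h)) else None.
have cA n a : c n = Some a -> A a.
  by rewrite /c; case: pselect => // h [<-]; case: cid => b [].
have ce a : A a -> c (e a) = Some a.
  move=> Aa; rewrite /c; case: pselect => [h|[]]; last by exists a.
  by case: cid => b /= [Ab eab]; rewrite (inj _ _ Ab Aa eab).
exists c => // f f0.
rewrite nneseries_esumT => [|n]; last first.
  by case cn : (c n) => [a|//]; exact: f0 (cA _ _ cn).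
rewrite (esum_supp (S := e @` A)) => [|n nA].
  rewrite esum_image => [|a b]; last by rewrite !inE; exact: inj.
  by apply: eq_esum => a Aa; rewrite ce.
case cn : (c n) => [a|//]; case: nA; exists a; first exact: cA cn.
by move: cn; rewrite /c; case: pselect => // h [<-]; case: cid => b [].
Qed.

Context {d : measure_display} {X : measurableType d}.

Lemma measurable_esum (T : choiceType) (A : set T) (f : T -> X -> \bar R)
    (D : set X) : countable A ->
  (forall a, A a -> measurable_fun D (f a)) ->
  (forall a x, A a -> 0 <= f a x) ->
  measurable_fun D (fun x => \esum_(a in A) f a x).
Proof.
move=> /esum_enum[c cA cE] mf f0.
rewrite (_ : (fun x => _) =
    fun x => \sum_(0 <= n <oo) oapp (f^~ x) 0 (c n)); last first.
  by apply/funext => x; rewrite cE// => a Aa; exact: f0.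
apply: (ge0_emeasurable_sum (P := xpredT) (h := fun n x => oapp (f^~ x) 0 (c n))).
  by move=> n x _ _; case cn : (c n) => [a|//]; exact: f0 (cA _ _ cn).
move=> n _; case cn : (c n) => [a|] /=; last exact: measurable_cst.
exact: mf (cA _ _ cn).
Qed.

Lemma integral_esum (mu : {measure set X -> \bar R}) (T : choiceType)
    (A : set T) (f : T -> X -> \bar R) (D : set X) :
  countable A -> measurable D ->
  (forall a, A a -> measurable_fun D (f a)) ->
  (forall a x, A a -> 0 <= f a x) ->
  \int[mu]_(x in D) (\esum_(a in A) f a x) =
  \esum_(a in A) \int[mu]_(x in D) f a x.
Proof.
move=> /esum_enum[c cA cE] mD mf f0.
rewrite cE => [|a Aa]; last by apply: integral_ge0 => x _; exact: f0.
transitivity (\int[mu]_(x in D) (\sum_(0 <= n <oo) oapp (f^~ x) 0 (c n))).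
  by apply: eq_integral => x _; rewrite cE// => a Aa; exact: f0.
rewrite integral_nneseries//.
- apply: eq_eseriesr => n _; case cn : (c n) => [a|] //=.
  exact: integral0.
- move=> n; case cn : (c n) => [a|] /=; last exact: measurable_cst.
  exact: mf (cA _ _ cn).
- by move=> n x _; case cn : (c n) => [a|//]; exact: f0 (cA _ _ cn).
Qed.

Lemma measurable_countable_bigcup (T : Type) (A : set T) (F : T -> set X) :
  countable A -> (forall a, A a -> measurable (F a)) ->
  measurable (\bigcup_(a in A) F a).
Proof.
move=> /countable_injP[e einj] mF; rewrite bigcup_set_type.
apply: countable_bigcupT_measurable => [|a]; last exact: mF (set_valP a).
apply/countable_injP; exists (e \o val) => a b _ _ /= eab.
by apply: val_inj; apply: einj eab; exact: valP.
Qed.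

End countable_sums.

(** * Integrals split by the letter visited at a given time *)

Section partition_integral.
Local Open Scope ereal_scope.
Context {R : realType} {d : measure_display} {X : measurableType d}.
Variables (mu : {measure set X -> \bar R}) (alpha : set (set X)) (T : X -> X).
Hypothesis alpha_countable : countable alpha.
Hypothesis alpha_partition : partition alpha id [set: X].
Hypothesis alpha_measurable : forall a, alpha a -> measurable a.
Hypothesis T_measurable : measurable_fun [set: X] T.

Lemma letter_uniq a b x : alpha a -> alpha b -> a x -> b x -> a = b.
Proof.
case: alpha_partition => _ triv _ aa ab ax bx; apply: (triv a b aa ab).
by exists x.
Qed.

Lemma letterP x : exists2 a, alpha a & a x.
Proof.
case: alpha_partition => cov _ _; have : [set: X] x by [].
by rewrite -cov => -[a aa ax]; exists a.
Qed.

Lemma measurable_preimage_iter k B : measurable B ->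
  measurable (iter k T @^-1` B).
Proof.
elim: k B => [//|k IH] B mB.
rewrite (_ : _ @^-1` _ = iter k T @^-1` (T @^-1` B))//.
by apply: IH; rewrite -[_ @^-1` _]setTI; exact: T_measurable.
Qed.

Lemma integral_partition (k : nat) (B : set X) (h : X -> \bar R) : measurable B ->
  measurable_fun B h -> (forall x, B x -> 0 <= h x) ->
  \int[mu]_(x in B) h x =
  \esum_(a in alpha) \int[mu]_(x in B `&` iter k T @^-1` a) h x.
Proof.
move=> mB mh h0.
have /countable_injP[e einj] := alpha_countable.
pose P a := B `&` iter k T @^-1` a.
pose F n := \bigcup_(a in alpha `&` [set a | e a = n]) P a.
have Fe a : alpha a -> F (e a) = P a.
  move=> aa; apply/seteqP; split=> [x [b [ab /= eb]]|x Px]; last by exists a.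
  by rewrite (einj b a)// ?inE.
have F0 n : ~ (e @` alpha) n -> F n = set0.
  by move=> nn; apply/seteqP; split=> // x [b [ab /= eb] _]; apply: nn; exists b.
have mF n : measurable (F n).
  have [[a aa <-]|/F0 ->//] := pselect ((e @` alpha) n).
  by rewrite Fe//; apply: measurableI => //; apply: measurable_preimage_iter;
    exact: alpha_measurable.
have BE : \bigcup_n F n = B.
  apply/seteqP; split=> [x [n _ [a _ []//]]|x Bx].
  have [a aa ax] := letterP (iter k T x).
  by exists (e a) => //; rewrite Fe.
have Ftriv : trivIset [set: nat] F.
  move=> i j _ _ [x [[a [aa /= <-] [_ ax]] [b [ab /= <-] [_ bx]]]].
  by rewrite (letter_uniq aa ab ax bx).
rewrite -[in LHS]BE ge0_integral_bigcup ?BE//.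
rewrite nneseries_esumT => [|n]; last first.
  by apply: integral_ge0 => x Fx; apply: h0; rewrite -BE; exists n.
rewrite (esum_supp (S := e @` alpha)) => [|n /F0 ->]; last by rewrite integral_set0.
rewrite esum_image; last by move=> a b aa ab; exact: einj.
by apply: eq_esum => a aa; rewrite Fe.
Qed.

Lemma measure_partition (k : nat) (B : set X) : measurable B ->
  mu B = \esum_(a in alpha) mu (B `&` iter k T @^-1` a).
Proof.
move=> mB; rewrite -[LHS]mul1e -integral_cst//.
rewrite (integral_partition k)//; apply: eq_esum => a aa.
rewrite integral_cst ?mul1e//; apply: measurableI => //.
by apply: measurable_preimage_iter; exact: alpha_measurable.
Qed.
End partition_integral.

(** * Densities of inverse branches *)

Section restricted_image.
Local Open Scope ereal_scope.
Context {R : realType} {d : measure_display} {X : measurableType d}.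
Variables (mu : probability X R) (D : set X) (T : X -> X).

(* The proofs are arguments so that the measure structure can be inferred. *)
Definition restricted_image of measurable D & measurable_fun [set: X] T :=
  fun B : set X => mu (D `&` T @^-1` B).

Variables (mD : measurable D) (mT : measurable_fun [set: X] T).
Local Notation nu := (restricted_image mD mT).

Let mpre B : measurable B -> measurable (D `&` T @^-1` B).
Proof. by move=> mB; apply: measurableI => //; rewrite -[_ @^-1` _]setTI; exact: mT. Qed.

Let nu0 : nu set0 = 0.
Proof. by rewrite /restricted_image preimage_set0 setI0 measure0. Qed.

Let nu_ge0 B : 0 <= nu B.
Proof. exact: measure_ge0. Qed.

Let nu_sigma : semi_sigma_additive nu.
Proof.
move=> F mF tF mUF; rewrite /restricted_image preimage_bigcup setI_bigcupr.
apply: measure_semi_sigma_additive.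
- by move=> n; exact: mpre.
- apply/trivIsetP => /= i j _ _ ij; rewrite setIACA -preimage_setI.
  by move/trivIsetP : tF => /(_ _ _ _ _ ij) ->//; rewrite preimage_set0 setI0.
- by rewrite -setI_bigcupr -preimage_bigcup; exact: mpre.
Qed.

HB.instance Definition _ := isMeasure.Build _ _ _ nu nu0 nu_ge0 nu_sigma.

Let nu_fin : fin_num_fun nu.
Proof. by move=> B mB; apply: fin_num_measure; exact: mpre. Qed.

HB.instance Definition _ := Measure_isFinite.Build _ _ _ nu nu_fin.

Lemma restricted_image_density : (forall B, measurable B -> mu B = 0 -> nu B = 0) ->
  exists f : X -> R, [/\ measurable_fun [set: X] f, forall x, (0 <= f x)%R &
    forall B, measurable B -> \int[mu]_(x in B) (f x)%:E = nu B].
Proof.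
move=> ac; have numu : nu `<< mu by apply/null_content_dominatesP.
pose f := Radon_Nikodym_SigmaFinite.f nu mu.
have fE x : (fine (f x))%:E = f x.
  by rewrite fineK//; exact: Radon_Nikodym_SigmaFinite.f_fin_num.
have mf : measurable_fun [set: X] f.
  exact: measurable_int (Radon_Nikodym_SigmaFinite.f_integrable numu).
exists (fine \o f); split.
- by apply: measurableT_comp => //; exact: fine_measurable.
- by move=> x; rewrite fine_ge0//; exact: Radon_Nikodym_SigmaFinite.f_ge0.
- move=> B mB; rewrite (Radon_Nikodym_SigmaFinite.f_integral numu)//.
  by apply: eq_integral => x _; rewrite /= fE.
Qed.

End restricted_image.

(** * Cylinders and their masses *)

Section markov_cylinders.
Local Open Scope ereal_scope.
Context {R : realType} {d : measure_display} {X : measurableType d}.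
Variables (mu : probability X R) (alpha : set (set X)) (theta : X -> X).
Hypothesis GM : gibbs_markov_full_branches mu alpha theta.
Hypothesis mu_inv : invariant_measure mu theta.

Local Notation inA := (fun a : set X => a \in alpha).
Local Notation cyl := (cylinder theta).

Let MM : markov_map mu alpha theta. Proof. by case: GM. Qed.

Lemma measurable_markov : measurable_fun [set: X] theta.
Proof.
move=> _ B mB; rewrite setTI.
rewrite (_ : _ @^-1` B = \bigcup_(a in alpha) (a `&` theta @^-1` B)); last first.
  apply/seteqP; split=> [x Bx|x [a _ []//]].
  by have [a aa ax] := letterP (mm_partition MM) x; exists a.
apply: measurable_countable_bigcup; first exact: mm_countable MM.
by move=> a aa; exact: mm_preimage MM _ _ aa mB.
Qed.

Lemma invariant_iter k B : measurable B -> mu (iter k theta @^-1` B) = mu B.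
Proof.
elim: k B => [//|k IH] B mB.
rewrite (_ : _ @^-1` B = iter k theta @^-1` (theta @^-1` B))//.
rewrite IH ?mu_inv// -[_ @^-1` _]setTI; exact: measurable_markov.
Qed.

Lemma cylinder_nil : cyl [::] = [set: X].
Proof. by apply/seteqP; split=> // x _ k. Qed.

Lemma cylinder_cons a w : cyl (a :: w) = a `&` theta @^-1` cyl w.
Proof.
apply/seteqP; split=> [x wx|x [ax wx]].
  split; first exact: (wx 0%N).
  by move=> k /= kw; have := wx k.+1 kw; rewrite /= -iterSr.
by case=> [//|k] /= kw; rewrite -iterS iterSr; exact: wx.
Qed.

Lemma cylinder_cat u v : cyl (u ++ v) = cyl u `&` iter (size u) theta @^-1` cyl v.
Proof.
elim: u => [|a u IH]; first by rewrite cylinder_nil setTI.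
rewrite /= !cylinder_cons IH; apply/seteqP; split=> x /=.
  by move=> [ax [ux vx]]; rewrite -iterS iterSr.
by move=> [[ax ux]]; rewrite -iterS iterSr.
Qed.

Lemma cylinder_rcons w a : cyl (rcons w a) = cyl w `&` iter (size w) theta @^-1` a.
Proof.
rewrite -cats1 cylinder_cat cylinder_cons cylinder_nil.
by congr (_ `&` _); apply/seteqP; split=> x //= [].
Qed.

Lemma measurable_cylinder w : all inA w -> measurable (cyl w).
Proof.
elim: w => [|a w IH] /=; first by rewrite cylinder_nil.
move=> /andP[/set_mem aa /IH mw]; rewrite cylinder_cons.
exact: mm_preimage MM _ _ aa mw.
Qed.

Definition cylmass (w : seq (set X)) : R := fine (mu (cyl w)).

Lemma cylmassE w : all inA w -> (cylmass w)%:E = mu (cyl w).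
Proof.
by move=> Aw; rewrite fineK// fin_num_measure//; exact: measurable_cylinder.
Qed.

Lemma cylmass_ge0 w : (0 <= cylmass w)%R.
Proof. by rewrite fine_ge0. Qed.

End markov_cylinders.

Section markov_distortion.
Local Open Scope ereal_scope.
Context {R : realType} {d : measure_display} {X : measurableType d}.
Variables (mu : probability X R) (alpha : set (set X)) (theta : X -> X).
Hypothesis GM : gibbs_markov_full_branches mu alpha theta.
Hypothesis mu_inv : invariant_measure mu theta.

Local Notation inA := (fun a : set X => a \in alpha).
Local Notation cyl := (cylinder theta).
Local Notation wt := (cylmass mu theta).

Let MM : markov_map mu alpha theta. Proof. by case: GM. Qed.
Let mtheta := measurable_markov GM.

Let mpre k B : measurable B -> measurable (iter k theta @^-1` B).
Proof. exact: measurable_preimage_iter. Qed.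

Lemma measurable_iter k : measurable_fun [set: X] (iter k theta).
Proof. by move=> _ B mB; rewrite setTI; exact: mpre. Qed.

(** By invariance [theta^-1 [z]] has the mass of [[z]], and the first letter partitions it. *)
Lemma cylmass_massl z : all inA z -> \esum_(a in alpha) (wt (a :: z))%:E = (wt z)%:E.
Proof.
move=> Az; have mz := measurable_cylinder GM Az.
rewrite (cylmassE GM)// -(invariant_iter GM mu_inv 1 mz).
rewrite (measure_partition _ (mm_countable MM) (mm_partition MM) (mm_measurable MM)
  mtheta 0); last exact: mpre.
apply: eq_esum => a aa; rewrite (cylmassE GM) /=; last by rewrite mem_set.
by rewrite cylinder_cons setIC.
Qed.

Lemma cylmass_massr z : all inA z -> \esum_(a in alpha) (wt (rcons z a))%:E = (wt z)%:E.
Proof.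
move=> Az; have mz := measurable_cylinder GM Az.
rewrite (cylmassE GM)// (measure_partition _ (mm_countable MM) (mm_partition MM)
  (mm_measurable MM) mtheta (size z))//.
apply: eq_esum => a aa; rewrite (cylmassE GM) ?cylinder_rcons//.
by rewrite all_rcons mem_set.
Qed.

Lemma cylmass_nil : wt [::] = 1%R.
Proof. by rewrite /cylmass cylinder_nil probability_setT. Qed.

(* [phi w] is the density of this measure. *)
Definition pull (w : seq (set X)) (B : set X) : \bar R :=
  mu (cyl w `&` iter (size w) theta @^-1` B).

Lemma pull_cyl w z : all inA w -> all inA z -> pull w (cyl z) = (wt (w ++ z))%:E.
Proof. by move=> Aw Az; rewrite (cylmassE GM) ?all_cat ?Aw// cylinder_cat. Qed.

Lemma pull_cons a w B :
  pull (a :: w) B = mu (a `&` theta @^-1` (cyl w `&` iter (size w) theta @^-1` B)).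
Proof.
rewrite /pull cylinder_cons -setIA; congr (mu (_ `&` _)).
by apply/seteqP; split=> x /=; rewrite -iterS iterSr.
Qed.

Lemma inj_iter_cyl w : all inA w -> set_inj (cyl w) (iter (size w) theta).
Proof.
elim: w => [|a w IH] //=; first by move=> _ x y.
move=> /andP[/set_mem aa Aw] x y; rewrite cylinder_cons !inE => -[ax wx] [ay wy].
rewrite [size _]/= !iterSr => /(IH Aw _ _ (mem_set wx) (mem_set wy)).
by apply: (mm_inj MM aa); rewrite inE.
Qed.

Lemma tau_image w A : all inA w ->
  tau theta w @` (A `&` iter (size w) theta @` cyl w) =
  cyl w `&` iter (size w) theta @^-1` A.
Proof.
move=> Aw; apply/seteqP; split=> [_ [x [Ax [y wy yx]] <-]|y [wy Ay]].
  rewrite /tau; case: xgetP => [z -> [wz zx]|/(_ y)[]//]; by rewrite /= zx.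
exists (iter (size w) theta y); first by split => //; exists y.
rewrite /tau; case: xgetP => [z _ [wz zx]|/(_ y)[]//].
exact: (inj_iter_cyl Aw (mem_set wz) (mem_set wy)).
Qed.

Lemma pull_null w B : all inA w -> measurable B -> mu B = 0 -> pull w B = 0.
Proof.
move=> Aw mB B0; apply: (@subset_measure0 _ _ _ mu _ (iter (size w) theta @^-1` B)).
- by apply: measurableI; [exact: (measurable_cylinder GM Aw)|exact: mpre].
- exact: mpre.
- exact: subIsetr.
- exact: (etrans (invariant_iter GM mu_inv _ mB) B0).
Qed.

(** One letter at a time: non-singularity carries a null set of the form [a] intersected with
    [theta^-1 C] to the part of [C] inside [theta a], which is all of [C] up to a null set since the
    branch is full. *)
Lemma pull_null_inv w B : all inA w -> measurable B -> pull w B = 0 -> mu B = 0.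
Proof.
elim: w => [|a w IH] Aw mB.
  by rewrite /pull cylinder_nil setTI.
move: Aw => /= /andP[/set_mem aa Aw]; rewrite pull_cons => h.
apply: IH => //; rewrite /pull; set C := _ `&` _.
have mC : measurable C.
  by apply: measurableI; [exact: (measurable_cylinder GM Aw)|exact: mpre].
have mP : measurable (a `&` theta @^-1` C) by exact: mm_preimage MM _ _ aa mC.
have ma := mm_measurable MM aa.
have mT : measurable (theta @` a) by exact: mm_image MM _ _ aa ma _.
have /(mm_nonsingular MM aa mP) : a `&` theta @^-1` C `<=` a by exact: subIsetl.
move=> /iffLR /(_ h).
rewrite (_ : theta @` _ = theta @` a `&` C); last first.
  apply/seteqP; split=> [_ [x [ax Cx] <-]|_ [[x ax <-] Cx]].
    by split => //; exists x.
  by exists x.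
case: GM => _ full _ TC0.
rewrite -(setIT C) -(setUv (theta @` a)) setIUr measureU0//.
- by rewrite setIC.
- exact: measurableI.
- by apply: measurableI => //; exact: measurableC.
- apply: (subset_measure0 _ _ _ (full _ aa)); last exact: subIsetr.
    by apply: measurableI => //; exact: measurableC.
  exact: measurableC.
Qed.

(** By invariance [pull w] is absolutely continuous, so a density exists and [phi] is not the
    default value of [xget]. *)
Lemma phi_density w : all inA w -> is_density mu theta w (phi mu theta w).
Proof.
move=> Aw; apply: xgetPex.
have mw := measurable_cylinder GM Aw.
have [f [mf f0 fE]] := restricted_image_density (mD := mw)
  (mT := measurable_iter (size w)) (fun B mB => pull_null Aw mB).
by exists f; split => // B mB; rewrite fE// tau_image.
Qed.

Lemma measurable_phi w : all inA w -> measurable_fun [set: X] (phi mu theta w).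
Proof. by case/phi_density. Qed.

Lemma phi_ge0 w x : all inA w -> (0 <= phi mu theta w x)%R.
Proof. by case/phi_density => _ + _; apply. Qed.

Lemma integral_phi w B : all inA w -> measurable B ->
  \int[mu]_(x in B) (phi mu theta w x)%:E = pull w B.
Proof. by move=> Aw mB; case: (phi_density Aw) => _ _ ->//; rewrite tau_image. Qed.

Lemma admissible_word w : (0 < size w)%N -> all inA w -> admissible mu alpha theta w.
Proof.
move=> w0 Aw; have wa k : (k < size w)%N -> alpha (nth set0 w k).
  by move=> kw; apply: set_mem; exact: (allP Aw _ (mem_nth _ kw)).
split=> // k kw; case: GM => _ full _.
have ak := wa _ (ltnW kw).
have mT : measurable (theta @` nth set0 w k).
  exact: (mm_image MM ak (mm_measurable MM ak) (@subset_refl _ _)).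
apply: (subset_measure0 _ _ _ (full _ ak)); last by move=> x [].
  by apply: measurableD => //; exact: (mm_measurable MM (wa _ kw)).
exact: measurableC.
Qed.

(** Required to pass from the Gibbs bound, which concerns logarithms, to ratios of densities. The
    zero set of [phi w] has [pull w] equal to 0, hence is null. *)
Lemma phi_gt0_ae w : all inA w -> \forall x \ae mu, (0 < phi mu theta w x)%R.
Proof.
move=> Aw.
have mZ : measurable (phi mu theta w @^-1` [set 0%R]).
  by rewrite -[_ @^-1` _]setTI; exact: measurable_phi.
exists (phi mu theta w @^-1` [set 0%R]); split => //.
  apply: (pull_null_inv Aw mZ); rewrite -integral_phi//.
  by rewrite (eq_integral (cst 0)) ?integral0// => x /[!inE] /= ->.
move=> x /= /negP; rewrite -leNgt => h; apply/le_anti; rewrite h.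
exact: phi_ge0.
Qed.
End markov_distortion.

(** * Bounded distortion on cylinders *)

Section distortion.
Local Open Scope ereal_scope.
Context {R : realType} {d : measure_display} {X : measurableType d}.
Variables (mu : probability X R) (alpha : set (set X)) (theta : X -> X).
Hypothesis GM : gibbs_markov_full_branches mu alpha theta.
Hypothesis mu_inv : invariant_measure mu theta.

Local Notation inA := (fun a : set X => a \in alpha).
Local Notation cyl := (cylinder theta).
Local Notation plw := (pull mu theta).

Lemma d_r_cylinder (r : R) z x y : (0 < r < 1)%R -> all inA z ->
  cyl z x -> cyl z y -> (d_r alpha theta r x y <= r ^+ size z)%R.
Proof.
move=> /andP[r0 r1] Az zx zy; rewrite /d_r.
case: pselect => [h|_]; last by rewrite exprn_ge0// ltW.
case: ex_minnP => n /asboolP dn _.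
(* The first difference has 0-based position [n >= size z], and [d_r] is [r ^+ n.+1] there. *)
rewrite ler_wiXn2l ?(ltW r0) ?(ltW r1)// leqW// leqNgt; apply/negP => nz.
apply: (dn (nth set0 z n)).
  by apply: set_mem; exact: (allP Az _ (mem_nth _ nz)).
by split; [exact: zx|exact: zy].
Qed.

(** The exceptional set depends on [w] only: it joins those of the two variables of the Gibbs bound
    to the zero set of [phi w]. *)
Lemma phi_distortion : exists C r : R, [/\ (0 < C)%R, (0 < r < 1)%R &
  forall w, (0 < size w)%N -> all inA w ->
    exists2 N : set X, measurable N /\ mu N = 0 &
      forall z x y, all inA z -> cyl z x -> cyl z y -> ~ N x -> ~ N y ->
        (phi mu theta w x <= expR (C * r ^+ size z) * phi mu theta w y)%R].
Proof.
case: (GM) => _ _ [C [r [C0 r01 dist]]]; exists C, r; split => // w w0 Aw.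
have [[P Q] /= [[NP [mNP NP0 subP]] [NQ [mNQ NQ0 subQ]]] PQ] :=
  dist _ (admissible_word GM w0 Aw).
have [Nphi [mNphi Nphi0 subphi]] := phi_gt0_ae GM mu_inv Aw.
exists (NP `|` NQ `|` Nphi); first split.
- by do 2 apply: measurableU => //.
- rewrite measureU0//; last exact: measurableU.
  by rewrite measureU0.
move=> z x y Az zx zy; rewrite /setU /= => /not_orP[/not_orP[nPx _] nphx].
move=> /not_orP[/not_orP[_ nQy] nphy].
have Px : P x by apply: contrapT => nP; apply: nPx; exact: subP.
have Qy : Q y by apply: contrapT => nQ; apply: nQy; exact: subQ.
have px : (0 < phi mu theta w x)%R.
  by apply: contrapT => nP; apply: nphx; exact: subphi.
have py : (0 < phi mu theta w y)%R.
  by apply: contrapT => nP; apply: nphy; exact: subphi.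
have := PQ (x, y) (conj Px Qy); rewrite /=.
move=> /(le_trans (ler_norm _)) h.
rewrite -ler_ln ?posrE ?mulr_gt0 ?expR_gt0// lnM ?posrE ?expR_gt0// expRK.
rewrite -lerBlDr; apply: le_trans h _.
by rewrite ler_pM2l//; exact: d_r_cylinder.
Qed.

(** The pointwise bound, integrated over [x] in [B] and then over [y] in [B']. The product form also
    covers null sets. *)
Lemma pull_distortion : exists C r : R, [/\ (0 < C)%R, (0 < r < 1)%R &
  forall w z B B', all inA w -> all inA z -> measurable B -> measurable B' ->
    B `<=` cyl z -> B' `<=` cyl z ->
    plw w B * mu B' <= (expR (C * r ^+ size z))%:E * (plw w B' * mu B)].
Proof.
have [C [r [C0 r01 dist]]] := phi_distortion.
exists C, r; split => // w z B B' Aw Az mB mB' Bz B'z.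
set K := expR _.
have K1 : (1 <= K)%R.
  rewrite -[leLHS]expR0 ler_expR mulr_ge0 ?(ltW C0)//.
  by case/andP: r01 => r0 _; rewrite exprn_ge0// ltW.
(* The Gibbs bound concerns nonempty words; for the empty one [pull] is [mu] itself. *)
have [->|w0] := eqVneq w [::].
  have pull0 D : plw [::] D = mu D by rewrite /pull cylinder_nil setTI.
  rewrite !pull0 muleC -[leLHS]mul1e lee_wpmul2r ?lee_fin ?mule_ge0//.
have sw : (0 < size w)%N by rewrite lt0n size_eq0.
have [N [mN N0] distN] := dist _ sw Aw.
have p0 x := phi_ge0 GM mu_inv x Aw.
have mphi D : measurable_fun D (fun x => (phi mu theta w x)%:E).
  apply/measurable_EFinP; apply: (measurable_funS measurableT) => //.
  exact: (measurable_phi GM mu_inv Aw).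
have pullB : forall y, B' y -> ~ N y -> plw w B <= (K * phi mu theta w y)%:E * mu B.
  move=> y B'y Ny.
  rewrite -(integral_phi GM mu_inv Aw mB) -integral_cst//.
  apply: ae_ge0_le_integral => //.
  - by move=> x _; rewrite lee_fin.
  - by move=> x _; rewrite lee_fin mulr_ge0// expR_ge0.
  exists N; split => // x /= /not_implyP[Bx]; apply: contra_notP => Nx.
  by rewrite lee_fin; apply: distN => //; [exact: Bz|exact: B'z].
have pw : plw w B \is a fin_num.
  apply: fin_num_measure; apply: measurableI; first exact: (measurable_cylinder GM).
  exact: (measurable_preimage_iter (measurable_markov GM)).
rewrite -(fineK pw) -integral_cst//.
have muB : mu B \is a fin_num by exact: fin_num_measure.
rewrite -(integral_phi GM mu_inv Aw mB') -(fineK muB) [_ * (fine _)%:E]muleC muleA -EFinM.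
rewrite -ge0_integralZl//; last 2 first.
- by move=> x _; rewrite lee_fin.
- by rewrite lee_fin mulr_ge0 ?expR_ge0// fine_ge0.
apply: ae_ge0_le_integral => //.
- by move=> x _; rewrite lee_fin fine_ge0.
- by move=> x _; rewrite mule_ge0 ?lee_fin// mulr_ge0 ?expR_ge0// fine_ge0.
- by apply: measurable_funeM.
exists N; split => // y /= /not_implyP[B'y]; apply: contra_notP => Ny.
rewrite -EFinM mulrAC fineK// EFinM fineK//; exact: pullB.
Qed.

End distortion.

Section change_of_variables.
Local Open Scope ereal_scope.
Context {R : realType} {d : measure_display} {X : measurableType d}.
Variables (mu : probability X R) (D : set X) (T : X -> X).
Variables (mD : measurable D) (mT : measurable_fun [set: X] T).

Lemma integral_density (nu : {finite_measure set X -> \bar R}) (psi : X -> R)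
    (f : X -> \bar R) (B : set X) :
  measurable_fun [set: X] psi -> (forall x, 0 <= psi x)%R ->
  (forall B, measurable B -> \int[mu]_(x in B) (psi x)%:E = nu B) ->
  measurable B -> measurable_fun B f -> (forall x, 0 <= f x) ->
  \int[nu]_(x in B) f x = \int[mu]_(x in B) (f x * (psi x)%:E).
Proof.
move=> mpsi psi0 psiE mB mf f0.
have numu : nu `<< mu.
  apply/null_content_dominatesP => C mC C0; rewrite -psiE//.
  by apply: null_set_integral => //; apply/measurable_EFinP; exact: measurable_funTS.
rewrite -(Radon_Nikodym_SigmaFinite.change_of_variables numu)//.
set g := Radon_Nikodym_SigmaFinite.f nu mu.
have ig := Radon_Nikodym_SigmaFinite.f_integrable numu.
have mg : measurable_fun [set: X] g by exact: measurable_int ig.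
have g0 x : 0 <= g x by exact: Radon_Nikodym_SigmaFinite.f_ge0.
have mpsiE : measurable_fun [set: X] (fun x => (psi x)%:E) by exact/measurable_EFinP.
have gpsi : ae_eq mu [set: X] g (fun x => (psi x)%:E).
  apply: integral_ae_eq => // C _ mC.
  by rewrite psiE// (Radon_Nikodym_SigmaFinite.f_integral numu).
apply: ge0_ae_eq_integral => //.
- by apply: emeasurable_funM => //; exact: measurable_funTS.
- by apply: emeasurable_funM => //; exact: measurable_funTS.
- by move=> x _; exact: mule_ge0.
- by move=> x _; rewrite mule_ge0// lee_fin.
by case: gpsi => N [mN N0 sN]; exists N; split => // x /= h; apply: sN => /= gx;
  apply: h => _; rewrite gx.
Qed.

Lemma integral_restricted_image (f : X -> \bar R) (B : set X) :
  measurable B -> measurable_fun [set: X] f -> (forall x, 0 <= f x) ->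
  \int[restricted_image mu mD mT]_(x in B) f x =
  \int[mu]_(x in D `&` T @^-1` B) f (T x).
Proof.
move=> mB mf f0.
(* With the identity as map this is the restriction of [mu] to [D], whose density is [\1_D]; its
   image under [T] is the measure on the left. *)
pose nu := restricted_image mu mD (@measurable_id _ X [set: X]).
have mTB : measurable (T @^-1` B) by rewrite -[_ @^-1` _]setTI; exact: mT.
transitivity (\int[nu]_(x in T @^-1` B) (f \o T) x).
  rewrite -(ge0_integral_pushforward mT nu mB)//; last exact: measurable_funTS.
rewrite (integral_density (psi := \1_D))//.
- rewrite integral_mkcondl; apply: eq_integral => x _.
  rewrite patchE indicE; case: ifP => _; rewrite ?mule1 ?mule0//.
- by move=> C mC; rewrite integral_indic// setIC.
- by apply: measurableT_comp => //; exact: measurable_funTS.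
- by move=> x; exact: f0.
Qed.
End change_of_variables.

(** * The transfer operator *)

Section letter_transport.
Local Open Scope ereal_scope.
Context {R : realType} {d : measure_display} {X : measurableType d}.
Variables (mu : probability X R) (alpha : set (set X)) (theta : X -> X).
Hypothesis GM : gibbs_markov_full_branches mu alpha theta.
Hypothesis mu_inv : invariant_measure mu theta.

Local Notation inA := (fun a : set X => a \in alpha).

Let MM : markov_map mu alpha theta. Proof. by case: GM. Qed.

Let all1 a : alpha a -> all inA [:: a].
Proof. by move=> aa /=; rewrite mem_set. Qed.

Let cyl1 a : cylinder theta [:: a] = a.
Proof. by rewrite cylinder_cons cylinder_nil setIT. Qed.

Lemma tau_letterK a y : alpha a -> a y -> tau theta [:: a] (theta y) = y.
Proof.
move=> aa ay; rewrite /tau; case: xgetP => [z _ []|/(_ y)].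
  by rewrite cyl1 => az zy; apply: (mm_inj MM aa); rewrite ?inE.
by rewrite cyl1 => -[].
Qed.

Lemma measurable_tau a : alpha a -> measurable_fun [set: X] (tau theta [:: a]).
Proof.
move=> aa _ B mB; rewrite setTI.
have ma := mm_measurable MM aa.
have maB : measurable (a `&` B) by exact: measurableI.
have mT : measurable (theta @` a) by exact: (mm_image MM aa ma (@subset_refl _ _)).
(* Outside [theta a] the map [tau] takes its dummy value, the identity. *)
rewrite (_ : _ @^-1` B = theta @` (a `&` B) `|` (B `\` theta @` a)).
  apply: measurableU; last exact: measurableD.
  by apply: (mm_image MM aa maB); exact: subIsetl.
apply/seteqP; split=> [x /=|x [[y [ay By] <-]|[Bx nx]] /=].
- have [[y ay <-]|nx] := pselect ((theta @` a) x).
    by rewrite tau_letterK// => By; left; exists y.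
  rewrite /tau; case: xgetP => [z _ [+ zx]|_ Bx]; last by right.
  by rewrite cyl1 => az; case: nx; exists z.
- by rewrite tau_letterK.
- rewrite /tau; case: xgetP => [z _ [+ zx]|_ //].
  by rewrite cyl1 => az; case: nx; exists z.
Qed.

(** The substitution [x = theta y] on the branch [a]. *)
Lemma integral_letter a (u : X -> \bar R) B : alpha a ->
  measurable B -> measurable_fun [set: X] u -> (forall x, 0 <= u x) ->
  \int[mu]_(x in B) ((phi mu theta [:: a] x)%:E * u (tau theta [:: a] x)) =
  \int[mu]_(x in a `&` theta @^-1` B) u x.
Proof.
move=> aa mB mu_ u0.
have ma := mm_measurable MM aa.
have mut : measurable_fun [set: X] (u \o tau theta [:: a]).
  by apply: measurableT_comp => //; exact: measurable_tau.
transitivity (\int[restricted_image mu ma (measurable_markov GM)]_(x in B)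
    (u \o tau theta [:: a]) x).
  rewrite [RHS](integral_density (mu := mu) (measurable_phi GM mu_inv (all1 aa)))//.
  - by apply: eq_integral => x _; rewrite muleC.
  - by move=> x; exact: (phi_ge0 GM mu_inv x (all1 aa)).
  - move=> C mC; rewrite (integral_phi GM mu_inv (all1 aa) mC).
    by rewrite pull_cons cylinder_nil setTI.
  - exact: measurable_funTS.
  - by move=> x; exact: u0.
rewrite integral_restricted_image//; last by move=> x; exact: u0.
by apply: eq_integral => x /[!inE] -[ax _]; rewrite /= tau_letterK.
Qed.

End letter_transport.

Section positive_transfer.
Local Open Scope ereal_scope.
Context {R : realType} {d : measure_display} {X : measurableType d} {V : pointedType}.
Variables (mu : probability X R) (alpha : set (set X)) (theta : X -> X).
Variable (kappa : X -> V -> V).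
Hypothesis GM : gibbs_markov_full_branches mu alpha theta.
Hypothesis mu_inv : invariant_measure mu theta.

Local Notation inA := (fun a : set X => a \in alpha).
Local Notation Y := (X * discrete_mtype V)%type.
Local Notation kb := (kappa_inv kappa).
Local Notation That := (transfer mu alpha theta kappa).

Let MM : markov_map mu alpha theta. Proof. by case: GM. Qed.
Let all1 a : alpha a -> all inA [:: a].
Proof. by move=> aa /=; rewrite mem_set. Qed.

(* Free of subtraction and [fine], so that it can be iterated by Tonelli. *)
Definition transfer_ge0 (h : Y -> \bar R) (y : Y) : \bar R :=
  \esum_(a in alpha) ((phi mu theta [:: a] y.1)%:E *
                      h (tau theta [:: a] y.1, kb a y.2)).

Definition fibre_measurable (h : Y -> \bar R) : Prop :=
  forall g : V, measurable_fun [set: X] (fun x => h (x, g)).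

Let phi0 a x : alpha a -> (0 <= phi mu theta [:: a] x)%R.
Proof. by move=> aa; exact: (phi_ge0 GM mu_inv x (all1 aa)). Qed.

Lemma transfer_ge0_ge0 h y : (forall z, 0 <= h z) -> 0 <= transfer_ge0 h y.
Proof. by move=> h0; apply: esum_ge0 => a aa; rewrite mule_ge0// lee_fin phi0. Qed.

Lemma iter_transfer_ge0_ge0 k h y : (forall z, 0 <= h z) ->
  0 <= iter k transfer_ge0 h y.
Proof. by move=> h0; elim: k y => [//|k IH] y; exact: transfer_ge0_ge0. Qed.

Lemma le_transfer_ge0 h h' y : (forall z, h z <= h' z) ->
  transfer_ge0 h y <= transfer_ge0 h' y.
Proof. by move=> hh; apply: le_esum => a aa; rewrite lee_wpmul2l// lee_fin phi0. Qed.

Let measurable_term h a g : alpha a -> fibre_measurable h ->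
  measurable_fun [set: X] (fun x => (phi mu theta [:: a] x)%:E *
    h (tau theta [:: a] x, kb a g)).
Proof.
move=> aa mh; apply: emeasurable_funM.
  by apply/measurable_EFinP; exact: (measurable_phi GM mu_inv (all1 aa)).
apply: (measurableT_comp (mh (kb a g))); exact: (measurable_tau GM aa).
Qed.

Lemma fibre_measurable_transfer_ge0 h : (forall z, 0 <= h z) ->
  fibre_measurable h -> fibre_measurable (transfer_ge0 h).
Proof.
move=> h0 mh g; rewrite /transfer_ge0 /=.
apply: (measurable_esum (f := fun a x => (phi mu theta [:: a] x)%:E *
  h (tau theta [:: a] x, kb a g))); first exact: mm_countable MM.
- by move=> a aa; exact: measurable_term.
- by move=> a x aa; rewrite mule_ge0// lee_fin phi0.
Qed.

Lemma fibre_measurable_iter k h : (forall z, 0 <= h z) ->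
  fibre_measurable h -> fibre_measurable (iter k transfer_ge0 h).
Proof.
move=> h0 mh; elim: k => [//|k IH] /=; apply: fibre_measurable_transfer_ge0 => //.
by move=> z; exact: iter_transfer_ge0_ge0.
Qed.

Lemma integral_transfer_ge0 h B (g : V) : measurable B -> (forall z, 0 <= h z) ->
  fibre_measurable h ->
  \int[mu]_(x in B) transfer_ge0 h (x, g) =
  \esum_(a in alpha) \int[mu]_(x in a `&` theta @^-1` B) h (x, kb a g).
Proof.
move=> mB h0 mh; rewrite /transfer_ge0 /=.
rewrite (@integral_esum _ _ _ mu _ alpha (fun a x => (phi mu theta [:: a] x)%:E *
  h (tau theta [:: a] x, kb a g)))//.
- apply: eq_esum => a aa.
  exact: (@integral_letter _ _ _ mu alpha theta GM mu_inv a (fun x => h (x, kb a g)) B).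
- exact: mm_countable MM.
- by move=> a aa; apply: measurable_funTS; exact: measurable_term.
- by move=> a x aa; rewrite mule_ge0// lee_fin phi0.
Qed.

(** Integrating over sets replaces a chain rule for [phi] by the substitution of one letter at a
    time. The outermost operator contributes the last letter of the word. *)
Lemma integral_iter_transfer_ge0 k h B (g : V) : measurable B ->
  (forall z, 0 <= h z) -> fibre_measurable h ->
  \int[mu]_(x in B) iter k transfer_ge0 h (x, g) =
  \esum_(w in words alpha k)
    \int[mu]_(x in cylinder theta w `&` iter k theta @^-1` B) h (x, kinv kb w g).
Proof.
move=> mB h0 mh; elim: k B g mB => [|k IH] B g mB.
  by rewrite words0 esum_set1 ?cylinder_nil ?setTI//; exact: integral_ge0.
rewrite iterS integral_transfer_ge0//; last 2 first.
- by move=> z; exact: iter_transfer_ge0_ge0.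
- exact: fibre_measurable_iter.
rewrite esum_words_rcons; last by move=> w; exact: integral_ge0.
rewrite esumC; last by move=> w a _ _; exact: integral_ge0.
apply: eq_esum => a aa; rewrite IH; last exact: mm_preimage MM _ _ aa mB.
apply: eq_esum => w [sw _]; rewrite cylinder_rcons /kinv foldr_rcons.
by congr (\int[mu]_(x in _) _); rewrite -setIA sw.
Qed.

Lemma abse_fine_sub (p q : \bar R) : 0 <= p -> 0 <= q ->
  `|fine (p - q)|%:E <= p + q.
Proof.
case: p => [p| |//]; case: q => [q| |//] //=; rewrite ?leey// ?lee_fin ?normr0.
by move=> p0 q0; rewrite ler_norml; lra.
Qed.

(** True at every point: where the difference of the two sums is infinite, [fine] returns 0. *)
Lemma abs_transfer_le (f : Y -> R) y :
  `|That f y|%:E <= transfer_ge0 (fun z => `|f z|%:E) y.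
Proof.
set F := fun a : set X => (phi mu theta [:: a] y.1 *
  f (tau theta [:: a] y.1, kb a y.2))%:E.
have -> : That f y = fine (\esum_(a in alpha) F^\+ a - \esum_(a in alpha) F^\- a) by [].
apply: le_trans (abse_fine_sub _ _) _; [exact: esum_ge0|exact: esum_ge0|].
rewrite -esumD//; apply: le_esum => a aa.
have /(congr1 (@^~ a)) /= <- := fune_abse F.
by rewrite /F /= normrM EFinM ger0_norm// phi0.
Qed.

Lemma transferE (f : Y -> R) y : (forall z, 0 <= f z)%R ->
  That f y = fine (transfer_ge0 (EFin \o f) y).
Proof.
move=> f0.
set F := fun a : set X => (phi mu theta [:: a] y.1 *
  f (tau theta [:: a] y.1, kb a y.2))%:E.
have -> : That f y = fine (\esum_(a in alpha) F^\+ a - \esum_(a in alpha) F^\- a) by [].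
have F0 a : alpha a -> 0 <= F a by move=> aa; rewrite lee_fin mulr_ge0// phi0.
rewrite (esum1 (a := F^\-)) ?sube0 => [|a aa]; last first.
  by rewrite funenegE max_r// oppe_le0 F0.
congr fine; apply: eq_esum => a aa.
by rewrite funeposE max_l ?F0// /F EFinM.
Qed.

Lemma abs_iter_transfer_le k (f : Y -> R) y :
  `|iter k That f y|%:E <= iter k transfer_ge0 (fun z => `|f z|%:E) y.
Proof.
elim: k y => [//|k IH] y; apply: le_trans (abs_transfer_le _ _) _.
exact: le_transfer_ge0.
Qed.

Lemma transfer_nonneg k (f : Y -> R) : (forall z, 0 <= f z)%R ->
  forall z, (0 <= iter k That f z)%R.
Proof.
move=> f0; elim: k => [//|k IH] z /=; rewrite transferE// fine_ge0//.
by apply: transfer_ge0_ge0 => y; rewrite lee_fin.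
Qed.

Lemma integral_fine (u : X -> \bar R) B : measurable B ->
  measurable_fun [set: X] u -> (forall x, 0 <= u x) ->
  \int[mu]_x u x < +oo ->
  \int[mu]_(x in B) (fine (u x))%:E = \int[mu]_(x in B) u x.
Proof.
move=> mB mu_ u0 uoo.
have iu : mu.-integrable [set: X] u.
  apply/integrableP; split => //.
  by under eq_integral do rewrite gee0_abs//.
have [N [mN N0 sN]] := integrable_ae measurableT iu.
apply: ge0_ae_eq_integral => //.
- apply: measurable_funTS; apply/measurable_EFinP.
  by apply: measurableT_comp => //; exact: fine_measurable.
- exact: measurable_funTS.
- by move=> x _; rewrite lee_fin fine_ge0.
exists N; split => // x /= h; apply: sN => /= /(_ I) ux.
by apply: h => _; rewrite fineK.
Qed.

Lemma fibre_measurable_iter_transfer k (f : Y -> R) : (forall z, 0 <= f z)%R ->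
  fibre_measurable (EFin \o f) -> fibre_measurable (EFin \o iter k That f).
Proof.
move=> f0 mf; elim: k => [//|k IH] g; apply/measurable_EFinP.
have fk0 z : (0 <= iter k That f z)%R by exact: transfer_nonneg.
rewrite (_ : (fun x => _) =
    fine \o (fun x => transfer_ge0 (EFin \o iter k That f) (x, g))).
  apply: measurableT_comp; first exact: fine_measurable.
  exact: (fibre_measurable_transfer_ge0 (h := EFin \o iter k That f)).
by apply/funext => x /=; rewrite transferE.
Qed.

(** Boundedness of [f] makes the positive iterates integrable, hence finite almost everywhere, so
    that the [fine] inside [transfer] does not change integrals. *)
Lemma integral_iter_transfer k (f : Y -> R) (M : R) B (g : V) : measurable B ->
  (forall z, 0 <= f z <= M)%R -> fibre_measurable (EFin \o f) ->
  \int[mu]_(x in B) (iter k That f (x, g))%:E =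
  \esum_(w in words alpha k)
    \int[mu]_(x in cylinder theta w `&` iter k theta @^-1` B)
      (f (x, kinv kb w g))%:E.
Proof.
move=> mB fM mf.
have f0 z : (0 <= f z)%R by case/andP: (fM z).
have M0 : (0 <= M)%R.
  by have := fM (point, point); case/andP => /le_trans; apply.
have f0E z : 0 <= (EFin \o f) z by rewrite lee_fin.
suff H : forall B g, measurable B ->
    \int[mu]_(x in B) (iter k That f (x, g))%:E =
    \int[mu]_(x in B) iter k transfer_ge0 (EFin \o f) (x, g).
  by rewrite H//; exact: integral_iter_transfer_ge0.
elim: k {B g mB} => [//|k IH].
have mk := fibre_measurable_iter_transfer k f0 mf.
have fk0 z : 0 <= (EFin \o iter k That f) z by rewrite lee_fin transfer_nonneg.
have mTk := fibre_measurable_transfer_ge0 fk0 mk.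
have TE B' (g' : V) : measurable B' ->
    \int[mu]_(x in B') transfer_ge0 (EFin \o iter k That f) (x, g') =
    \int[mu]_(x in B') iter k.+1 transfer_ge0 (EFin \o f) (x, g').
  move=> mB'; rewrite iterS !integral_transfer_ge0//.
  - apply: eq_esum => a aa; apply: IH; exact: mm_preimage MM _ _ aa mB'.
  - by move=> z; exact: iter_transfer_ge0_ge0.
  - exact: fibre_measurable_iter.
move=> B' g' mB'; rewrite -TE//.
transitivity (\int[mu]_(x in B')
    (fine (transfer_ge0 (EFin \o iter k That f) (x, g')))%:E).
  by apply: eq_integral => x _ /=; rewrite transferE// => z; exact: transfer_nonneg.
apply: (@integral_fine (fun x => transfer_ge0 (EFin \o iter k That f) (x, g'))) => //.
  by move=> x; exact: transfer_ge0_ge0.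
rewrite TE// integral_iter_transfer_ge0//.
apply: le_lt_trans (ltry M).
apply: le_trans (_ : \esum_(w in words alpha k.+1) (M%:E * (cylmass mu theta w)%:E) <= _).
  apply: le_esum => w [_ Aw].
  have mw : measurable (cylinder theta w) := measurable_cylinder GM Aw.
  rewrite preimage_setT setIT (cylmassE GM)// -integral_cst//.
  apply: ge0_le_integral => //.
  - by apply: measurable_funTS; exact: mf.
  - by move=> x _; rewrite lee_fin; case/andP: (fM (x, kinv kb w g')).
rewrite esumZl// => [|w _]; last by rewrite lee_fin cylmass_ge0.
rewrite (mass_words (cylmass_ge0 mu theta) (cylmass_nil mu theta)) ?mule1//.
exact: (cylmass_massl GM mu_inv).
Qed.

End positive_transfer.

(** * Graph extensions and amenability *)

Section graph_extension.
Local Open Scope ereal_scope.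
Context {R : realType} {d : measure_display} {X : measurableType d} {V : pointedType}.
Variables (mu : probability X R) (alpha : set (set X)) (theta : X -> X).
Variables (E : set (V * V)) (kappa : X -> V -> V).
Hypothesis GM : gibbs_markov_full_branches mu alpha theta.
Hypothesis mu_inv : invariant_measure mu theta.
Hypothesis cocycle : nearest_neighbour_cocycle alpha E kappa.

Local Notation inA := (fun a : set X => a \in alpha).
Local Notation kb := (kappa_inv kappa).
Local Notation m := (cylmass mu theta).

Let MM : markov_map mu alpha theta. Proof. by case: GM. Qed.

(** Any point of [a] would do, by the cocycle condition ([kappa_letterE]). *)
Definition kappa_letter (a : set X) (g : V) : V := kappa (xget point a) g.
Local Notation kf := kappa_letter.

Lemma kappa_letterE a y : alpha a -> a y -> kf a = kappa y.
Proof.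
case: cocycle => _ _ const aa ay; apply/funext => g.
by rewrite /kf (const a (xget point a) y aa _ ay)//; exact: xgetPex (ex_intro _ y ay).
Qed.

Lemma letter_inhabited a : alpha a -> exists y, a y.
Proof. by case: (mm_partition MM) => _ _ ne /ne. Qed.

Lemma kappa_invK a : alpha a -> cancel (kb a) (kf a).
Proof.
move=> aa g; have [y ay] := letter_inhabited aa.
rewrite (kappa_letterE aa ay).
suff : [set h | forall y, a y -> kappa y h = g] (kb a g) by move=> /(_ _ ay).
apply: xgetPex; case: cocycle => bij _ const.
have [k _ kK] := bij y.
by exists (k g) => z az; rewrite (const _ _ _ aa az ay).
Qed.

Lemma kappa_letter_inj a : alpha a -> injective (kf a).
Proof.
move=> aa; have [y ay] := letter_inhabited aa; rewrite (kappa_letterE aa ay).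
by case: cocycle => bij _ _; exact: bij_inj (bij y).
Qed.

Lemma kappa_letterK a : alpha a -> cancel (kf a) (kb a).
Proof. by move=> aa g; apply: (kappa_letter_inj aa); rewrite kappa_invK. Qed.

Lemma kappa_inv_bij a : alpha a -> bijective (kb a).
Proof. by move=> aa; exists (kf a); [exact: kappa_invK|exact: kappa_letterK]. Qed.

(** Here [K j = exp (C r^j)]. The first clause compares [[z ++ z']] with [[z]] inside [[z]]. The
    next two use the empty word and compare the whole space with [[z]], and [B] with the whole
    space. *)
Lemma mass_distortion : exists K : nat -> R,
  [/\ forall w z z', all inA w -> all inA z -> all inA z' ->
        (m (w ++ z ++ z') * m z <= K (size z) * (m (w ++ z) * m (z ++ z')))%R,
      forall w z, all inA w -> all inA z -> (m w * m z <= K 0 * m (w ++ z))%R,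
      forall w B, all inA w -> measurable B ->
        pull mu theta w B <= (K 0 * m w)%:E * mu B &
      forall e : R, (0 < e)%R -> exists N, (K N <= 1 + e)%R].
Proof.
have [C [r [C0 r01 dist]]] := pull_distortion GM mu_inv.
have fm B : measurable B -> mu B = (fine (mu B))%:E.
  by move=> mB; rewrite fineK// fin_num_measure.
have dist' w z B B' : all inA w -> all inA z -> measurable B -> measurable B' ->
    B `<=` cylinder theta z -> B' `<=` cylinder theta z ->
    (pull mu theta w B * mu B' <= (expR (C * r ^+ size z))%:E * (pull mu theta w B' * mu B)).
  exact: dist.
exists (fun j => expR (C * r ^+ j)); split.
- move=> w z z' Aw Az Az'; have Azz' : all inA (z ++ z') by rewrite all_cat Az.
  have := dist w z _ _ Aw Az (measurable_cylinder GM Azz') (measurable_cylinder GM Az).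
  rewrite !(pull_cyl GM)// -!(cylmassE GM)// -!EFinM lee_fin; apply => //.
  by rewrite cylinder_cat; exact: subIsetl.
- move=> w z Aw Az.
  have := dist w [::] _ _ Aw isT measurableT (measurable_cylinder GM Az).
  rewrite -[X in pull _ _ _ X](cylinder_nil theta) !(pull_cyl GM)// cats0.
  rewrite cylinder_nil probability_setT mule1 -(cylmassE GM)// -!EFinM lee_fin.
  by apply => //; rewrite cylinder_nil.
- move=> w B Aw mB.
  have := dist w [::] _ _ Aw isT mB measurableT.
  rewrite probability_setT mule1 -[in pull _ _ _ [set: X]](cylinder_nil theta).
  rewrite (pull_cyl GM)// cats0 muleA -EFinM.
  by apply => //; rewrite cylinder_nil.
- move=> e e0.
  have [N _ /(_ _ (leqnn N)) HN] : \forall N \near \oo, (r ^+ N < ln (1 + e) / C)%R.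
    have r1 : (`|r| < 1)%R by case/andP: r01 => r0 r1; rewrite ger0_norm// ltW.
    have := cvg_expr r1 => /cvgrPdist_lt /(_ (ln (1 + e) / C)%R).
    have le0 : (0 < ln (1 + e) / C)%R by rewrite divr_gt0// ln_gt0// ltrDl.
    move=> /(_ le0); apply: filterS => N; rewrite sub0r normrN; apply: le_lt_trans.
    exact: ler_norm.
  exists N; rewrite -[leRHS]lnK ?posrE ?addr_gt0// ler_expR mulrC -ler_pdivlMr//.
  exact: ltW.
Qed.

(** Masses are supermultiplicative up to [K 0], so positivity passes from letters to words. *)
Lemma cylmass_gt0 w : all inA w -> (0 < m w)%R.
Proof.
have [K [_ rev _ _]] := mass_distortion.
elim: w => [|a w IH]; first by rewrite cylmass_nil.
move=> /= /andP[aA Aw]; have aa := set_mem aA.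
have ma : (0 < m [:: a])%R.
  rewrite -lte_fin (cylmassE GM) /= ?aA// cylinder_cons cylinder_nil setIT.
  exact: mm_pos MM _ aa.
have := rev [:: a] w; rewrite /= aA => /(_ isT Aw) h.
rewrite lt_neqAle cylmass_ge0 andbT; apply/eqP => m0.
by move: h; rewrite -m0 mulr0 leNgt mulr_gt0// IH.
Qed.

Definition itinerary (n : nat) (x : X) : seq (set X) :=
  [seq xget set0 [set a | alpha a /\ a (iter k theta x)] | k <- iota 0 n].

Lemma itineraryS n x : itinerary n.+1 x =
  rcons (itinerary n x) (xget set0 [set a | alpha a /\ a (iter n theta x)]).
Proof. by rewrite /itinerary -addn1 iotaD map_cat cats1. Qed.

Lemma letter_of x :
  let a := xget set0 [set a | alpha a /\ a x] in alpha a /\ a x.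
Proof.
have [a aa ax] := letterP (mm_partition MM) x.
have : exists a, [set a | alpha a /\ a x] a by exists a.
by move=> /(xgetPex set0).
Qed.

Lemma words_itinerary n x : words alpha n (itinerary n x).
Proof.
split; first by rewrite size_map size_iota.
apply/allP => _ /mapP[k _ ->]; rewrite mem_set//.
by case: (letter_of (iter k theta x)).
Qed.

Lemma kinv_itinerary n x g :
  kinv kb (itinerary n x) (kappa_iter theta kappa n x g) = g.
Proof.
elim: n => [//|n IH]; rewrite itineraryS /kinv foldr_rcons /=.
have [aa ax] := letter_of (iter n theta x).
by rewrite -(kappa_letterE aa ax) kappa_letterK.
Qed.

(** The points of the finite set [J] have finitely many itineraries of length [n], each of positive
    mass; [delta] is a lower bound for these masses. *)
Lemma loops_mass n : uniform_loops theta kappa n ->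
  exists2 delta : R, (0 < delta)%R & forall g, exists w,
    [/\ words alpha n w, (delta <= m w)%R & kinv kb w g = g].
Proof.
move=> [J /finite_seqP[s ->] loops].
have [delta d0 dle] : exists2 delta : R, (0 < delta)%R &
    forall x, x \in s -> (delta <= m (itinerary n x))%R.
  elim: (s) => [|x t [e e0 ele]]; first by exists 1%R.
  have mx : (0 < m (itinerary n x))%R.
    by apply: cylmass_gt0; case: (words_itinerary n x).
  exists (Num.min e (m (itinerary n x))); first by rewrite lt_min e0.
  move=> y; rewrite inE => /predU1P[->|/ele h]; first by rewrite ge_min lexx orbT.
  by rewrite ge_min h.
exists delta => // g; have [x /= xs xg] := loops g.
exists (itinerary n x); split; [exact: words_itinerary|exact: dle|].
by rewrite -{1}xg kinv_itinerary.
Qed.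

End graph_extension.

(** * Amenability as smallness of the flow *)

Section boundary_and_flow.
Local Open Scope ereal_scope.
Context {R : realType} {d : measure_display} {X : measurableType d} {V : pointedType}.
Variables (mu : probability X R) (alpha : set (set X)) (theta : X -> X).
Variables (E : set (V * V)) (kappa : X -> V -> V).
Hypothesis GM : gibbs_markov_full_branches mu alpha theta.
Hypothesis mu_inv : invariant_measure mu theta.
Hypothesis cocycle : nearest_neighbour_cocycle alpha E kappa.

Local Notation inA := (fun a : set X => a \in alpha).
Local Notation kb := (kappa_inv kappa).
Local Notation kf := (kappa_letter kappa).
Local Notation m := (cylmass mu theta).
Local Notation bd := (boundary mu E kappa).

Let MM : markov_map mu alpha theta. Proof. by case: GM. Qed.

Let mcyl1 a : alpha a -> (m [:: a])%:E = mu a.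
Proof.
by move=> aa; rewrite (cylmassE GM) /= ?mem_set// cylinder_cons cylinder_nil setIT.
Qed.

Let mass_partition B : measurable B -> mu B = \esum_(a in alpha) mu (B `&` a).
Proof.
exact: (measure_partition mu (mm_countable MM) (mm_partition MM)
  (mm_measurable MM) (measurable_markov GM) 0).
Qed.

Lemma measurable_edge (v u : V) : measurable [set x | kappa x v = u].
Proof.
rewrite (_ : [set x | _] = \bigcup_(a in alpha `&` [set a | kf a v = u]) a).
  apply: measurable_countable_bigcup => [|a [aa _]]; last exact: (mm_measurable MM aa).
  by apply: sub_countable (mm_countable MM); apply: subset_card_le; exact: subIsetl.
apply/seteqP; split=> [x /= xvu|x [a [aa /= avu] ax] /=].
  have [a aa ax] := letterP (mm_partition MM) x; exists a => //; split => //=.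
  by rewrite (kappa_letterE cocycle aa ax).
by rewrite -(kappa_letterE cocycle aa ax).
Qed.

Lemma edge_prob_ge a v : alpha a -> mu a <= edge_prob mu kappa (v, kf a v).
Proof.
move=> aa; apply: le_measure; rewrite ?inE.
- exact: (mm_measurable MM aa).
- exact: measurable_edge.
- by move=> x ax /=; rewrite (kappa_letterE cocycle aa ax).
Qed.

(* Finitely many letters carry all but [e] of the mass, and hence carry every
   edge of probability larger than [e]. *)
Lemma finite_letters (e : R) : (0 < e)%R -> exists s : seq (set X),
  [/\ all inA s,
      \esum_(a in alpha) (if a \in s then 0 else (m [:: a])%:E) <= e%:E &
      forall v u, e%:E < edge_prob mu kappa (v, u) -> exists2 a, a \in s & kf a v = u].
Proof.
move=> e0.
have total : \esum_(a in alpha) mu a = 1.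
  rewrite -(probability_setT mu) (mass_partition measurableT).
  by apply: eq_esum => a _; rewrite setTI.
have : (1 - e)%:E < \esum_(a in alpha) mu a by rewrite total lte_fin ltrBlDr ltrDl.
move=> /ereal_sup_gt[_ [F [finF Fa] <-]] eF.
pose s := fset_set F; pose U := \bigcup_(a in F) a.
have sF a : (a \in (s : seq _)) = (a \in F) by rewrite in_fset_set.
have mU : measurable U.
  by apply: fin_bigcup_measurable => // a Fa'; exact: (mm_measurable MM (Fa _ Fa')).
have Ule : \sum_(a \in F) mu a <= mu U.
  rewrite (mass_partition mU) -esum_fset//.
  rewrite (esum_mkcond F) [leRHS]esum_mkcond; apply: le_esum => a _.
  case: ifPn => [|_]; last by case: ifP.
  move=> /set_mem aF; rewrite mem_set; last exact: Fa.
  by rewrite setIidr// => x ax; exists a.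
have mCU : mu (~` U) < e%:E.
  rewrite probability_setC// lteBlDr ?fin_num_measure// addeC -lteBlDr//.
  by apply: lt_le_trans Ule; rewrite -EFinB.
exists s; split.
- by apply/allP => a; rewrite sF => /set_mem/Fa; exact: mem_set.
- apply: le_trans (ltW mCU); rewrite (mass_partition (measurableC mU)).
  apply: le_esum => a aa; case: ifPn => [_|]; first exact: measure_ge0.
  rewrite sF => /negP aF; rewrite mcyl1// setIidr// => x ax [b Fb bx].
  by apply: aF; rewrite mem_set// (letter_uniq (mm_partition MM) aa (Fa _ Fb) ax bx).
- move=> v u evu; apply: contrapT => nos.
  have : edge_prob mu kappa (v, u) <= mu (~` U).
    apply: le_measure; rewrite ?inE; [exact: measurable_edge|exact: measurableC|].
    move=> x /= xvu [a Fa' ax]; apply: nos; exists a; first by rewrite sF mem_set.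
    by rewrite (kappa_letterE cocycle (Fa _ Fa') ax).
  by rewrite leNgt => /negP; apply; exact: lt_trans evu.
Qed.

Lemma boundaryP eps (K : {fset V}) h : h \in bd eps K <->
  h \in K /\ exists u, [/\ E (h, u), u \notin K & eps%:E < edge_prob mu kappa (h, u)].
Proof.
rewrite !inE; split.
  move=> /andP[hK /asboolP[[v u] /= [Evu vh uK eu]]].
  by split => //; exists u; rewrite -vh.
by move=> [-> [u [Eu uK eu]]]; apply/asboolP; exists (h, u).
Qed.

(** [thicken] is applied to the finitely many letters that carry the edges of probability larger
    than [eps]; a boundary point leaves along one of them, hence lies in the exceptional set [B]. *)
Lemma boundary_of_flow n : (0 < n)%N ->
  (forall c : R, (0 < c)%R -> exists K : {fset V},
     flow (words alpha n) m (kinv kb) K < (c * #|` K|%:R)%:E) ->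
  forall eps delta : R, (0 < eps)%R -> (0 < delta)%R ->
    exists2 K : {fset V}, K != fset0 &
      (#|` bd eps K|%:R <= delta * #|` K|%:R)%R.
Proof.
move=> n0 small eps delta e0 d0.
have [s [sA _ sE]] := finite_letters e0.
have [K K0 [B Bd BP]] := thicken (cylmass_ge0 mu theta) (cylmass_gt0 GM mu_inv)
  (kappa_letterK GM cocycle) (kappa_invK GM cocycle) n0 sA d0 small.
exists K => //; apply: le_trans Bd; rewrite ler_nat.
apply: fsubset_leq_card; apply/fsubsetP => h /boundaryP[hK [u [_ uK /sE[a sa hu]]]].
by apply: (BP h a) => //; rewrite hu.
Qed.

(** Half of [e] pays for the rare letters, however many points they move; along the other letters a
    point can leave only from the boundary. *)
Lemma flow_of_boundary :
  (forall eps delta : R, (0 < eps)%R -> (0 < delta)%R ->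
    exists2 K : {fset V}, K != fset0 &
      (#|` bd eps K|%:R <= delta * #|` K|%:R)%R) ->
  forall e : R, (0 < e)%R -> exists2 K : {fset V}, K != fset0 &
    flow (words alpha 1) m (kinv kb) K <= (e * #|` K|%:R)%:E.
Proof.
move=> thin e e0; have e20 : (0 < e / 2)%R by rewrite divr_gt0.
have [s [sA smass _]] := finite_letters e20.
(* With [eps] below the masses of the letters in [s], every exit along [s] uses an edge of
   probability larger than [eps]. *)
have [eps eps0 epsm] : exists2 eps : R, (0 < eps)%R &
    forall a, a \in s -> (eps < m [:: a])%R.
  elim: (s) sA => [|a t IH] /=; first by exists 1%R.
  move=> /andP[aA /IH[c c0 cm]].
  have ma : (0 < m [:: a])%R by apply: (cylmass_gt0 GM mu_inv); rewrite /= aA.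
  exists (Num.min c (m [:: a] / 2))%R; first by rewrite lt_min c0 divr_gt0.
  move=> b; rewrite inE => /predU1P[->|/cm h].
    by rewrite gt_min; apply/orP; right; rewrite ltr_pdivrMr// mulr_natr mulr2n ltrDl.
  by rewrite gt_min h.
have [K K0 Kbd] := thin _ _ eps0 e20.
exists K => //.
rewrite (flow_fwd m (kappa_letterK GM cocycle) (kappa_invK GM cocycle)) esum_words1.
have nn (x : R) : (0 <= x)%R -> 0 <= x%:E by rewrite lee_fin.
apply: le_trans (_ : \esum_(a in alpha) ((#|` bd eps K|%:R)%:E * (m [:: a])%:E +
    (#|` K|%:R)%:E * (if a \in s then 0 else (m [:: a])%:E)) <= _).
  apply: le_esum => a aa; have [sa|sa] := boolP (a \in s).
    rewrite mule0 adde0 muleC lee_wpmul2r ?lee_fin ?cylmass_ge0// ler_nat.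
    apply: fsubset_leq_card; apply/fsubsetP => h hout; apply/boundaryP.
    move: hout; rewrite !inE => /andP[hK ahK]; split => //; exists (kf a h); split => //.
      have [y ay] := letter_inhabited GM aa.
      by rewrite (kappa_letterE cocycle aa ay); case: cocycle.
    apply: lt_le_trans (edge_prob_ge _ aa).
    by rewrite -mcyl1// lte_fin epsm.
  rewrite muleC -[leLHS]add0e leeD//; first by rewrite mule_ge0 ?nn ?cylmass_ge0.
  rewrite lee_wpmul2r ?lee_fin ?cylmass_ge0// ler_nat.
  by apply: fsubset_leq_card; apply/fsubsetP => h; rewrite !inE => /andP[].
have if0 a : 0 <= (if a \in s then 0 else (m [:: a])%:E).
  by case: ifP => // _; rewrite lee_fin cylmass_ge0.
rewrite esumD; last 2 first.
- by move=> a _; rewrite mule_ge0 ?nn ?cylmass_ge0.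
- by move=> a _; rewrite mule_ge0 ?nn.
rewrite !esumZl//; last by move=> a _; rewrite lee_fin cylmass_ge0.
rewrite (cylmass_massl GM mu_inv (z := [::]))// cylmass_nil mule1.
apply: le_trans (_ : (e / 2 * #|` K|%:R)%:E + (#|` K|%:R)%:E * (e / 2)%:E <= _).
  by rewrite leeD// ?lee_fin// lee_wpmul2l// lee_fin.
by rewrite -EFinM -EFinD lee_fin mulrC; lra.
Qed.

(** The boundary grows as [eps] decreases, so the nonnegative ratio tends to 0 only if it vanishes
    for every positive [eps]. *)
Lemma mu_amenableP : mu_amenable mu E kappa <->
  forall eps delta : R, (0 < eps)%R -> (0 < delta)%R ->
    exists2 K : {fset V}, K != fset0 &
      (#|` bd eps K|%:R <= delta * #|` K|%:R)%R.
Proof.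
have card_gt0 (K : {fset V}) : K != fset0 -> (0 < #|` K|%:R :> R)%R.
  by move=> K0; rewrite ltr0n cardfs_gt0.
split=> [amen eps delta e0 d0|thin].
  have near_lt : \forall e \near 0^'+, isoperimetric_ratio mu E kappa e < delta%:E.
    apply: (amen [set y | y < delta%:E]); apply: open_nbhs_nbhs.
    by split; [exact: open_ereal_lt_ereal|rewrite /= lte_fin].
  have [e [elt [epos eeps]]] : exists e, isoperimetric_ratio mu E kappa e < delta%:E /\
      (0 < e)%R /\ (e < eps)%R.
    apply: (@filter_ex _ (0^'+)); apply: filterI => //.
    by apply: filterI; [exact: nbhs_right_gt|exact: nbhs_right_lt].
  have [_ [K /= K0 <-] Kdelta] := ereal_inf_lt elt.
  exists K => //; move: Kdelta; rewrite lte_fin ltr_pdivrMr ?card_gt0// => /ltW.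
  apply: le_trans; rewrite ler_nat; apply: fsubset_leq_card; apply/fsubsetP => h.
  move=> /boundaryP[hK [u [Eu uK pu]]]; apply/boundaryP; split => //.
  by exists u; split => //; apply: lt_trans pu; rewrite lte_fin.
apply: cvg_near_cst; near=> e.
have e0 : (0 < e)%R by near: e; exact: nbhs_right_gt.
apply/le_anti/andP; split.
  apply/lee_addgt0Pr => delta d0; rewrite add0e.
  have [K K0 Kd] := thin _ _ e0 d0.
  apply: ge_ereal_inf; exists (#|` bd e K|%:R / #|` K|%:R)%R%:E; first by exists K.
  by rewrite lee_fin ler_pdivrMr ?card_gt0.
apply: le_ereal_inf_tmp => _ [K /= K0 <-].
by rewrite lee_fin divr_ge0.
Unshelve. all: end_near.
Qed.

End boundary_and_flow.

(** * Almost invariant sets *)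

Section fibre_integral.
Local Open Scope ereal_scope.
Context {R : realType} {d : measure_display} {X : measurableType d} {V : pointedType}.
Variable (mu : probability X R).
Hypothesis V_countable : countable [set: V].
Local Notation Y := (X * discrete_mtype V)%type.

Let fibre (g : discrete_mtype V) : set Y := [set: X] `*` [set g].

Let mfibre (A : set X) (g : discrete_mtype V) : measurable A ->
  measurable (A `*` [set g] : set Y).
Proof. by move=> mA; apply: measurableX. Qed.

Lemma measurable_fibres {d'} {Z : measurableType d'} (h : Y -> Z) :
  (forall g : V, measurable_fun [set: X] (fun x => h (x, g))) ->
  measurable_fun [set: Y] h.
Proof.
move=> mh _ B mB; rewrite setTI.
rewrite (_ : _ @^-1` B = \bigcup_(g in [set: V])
   (((fun x => h (x, g)) @^-1` B) `*` [set g])).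
  apply: measurable_countable_bigcup => // g _; apply: mfibre.
  by rewrite -[_ @^-1` _]setTI; exact: mh.
by apply/seteqP; split=> [[x g] /= hB|[x g] [g' _ [/= + ->]]//]; exists g.
Qed.

Lemma integral_fibre (h : Y -> \bar R) (g : V) : measurable_fun [set: Y] h ->
  (forall z, 0 <= h z) ->
  \int[mY mu]_(y in fibre g) h y = \int[mu]_x h (x, g).
Proof.
move=> mh h0.
have mphi : measurable_fun [set: X] (fun x => (x, g) : Y).
  exact: (pair2_measurable (g : discrete_mtype V)).
have mfg : measurable (fibre g) by exact: mfibre.
(* On one fibre the product with counting measure is the image of [mu] under [x |-> (x, g)]. *)
transitivity (\int[pushforward mu (fun x => (x, g) : Y)]_(y in fibre g) h y).
  apply: eq_measure_integral => A mA Ag.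
  have mA' : measurable ((fun x => (x, g) : Y) @^-1` A).
    by rewrite -[_ @^-1` _]setTI; exact: mphi.
  have -> : A = ((fun x => (x, g) : Y) @^-1` A) `*` [set (g : discrete_mtype V)].
    apply/seteqP; split=> [[x g'] Axg|[x g'] [/= + ->]//].
    by have [_ /= gg] := Ag _ Axg; split => //=; rewrite -gg.
  transitivity (mu ((fun x => (x, g) : Y) @^-1` A) *
      @counting (discrete_mtype V) R [set (g : discrete_mtype V)]).
    by apply: product_measure2E.
  rewrite /pushforward /counting /= asboolT// fset_set1 cardfs1 mule1; congr (mu _).
  by apply/seteqP; split=> [x|x []].
rewrite ge0_integral_pushforward//; last exact: measurable_funTS.
by rewrite (_ : _ @^-1` _ = [set: X])//; apply/seteqP; split.
Qed.

Lemma integral_mY (h : Y -> \bar R) : measurable_fun [set: Y] h ->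
  (forall z, 0 <= h z) ->
  \int[mY mu]_y h y = \esum_(g in [set: V]) \int[mu]_x h (x, g).
Proof.
move=> mh h0.
have fibre_inj : set_inj [set: V] fibre.
  move=> g g' _ _ gg'; have : fibre g (point, g) by [].
  by rewrite gg' => -[_ /=].
have fibre_part : partition (fibre @` [set: V]) id [set: Y].
  split.
  - apply/seteqP; split=> // -[x g] _.
    by exists (fibre g) => //; exists g.
  - move=> _ _ [g _ <-] [g' _ <-] [[x g''] [[_ /= ->] [_ /= ->]]] //.
  - by move=> _ [g _ <-]; exists (point, g).
(* The fibres are a countable partition of [Y]; at time 0 the iterated map is the identity. *)
rewrite (@integral_partition _ _ _ (mY mu) (fibre @` [set: V]) id _ fibre_part _ _ 0)//.
- rewrite esum_image//; apply: eq_esum => g _.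
  by rewrite setTI integral_fibre.
- by apply: sub_countable V_countable; exact: card_image_le.
- by move=> _ [g _ <-]; exact: mfibre.
Qed.

End fibre_integral.

(** * The deviation of an indicator from its transfer *)

Section almost_invariance.
Local Open Scope ereal_scope.
Context {R : realType} {d : measure_display} {X : measurableType d} {V : pointedType}.
Variables (mu : probability X R) (alpha : set (set X)) (theta : X -> X).
Variables (E : set (V * V)) (kappa : X -> V -> V).
Hypothesis GM : gibbs_markov_full_branches mu alpha theta.
Hypothesis mu_inv : invariant_measure mu theta.
Hypothesis cocycle : nearest_neighbour_cocycle alpha E kappa.

Local Notation Y := (X * discrete_mtype V)%type.
Local Notation kb := (kappa_inv kappa).
Local Notation m := (cylmass mu theta).
Local Notation That := (transfer mu alpha theta kappa).
Local Notation Tpos := (transfer_ge0 mu alpha theta kappa).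
Local Notation one := (indic_fiber R X).

Let MM : markov_map mu alpha theta. Proof. by case: GM. Qed.

Lemma indic_fiberE (A : {fset V}) x (g : V) : one A (x, g) = (g \in A)%:R.
Proof.
rewrite /indic_fiber indicE; congr ((nat_of_bool _)%:R).
by apply/idP/idP => [/set_mem[]|gA] //; apply/mem_set.
Qed.

Lemma indic_fiber_ge0 (A : {fset V}) z : (0 <= one A z)%R.
Proof. by case: z => x g; rewrite indic_fiberE. Qed.

Lemma integral_transfer_cst (h : Y -> \bar R) (c : V -> R) (g : V) B :
  (forall g, 0 <= c g)%R -> (forall x g, h (x, g) = (c g)%:E) -> measurable B ->
  \int[mu]_(x in B) Tpos h (x, g) =
  \esum_(a in alpha) ((c (kb a g))%:E * mu (a `&` theta @^-1` B)).
Proof.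
move=> c0 hE mB; rewrite integral_transfer_ge0//.
- apply: eq_esum => a aa; have ? := mm_preimage MM aa mB.
  by rewrite -integral_cst//; apply: eq_integral => x _; rewrite hE.
- by move=> [x g']; rewrite hE lee_fin.
- move=> g'; rewrite (_ : (fun x => _) = cst (c g')%:E)//.
  by apply/funext => x; rewrite hE.
Qed.

Let measurable_Tpos (h : Y -> \bar R) (g : V) : (forall z, 0 <= h z) ->
  fibre_measurable h -> measurable_fun [set: X] (fun x => Tpos h (x, g)).
Proof. by move=> h0 mh; exact: (fibre_measurable_transfer_ge0 kappa GM mu_inv h0 mh g). Qed.

(** Invariance of [mu] means that the transfer operator fixes constants. *)
Lemma transfer_one_ae (g : V) : \forall x \ae mu, Tpos (cst 1) (x, g) = 1.
Proof.
have mT : measurable_fun [set: X] (fun x => Tpos (cst 1) (x, g)).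
  by apply: measurable_Tpos => // g'; exact: measurable_cst.
have intT B : measurable B -> \int[mu]_(x in B) Tpos (cst 1) (x, g) = mu B.
  move=> mB; rewrite (@integral_transfer_cst _ (fun=> 1%R))//.
  under eq_esum do rewrite mul1e setIC.
  have mtB : measurable (theta @^-1` B).
    by rewrite -[_ @^-1` _]setTI; exact: (measurable_markov GM).
  rewrite -[RHS]mu_inv//.
  by rewrite (measure_partition mu (mm_countable MM) (mm_partition MM)
    (mm_measurable MM) (measurable_markov GM) 0 mtB).
have : ae_eq mu [set: X] (cst 1) (fun x => Tpos (cst 1) (x, g)).
  apply: integral_ae_eq => //.
    by apply: finite_measure_integrable_cst.
  by move=> B _ mB; rewrite intT// integral_cst// mul1e.
by case=> N [mN N0 sN]; exists N; split => // x /= nx; apply: sN => /= /(_ I) /esym.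
Qed.

Let moved (A : {fset V}) (g : V) (z : Y) : \bar R :=
  ((z.2 \in A) != (g \in A))%:R%:E.

(** As the weights [phi] add up to 1, the difference has a fixed sign on each fibre: minus the
    weight arriving from outside [A] if [g] is in [A], and the weight arriving from [A] otherwise.
    Hence the absolute value is again linear. *)
Lemma deviation_ae (A : {fset V}) (g : V) : \forall x \ae mu,
  `|That (one A) (x, g) - one A (x, g)|%:E = Tpos (moved A g) (x, g).
Proof.
have phi0 a x : alpha a -> (0 <= phi mu theta [:: a] x)%R.
  by move=> aa; apply: (phi_ge0 GM mu_inv) => /=; rewrite mem_set.
apply: filterS (transfer_one_ae g) => x T1.
pose P := Tpos (EFin \o one A) (x, g).
pose Q := Tpos (fun z : Y => (z.2 \notin A)%:R%:E) (x, g).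
have PE : P = \esum_(a in alpha) (phi mu theta [:: a] x * (kb a g \in A)%:R)%:E.
  by apply: eq_esum => a _; rewrite /= indic_fiberE EFinM.
have QE : Q = \esum_(a in alpha) (phi mu theta [:: a] x * (kb a g \notin A)%:R)%:E.
  by apply: eq_esum => a _; rewrite /= EFinM.
have P0 : 0 <= P by rewrite PE; apply: esum_ge0 => a aa; rewrite lee_fin mulr_ge0// phi0.
have Q0 : 0 <= Q by rewrite QE; apply: esum_ge0 => a aa; rewrite lee_fin mulr_ge0// phi0.
have PQ : P + Q = 1.
  rewrite -T1 PE QE -esumD; last 2 first.
  - by move=> a aa; rewrite lee_fin mulr_ge0// phi0.
  - by move=> a aa; rewrite lee_fin mulr_ge0// phi0.
  apply: eq_esum => a aa; rewrite -EFinD -mulrDr mule1.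
  by case: (kb a g \in A); rewrite ?addr0 ?add0r mulr1.
have -> : Tpos (moved A g) (x, g) = if g \in A then Q else P.
  rewrite PE QE /moved; case: (g \in A); apply: eq_esum => a _ /=.
    by rewrite -EFinM; case: (kb a g \in A).
  by rewrite -EFinM; case: (kb a g \in A).
rewrite (transferE kappa GM mu_inv (x, g) (indic_fiber_ge0 A)) indic_fiberE.
move: P0 Q0 PQ; rewrite -/P; case: P {PE} => [p| |//]; case: Q {QE} => [q| |//]//=.
rewrite !lee_fin => p0 q0 [pq]; case: (g \in A) => /=; congr (_%:E).
  by rewrite distrC ger0_norm; lra.
by rewrite subr0 ger0_norm.
Qed.

Definition deviation (A : {fset V}) (g : V) : \bar R :=
  \esum_(a in alpha) ((m [:: a])%:E * ((kb a g \in A) != (g \in A))%:R%:E).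

Lemma measurable_transfer_one (A : {fset V}) (g : V) :
  measurable_fun [set: X] (fun x => That (one A) (x, g)).
Proof.
rewrite (_ : (fun x => _) = fine \o (fun x => Tpos (EFin \o one A) (x, g))).
  apply: measurableT_comp; first exact: fine_measurable.
  apply: measurable_Tpos => [z|g'].
    by rewrite lee_fin indic_fiber_ge0.
  rewrite (_ : (fun x => _) = cst (g' \in A)%:R%:E)//.
  by apply/funext => x /=; rewrite indic_fiberE.
by apply/funext => x /=; rewrite (transferE kappa GM mu_inv)//; exact: indic_fiber_ge0.
Qed.

Lemma measurable_deviation (A : {fset V}) (g : V) :
  measurable_fun [set: X] (fun x => (That (one A) \- one A)%R (x, g)).
Proof.
apply: measurable_funB; first exact: measurable_transfer_one.
rewrite (_ : (fun x => _) = cst (g \in A)%:R)//.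
by apply/funext => x /=; rewrite indic_fiberE.
Qed.

Lemma integral_deviation (A : {fset V}) (g : V) :
  \int[mu]_x `|((That (one A) \- one A)%R (x, g))%:E| = deviation A g.
Proof.
have moved0 z : 0 <= moved A g z by rewrite lee_fin.
transitivity (\int[mu]_x Tpos (moved A g) (x, g)).
  apply: ge0_ae_eq_integral => //.
  - by apply/measurableT_comp => //; apply/measurable_EFinP; exact: measurable_deviation.
  - apply: measurable_Tpos => // g'.
    exact: (measurable_cst ((g' \in A) != (g \in A))%:R%:E).
  - by move=> x _; exact: (transfer_ge0_ge0 kappa GM mu_inv).
  by apply: filterS (deviation_ae A g) => x.
rewrite (@integral_transfer_cst _ (fun g' => ((g' \in A) != (g \in A))%:R%R))//.
apply: eq_esum => a aa; rewrite preimage_setT setIT muleC; congr (_ * _).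
by rewrite (cylmassE GM) /= ?mem_set// cylinder_cons cylinder_nil setIT.
Qed.

Lemma deviation_ge0 A g : 0 <= deviation A g.
Proof. by apply: esum_ge0 => a _; rewrite mule_ge0// lee_fin cylmass_ge0. Qed.

Let mass1 : \esum_(a in alpha) (m [:: a])%:E = 1.
Proof. by rewrite (cylmass_massl GM mu_inv (z := [::]))// cylmass_nil. Qed.

Lemma deviation_le1 A g : deviation A g <= 1.
Proof.
rewrite -mass1; apply: le_esum => a _.
by rewrite -[leRHS]mule1 lee_wpmul2l ?lee_fin ?cylmass_ge0// lern1 leq_b1.
Qed.

Local Notation escape A := (flow (words alpha 1) m (kinv kb) A).

Let escapeE (A : {fset V}) : escape A =
  \esum_(a in alpha) ((m [:: a])%:E *
    \esum_(g in [set: V]) ((kb a g \in A) && (g \notin A))%:R%:E).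
Proof. exact: esum_words1. Qed.

(** Crossings of the boundary of [A] are counted inwards and outwards, equally many by
    [inflow_outflow]. Over [A] alone, as in the next lemma, only one direction is counted. *)
Lemma esum_deviation (A : {fset V}) :
  \esum_(g in [set: V]) deviation A g = 2%:E * escape A.
Proof.
rewrite /deviation esumC; last by move=> *; rewrite mule_ge0// lee_fin cylmass_ge0.
rewrite escapeE -esumZl//; last first.
  by move=> a _; rewrite mule_ge0 ?lee_fin ?cylmass_ge0// esum_ge0.
apply: eq_esum => a aa; rewrite esumZl// ?cylmass_ge0// muleCA; congr (_ * _).
set I := \esum_(g in _) ((_ && _)%:R)%:E.
have -> : 2%:E * I = I + I.
  by rewrite -[2%R]/(1 + 1)%R EFinD ge0_muleDl ?lee_fin// ?mul1e.
rewrite {2}/I inflow_outflow -?esumD//; last exact: (kappa_inv_bij GM cocycle aa).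
apply: eq_esum => g _; rewrite -EFinD -natrD.
by case: (g \in A); case: (kb a g \in A).
Qed.

Lemma sum_deviation_in (A : {fset V}) :
  \sum_(g <- A) deviation A g = escape A.
Proof.
rewrite -esum_fsetE; last by move=> g; exact: deviation_ge0.
rewrite /deviation esumC; last by move=> *; rewrite mule_ge0// lee_fin cylmass_ge0.
rewrite escapeE; apply: eq_esum => a aa; rewrite esumZl// ?cylmass_ge0//; congr (_ * _).
rewrite inflow_outflow; last exact: (kappa_inv_bij GM cocycle aa).
rewrite esum_mkcond; apply: eq_esum => g _.
have -> : (g \in [set` A]) = (g \in A).
  by apply/idP/idP => [/set_mem//|gA]; exact/mem_set.
by case: (g \in A); case: (kb a g \in A).
Qed.

End almost_invariance.

Section mixed_norms.
Local Open Scope ereal_scope.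
Context {R : realType} {d : measure_display} {X : measurableType d} {V : pointedType}.
Variable (mu : probability X R).
Local Notation Y := (X * discrete_mtype V)%type.

Lemma sqr_poweR_half (x : \bar R) : 0 <= x -> (x `^ 2^-1) ^+ 2 = x.
Proof.
case: x => [x| |//] x0; last by rewrite poweRyr// invr_eq0 pnatr_eq0.
rewrite lee_fin in x0; rewrite poweR_EFin -EFin_expe -powR_mulrn ?powR_ge0//.
by rewrite -powRrM mulVf// powRr1.
Qed.

Let sum_ge0 p (f : Y -> R) : 0 <= \esum_(g in [set: discrete_mtype V])
  'N[mu]_p[(fun x => (f (x, g))%:E)] ^+ 2.
Proof. by apply: esum_ge0 => g _; apply: expe_ge0; exact: Lnorm_ge0. Qed.

Lemma mixed_norm_le p (f : Y -> R) c : 0 <= c ->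
  (mixed_norm mu p f <= c) =
  (\esum_(g in [set: discrete_mtype V])
     'N[mu]_p[(fun x => (f (x, g))%:E)] ^+ 2 <= c ^+ 2).
Proof.
by move=> c0; rewrite -lee_sqr ?poweR_ge0// sqr_poweR_half ?sum_ge0.
Qed.

Lemma mixed_norm_sqr p (f : Y -> R) : mixed_norm mu p f ^+ 2 =
  \esum_(g in [set: discrete_mtype V])
     'N[mu]_p[(fun x => (f (x, g))%:E)] ^+ 2.
Proof. by rewrite sqr_poweR_half ?sum_ge0. Qed.

Lemma mixed_norm_ge0 p (f : Y -> R) : 0 <= mixed_norm mu p f.
Proof. exact: poweR_ge0. Qed.

Lemma mixed_norm1_indic (A : {fset V}) :
  mixed_norm mu 1 (indic_fiber R X A) ^+ 2 = (#|` A|%:R)%:E.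
Proof.
rewrite mixed_norm_sqr.
transitivity (\esum_(g in [set: V]) ((g \in A) && true)%:R%:E : \bar R).
  apply: eq_esum => g _; rewrite Lnorm1.
  under eq_integral do rewrite indic_fiberE.
  have -> : \int[mu]__ `|((g \in A)%:R)%:E| = `|((g \in A)%:R)%:E| :> \bar R.
    by rewrite integral_cst// [X in _ * X]probability_setT mule1.
  rewrite andbT.
  by case: (g \in A); rewrite ?abse1 ?abse0 ?expe2 ?mule1 ?mule0.
rewrite (esum_indic_fset A xpredT); congr (_%:R%:E).
by congr (#|` _|); apply/fsetP => g; rewrite !inE andbT.
Qed.

End mixed_norms.

Section almost_invariant_sets.
Local Open Scope ereal_scope.
Context {R : realType} {d : measure_display} {X : measurableType d} {V : pointedType}.
Variables (mu : probability X R) (alpha : set (set X)) (theta : X -> X).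
Variables (E : set (V * V)) (kappa : X -> V -> V).
Hypothesis V_countable : countable [set: V].
Hypothesis GM : gibbs_markov_full_branches mu alpha theta.
Hypothesis mu_inv : invariant_measure mu theta.
Hypothesis cocycle : nearest_neighbour_cocycle alpha E kappa.

Local Notation kb := (kappa_inv kappa).
Local Notation m := (cylmass mu theta).
Local Notation That := (transfer mu alpha theta kappa).
Local Notation one := (indic_fiber R X).
Local Notation escape A := (flow (words alpha 1) m (kinv kb) A).
Local Notation dev := (deviation mu alpha theta kappa).

Lemma integral_mY_deviation (A : {fset V}) :
  \int[mY mu]_y `|((That (one A) \- one A)%R y)%:E| = 2%:E * escape A.
Proof.
rewrite integral_mY//.
  rewrite -(esum_deviation GM cocycle); apply: eq_esum => g _.
  exact: (integral_deviation kappa GM mu_inv).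
apply: measurableT_comp => //; apply/measurable_EFinP.
by apply: measurable_fibres => // g; exact: (measurable_deviation kappa GM mu_inv).
Qed.

Lemma mixed_norm1_deviation (A : {fset V}) :
  mixed_norm mu 1 (That (one A) \- one A)%R ^+ 2 =
  \esum_(g in [set: V]) dev A g ^+ 2.
Proof.
rewrite mixed_norm_sqr; apply: eq_esum => g _.
by rewrite Lnorm1 (integral_deviation kappa GM mu_inv).
Qed.

Lemma L1_invariant_of_flow :
  (forall e : R, (0 < e)%R -> exists2 A : {fset V}, A != fset0 &
     escape A <= (e * #|` A|%:R)%:E) ->
  forall e : R, (0 < e)%R -> exists2 A : {fset V}, A != fset0 &
    \int[mY mu]_y `|((That (one A) \- one A)%R y)%:E| <= (e * #|` A|%:R)%:E.
Proof.
move=> inv e e0; have [A A0 Ae] := inv (e / 2)%R (divr_gt0 e0 (ltr0n _ 2)).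
exists A => //; rewrite integral_mY_deviation.
apply: le_trans (lee_wpmul2l _ Ae) _; first by rewrite lee_fin.
by rewrite -EFinM lee_fin; lra.
Qed.

(** Deviations lie between 0 and 1, so their squares are no larger than themselves; squaring the
    norm turns the tolerance [e] into [e ^+ 2]. *)
Lemma mixed_invariant_of_L1 :
  (forall e : R, (0 < e)%R -> exists2 A : {fset V}, A != fset0 &
    \int[mY mu]_y `|((That (one A) \- one A)%R y)%:E| <= (e * #|` A|%:R)%:E) ->
  forall e : R, (0 < e)%R -> exists2 A : {fset V}, A != fset0 &
    mixed_norm mu 1 (That (one A) \- one A)%R <= e%:E * mixed_norm mu 1 (one A).
Proof.
move=> inv e e0; have [A A0 Ae] := inv (e ^+ 2)%R (exprn_gt0 2 e0).
exists A => //.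
rewrite -lee_sqr ?mixed_norm_ge0//; last by rewrite mule_ge0 ?mixed_norm_ge0// lee_fin ltW.
rewrite mixed_norm1_deviation [leRHS]expe2 muleACA -!expe2 mixed_norm1_indic.
rewrite -EFin_expe -EFinM; apply: le_trans Ae.
rewrite integral_mY_deviation -(esum_deviation GM cocycle).
apply: le_esum => g _; have := deviation_le1 kappa GM mu_inv A g.
have := deviation_ge0 mu alpha theta kappa A g.
by move=> D0 D1; rewrite expe2 -[leRHS]mule1 lee_wpmul2l.
Qed.

(** Cauchy-Schwarz on [A], where the deviations add up to the escape, in the form
    [2 e D <= e^2 + D^2]: each half of the right side sums to at most [e^2 #A]. *)
Lemma flow_of_mixed_invariant :
  (forall e : R, (0 < e)%R -> exists2 A : {fset V}, A != fset0 &
    mixed_norm mu 1 (That (one A) \- one A)%R <= e%:E * mixed_norm mu 1 (one A)) ->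
  forall e : R, (0 < e)%R -> exists2 A : {fset V}, A != fset0 &
     escape A <= (e * #|` A|%:R)%:E.
Proof.
move=> inv e e0; have [A A0 Ae] := inv e e0.
exists A => //; move: Ae.
rewrite -lee_sqr ?mixed_norm_ge0//; last by rewrite mule_ge0 ?mixed_norm_ge0// lee_fin ltW.
rewrite mixed_norm1_deviation [leRHS]expe2 muleACA -!expe2 mixed_norm1_indic.
rewrite -EFin_expe -EFinM => Ae.
have D0 := deviation_ge0 mu alpha theta kappa A.
have Dfin g : dev A g = (fine (dev A g))%:E.
  rewrite fineK// ge0_fin_numE//.
  by apply: le_lt_trans (deviation_le1 kappa GM mu_inv A g) (ltry _).
have sumD : \sum_(g <- A) dev A g ^+ 2 <= (e ^+ 2 * #|` A|%:R)%:E.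
  apply: le_trans Ae; rewrite -esum_fsetE; last by move=> g; exact: expe_ge0.
  by rewrite esum_mkcond; apply: le_esum => g _; case: ifP => // _; exact: expe_ge0.
rewrite -(sum_deviation_in GM cocycle).
under eq_bigr do rewrite Dfin.
rewrite sumEFin lee_fin.
move: sumD; under eq_bigr do rewrite Dfin -EFin_expe.
rewrite sumEFin lee_fin => sumD.
rewrite -(@ler_pM2l _ (2 * e)) ?mulr_gt0//.
apply: le_trans (_ : \sum_(g <- A) (e ^+ 2 + fine (dev A g) ^+ 2) <= _)%R.
  rewrite mulr_sumr; apply: ler_sum => g _.
  have := sqr_ge0 (e - fine (dev A g)); lra.
rewrite big_split/=.
have -> : (\sum_(g <- A) e ^+ 2 = e ^+ 2 * #|` A|%:R)%R.
  by rewrite card_fset_sum1 natr_sum mulr_sumr !big_seq_fsetE; apply: eq_bigr => g _; rewrite mulr1.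
by move: sumD; lra.
Qed.

End almost_invariant_sets.

(** * The spectral radius *)

Section flow_growth.
Local Open Scope ereal_scope.
Context {R : realType} {L V : choiceType}.
Variables (A : set L) (m : seq L -> R) (kb : L -> V -> V).
Let inA := fun a => a \in A.
Hypothesis m_ge0 : forall w, (0 <= m w)%R.
Hypothesis m_massl : forall z, all inA z -> \esum_(a in A) (m (a :: z))%:E = (m z)%:E.
Hypothesis m_massr : forall z, all inA z -> \esum_(a in A) (m (rcons z a))%:E = (m z)%:E.
Hypothesis kb_bij : forall a, A a -> bijective (kb a).

Let out (K : {fset V}) w : R := #|` [fset g in K | kinv kb w g \notin K]%fset|%:R.

Lemma flow_out n K : flow (words A n) m (kinv kb) K =
  \esum_(w in words A n) (m w * out K w)%:E.
Proof.
apply: eq_esum => w [_ Aw]; rewrite (inflow_outflow _ (kinv_bij kb_bij Aw)).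
by rewrite (esum_indic_fset K (fun g => kinv kb w g \notin K)).
Qed.

(** A point that leaves along [a :: w] has left after [w], or is then still in [K] and leaves along
    [a]. *)
Lemma out_cons K a w : all inA w -> (out K (a :: w) <= out K w + out K [:: a])%R.
Proof.
move=> Aw; rewrite -lee_fin EFinD /out -!esum_indic_fset.
rewrite -[X in _ + X](esum_bij _ (kinv_bij kb_bij Aw)) -esumD//.
apply: le_esum => g _; rewrite -EFinD lee_fin /= -natrD ler_nat.
by case: (g \in K); case: (kinv kb w g \in K) => //=; case: (_ \in K).
Qed.

(** The subadditivity of [out] involves only the laws of the first letter and of the remaining word;
    both are cylinder laws, by [m_massr] and [m_massl], although the letters are dependent. *)
Lemma flow_words_le k K : flow (words A k) m (kinv kb) K <=
  k%:R%:E * flow (words A 1) m (kinv kb) K.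
Proof.
have out0 w : (0 <= out K w)%R by exact: ler0n.
have mo0 w : 0 <= (m w * out K w)%:E by rewrite lee_fin mulr_ge0.
elim: k => [|k IH].
  rewrite mul0e flow_out words0 esum_set1//.
  rewrite (_ : out K [::] = 0%R) ?mulr0// /out.
  rewrite (_ : [fset _ in _ | _]%fset = fset0) ?cardfs0//.
  by apply/fsetP => g; rewrite !inE /= andbN.
have F10 : 0 <= flow (words A 1) m (kinv kb) K.
  by rewrite flow_out; apply: esum_ge0 => w _.
rewrite -natr1 EFinD ge0_muleDl ?lee_fin// mul1e.
apply: le_trans (leeD IH (lexx _)).
rewrite !flow_out esum_words_cons// esum_words1.
apply: le_trans (_ : \esum_(a in A) \esum_(w in words A k)
    ((m (a :: w) * out K w)%:E + (m (a :: w) * out K [:: a])%:E) <= _).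
  apply: le_esum => a _; apply: le_esum => w [_ Aw].
  by rewrite -EFinD lee_fin -mulrDr ler_wpM2l// out_cons.
under eq_esum.
  move=> a _; rewrite esumD; last 2 first.
  - by move=> w _; rewrite lee_fin mulr_ge0.
  - by move=> w _; rewrite lee_fin mulr_ge0.
  over.
rewrite esumD; last 2 first.
- by move=> a _; apply: esum_ge0 => w _; rewrite lee_fin mulr_ge0.
- by move=> a _; apply: esum_ge0 => w _; rewrite lee_fin mulr_ge0.
apply: leeD.
  rewrite esumC; last by move=> *; rewrite lee_fin mulr_ge0.
  apply: le_esum => w [_ Aw]; under eq_esum do rewrite mulrC EFinM.
  by rewrite esumZl// => [|a _]; rewrite ?lee_fin// m_massl// -EFinM mulrC.
apply: le_esum => a Aa; under eq_esum do rewrite mulrC EFinM.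
rewrite esumZl// => [|w _]; rewrite ?lee_fin//.
by rewrite (@esum_words_massr _ _ A m m_ge0 k [:: a] m_massr) /inA/= ?mem_set// -EFinM mulrC.
Qed.

End flow_growth.

Section contraction.
Local Open Scope ereal_scope.
Context {R : realType} {T V : choiceType}.
Variables (J : set T) (p : T -> R) (b : T -> V -> V).
Hypothesis p_ge0 : forall j, (0 <= p j)%R.
Hypothesis p_mass : \esum_(j in J) (p j)%:E = 1.
Hypothesis b_bij : forall j, J j -> bijective (b j).

(** Jensen's inequality and invariance of counting measure. *)
Lemma expect_ell2_le (F : V -> R) : (forall g, 0 <= F g)%R ->
  \esum_(g in [set: V]) expect J p (fun j => F (b j g)) ^+ 2 <=
  \esum_(g in [set: V]) (F g ^+ 2)%:E.
Proof.
move=> F0; rewrite -(esum_expect_bij p_ge0 p_mass b_bij (h := fun g => F g ^+ 2)%R); last first.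
  by move=> g; exact: sqr_ge0.
apply: le_esum => g _; apply: sqr_le_young.
- exact: expect_ge0.
- by apply: expect_ge0 => // j; exact: sqr_ge0.
move=> t t0; rewrite -expectZ// ?mulr_ge0//.
rewrite -(expect_cst p_ge0 p_mass (sqr_ge0 t)) -expectD//; last 2 first.
- by move=> j; exact: sqr_ge0.
- by move=> j; exact: sqr_ge0.
by apply: le_expect => // j _; have := sqr_ge0 (t - F (b j g)); lra.
Qed.
End contraction.

(** * Upper bounds for the operator norm *)

Section operator_norm.
Local Open Scope ereal_scope.
Context {R : realType} {d : measure_display} {X : measurableType d} {V : pointedType}.
Variables (mu : probability X R) (alpha : set (set X)) (theta : X -> X).
Variables (E : set (V * V)) (kappa : X -> V -> V).
Hypothesis GM : gibbs_markov_full_branches mu alpha theta.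
Hypothesis mu_inv : invariant_measure mu theta.

Local Notation inA := (fun a : set X => a \in alpha).
Local Notation Y := (X * discrete_mtype V)%type.
Local Notation kb := (kappa_inv kappa).
Local Notation m := (cylmass mu theta).
Local Notation That := (transfer mu alpha theta kappa).
Local Notation Tpos := (transfer_ge0 mu alpha theta kappa).
Local Notation opnorm := (opnorm_transfer mu alpha theta kappa).

Let muT : mu [set: X] = 1. Proof. exact: probability_setT. Qed.

Lemma Lnorm_oo (u : X -> \bar R) : 'N[mu]_+oo[u] = ess_sup mu (abse \o u).
Proof. by rewrite unlock /Lnorm [X in 0 < X]muT lte01. Qed.

(** On the set where [u > c] the hypothesis forces [u] and [c] to have the same integrals over all
    measurable subsets, so [u = c] almost everywhere on it and the set is null. *)
Lemma ae_le_of_integral (u : X -> \bar R) (c : \bar R) :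
  measurable_fun [set: X] u -> (forall x, 0 <= u x) -> 0 <= c ->
  (forall B, measurable B -> \int[mu]_(x in B) u x <= c * mu B) ->
  \forall x \ae mu, u x <= c.
Proof.
move=> mu_ u0; case: c => [r| |//] r0 uc; last by apply: aeW => x; rewrite leey.
pose B := [set x | r%:E < u x].
have mB : measurable B by rewrite -[B]setTI; exact: emeasurable_fun_o_infty.
have eqB C : C `<=` B -> measurable C ->
    \int[mu]_(x in C) (cst r%:E) x = \int[mu]_(x in C) u x.
  move=> CB mC; apply/le_anti/andP; split.
    apply: ge0_le_integral => //; first exact: measurable_funTS.
    by move=> x /CB /ltW.
  by rewrite integral_cst//; exact: uc.
have : ae_eq mu B (cst r%:E) u.
  apply: integral_ae_eq => //; first exact: finite_measure_integrable_cst.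
  exact: measurable_funTS.
case=> N [mN N0 sN]; exists N; split => // x /= /negP; rewrite -ltNge => rux.
by apply: sN => /= /(_ rux) rE; rewrite -rE ltxx in rux.
Qed.

Variable K0 : R.
Hypothesis K0_ge0 : (0 <= K0)%R.
Hypothesis pull_le : forall w B, all inA w -> measurable B ->
  pull mu theta w B <= (K0 * m w)%:E * mu B.

(** The supremum is bounded by testing against all sets [B]: a word contributes [F (kinv w g)] times
    [pull w B], and distortion gives [pull w B <= K0 m(w) mu(B)]. *)
Lemma sup_iter_transfer_le k (f : Y -> R) (F : V -> R) (g : V) :
  fibre_measurable (EFin \o f) -> (forall g, 0 <= F g)%R ->
  (forall g : V, \forall x \ae mu, (`|f (x, g)| <= F g)%R) ->
  'N[mu]_+oo[(fun x => (iter k That f (x, g))%:E)] <=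
  K0%:E * sums alpha m kb k F [::] g.
Proof.
move=> mf F0 fF; rewrite Lnorm_oo; apply/ess_supP.
pose h (z : Y) := `|f z|%:E.
have h0 z : 0 <= h z by rewrite lee_fin.
have mh : fibre_measurable h.
  move=> g'; rewrite (_ : (fun x => _) = abse \o (fun x => (f (x, g'))%:E))//.
  by apply: measurableT_comp => //; exact: mf.
suff : \forall x \ae mu, iter k Tpos h (x, g) <= K0%:E * sums alpha m kb k F [::] g.
  apply: filterS => x; apply: le_trans.
  exact: (abs_iter_transfer_le kappa GM mu_inv).
have term0 w : 0 <= (m (w ++ [::]) * F (kinv kb w g))%:E.
  by rewrite lee_fin mulr_ge0// cylmass_ge0.
apply: ae_le_of_integral.
- exact: (fibre_measurable_iter kappa GM mu_inv k h0 mh g).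
- by move=> x; exact: (iter_transfer_ge0_ge0 kappa GM mu_inv).
- by rewrite mule_ge0 ?lee_fin// esum_ge0.
move=> B mB; rewrite (integral_iter_transfer_ge0 kappa GM mu_inv)//.
have muB : mu B = (fine (mu B))%:E by rewrite fineK// fin_num_measure.
rewrite muB muleAC -EFinM /sums -esumZl ?mulr_ge0 ?fine_ge0//.
apply: le_esum => w [sw Aw]; rewrite cats0.
have mD : measurable (cylinder theta w `&` iter k theta @^-1` B).
  apply: measurableI; first exact: (measurable_cylinder GM).
  exact: (measurable_preimage_iter (measurable_markov GM)).
apply: le_trans (_ : (F (kinv kb w g))%:E * pull mu theta w B <= _).
  rewrite /pull sw -integral_cst//.
  apply: ae_ge0_le_integral => //.
  - by apply: measurable_funTS; exact: mh.
  - by move=> x _; rewrite lee_fin.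
  by apply: filterS (fF (kinv kb w g)) => x + _; rewrite lee_fin.
apply: le_trans (lee_wpmul2l _ (pull_le Aw mB)) _; first by rewrite lee_fin.
rewrite muB -!EFinM lee_fin le_eqVlt; apply/orP; left; apply/eqP; ring.
Qed.

Lemma opnorm_le k (a : R) : (0 <= a)%R ->
  (forall F : V -> R, (forall g, 0 <= F g)%R ->
    \esum_(g in [set: V]) (F g ^+ 2)%:E <= 1 ->
    \esum_(g in [set: V]) sums alpha m kb k F [::] g ^+ 2 <= a%:E) ->
  opnorm k <= (K0 * Num.sqrt a)%:E.
Proof.
move=> a0 sums_le; apply: ge_ereal_sup => _ [f [[mf _] f1] <-].
rewrite mixed_norm_le ?lee_fin ?mulr_ge0 ?sqrtr_ge0//.
rewrite mixed_norm_le// in f1.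
pose N (g : V) := 'N[mu]_+oo[(fun x => (f (x, g))%:E)].
have N0 g : 0 <= N g by exact: Lnorm_ge0.
have Nfin g : N g \is a fin_num.
  rewrite ge0_fin_numE//.
  have : N g ^+ 2 < +oo.
    apply: le_lt_trans (ltry (1 ^+ 2)%R); apply: le_trans f1.
    by apply: (@esum_ge_term _ _ _ (fun g => N g ^+ 2)) => //; exact: expe_ge0.
  by rewrite !ltey; apply: contra => /eqP ->.
pose F g := fine (N g).
have F0 g : (0 <= F g)%R by exact: fine_ge0.
have fF (g : V) : \forall x \ae mu, (`|f (x, g)| <= F g)%R.
  have := @ess_sup_ge _ _ _ mu (abse \o (fun x => (f (x, g))%:E)).
  by rewrite -Lnorm_oo; apply: filterS => x /=; rewrite -lee_fin fineK.
have mfib : fibre_measurable (EFin \o f).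
  move=> g; apply/measurable_EFinP.
  exact: (measurable_fun_pair1 (g : discrete_mtype V) mf).
have := sums_le F F0.
have -> : \esum_(g in [set: V]) (F g ^+ 2)%:E =
    \esum_(g in [set: discrete_mtype V]) N g ^+ 2.
  by apply: eq_esum => g _; rewrite EFin_expe fineK.
rewrite -[1]mule1 -expe2 => /(_ f1) H.
apply: le_trans (_ : (K0 ^+ 2)%:E * a%:E <= _); last first.
  by rewrite -EFin_expe -EFinM exprMn sqr_sqrtr.
apply: le_trans (lee_wpmul2l _ H); last by rewrite lee_fin sqr_ge0.
have s0 g : 0 <= sums alpha m kb k F [::] g.
  by apply: sums_ge0 => //; exact: cylmass_ge0.
rewrite -esumZl ?sqr_ge0// => [|g _]; last exact: expe_ge0.
apply: le_esum => g _.
rewrite EFin_expe !expe2 -muleACA -!expe2 lee_sqr ?Lnorm_ge0 ?mule_ge0//.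
exact: sup_iter_transfer_le.
Qed.

End operator_norm.

(** * A lower bound for the operator norm from almost invariant sets *)

Section spectral_radius_one.
Local Open Scope ereal_scope.
Context {R : realType} {d : measure_display} {X : measurableType d} {V : pointedType}.
Variables (mu : probability X R) (alpha : set (set X)) (theta : X -> X).
Variables (E : set (V * V)) (kappa : X -> V -> V).
Hypothesis V_countable : countable [set: V].
Hypothesis GM : gibbs_markov_full_branches mu alpha theta.
Hypothesis mu_inv : invariant_measure mu theta.
Hypothesis cocycle : nearest_neighbour_cocycle alpha E kappa.

Local Notation Y := (X * discrete_mtype V)%type.
Local Notation kb := (kappa_inv kappa).
Local Notation m := (cylmass mu theta).
Local Notation That := (transfer mu alpha theta kappa).
Local Notation one := (indic_fiber R X).
Local Notation opnorm := (opnorm_transfer mu alpha theta kappa).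
Local Notation escape A := (flow (words alpha 1) m (kinv kb) A).

Let m0 := cylmass_ge0 mu theta.
Let massl := cylmass_massl GM mu_inv.
Let massw := mass_words m0 (cylmass_nil mu theta) massl.

Let muT : mu [set: X] = 1. Proof. exact: probability_setT. Qed.

Lemma integral_le_Lnorm_oo (u : X -> R) : measurable_fun [set: X] u ->
  (forall x, 0 <= u x)%R ->
  \int[mu]_x (u x)%:E <= 'N[mu]_+oo[(fun x => (u x)%:E)].
Proof.
move=> mu_ u0; rewrite Lnorm_oo.
set N := ess_sup _ _.
have uN : \forall x \ae mu, (u x)%:E <= N.
  have := @ess_sup_ge _ _ _ mu (abse \o (fun x => (u x)%:E)).
  by apply: filterS => x /=; rewrite ger0_norm.
have N0 : 0 <= N.
  apply: ess_sup_gee; first by rewrite [X in 0 < X]muT.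
  by apply: aeW => x; exact: abse_ge0.
rewrite -[leRHS]mule1 -muT -integral_cst//.
apply: ae_ge0_le_integral => //.
- by move=> x _; rewrite lee_fin.
- exact/measurable_EFinP.
by apply: filterS uN => x + _.
Qed.

(* The test function is the normalized indicator of an almost invariant set. *)
Lemma opnorm_ge (A : {fset V}) (e : R) k : A != fset0 ->
  escape A <= (e * #|` A|%:R)%:E -> (1 - 2 * (k%:R * e))%:E <= opnorm k ^+ 2.
Proof.
move=> A0 Ae.
have cA : (0 < #|` A|%:R :> R)%R by rewrite ltr0n cardfs_gt0.
pose c : R := ((Num.sqrt #|` A|%:R)^-1)%R.
have c0 : (0 <= c)%R by rewrite invr_ge0 sqrtr_ge0.
have cc : (c ^+ 2 * #|` A|%:R = 1)%R.
  by rewrite exprVn sqr_sqrtr ?ltW// mulVf// gt_eqF.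
pose f (z : Y) := (c * one A z)%R.
have fE x (g : V) : f (x, g) = (c * (g \in A)%:R)%R by rewrite /f indic_fiberE.
have f0c z : (0 <= f z <= c)%R.
  case: z => x g; rewrite fE mulr_ge0//=.
  by rewrite -[leRHS]mulr1 ler_wpM2l// lern1 leq_b1.
have f0 z : (0 <= f z)%R by case/andP: (f0c z).
have mf (g : V) : measurable_fun [set: X] (fun x => f (x, g)).
  rewrite (_ : (fun x => _) = cst (c * (g \in A)%:R)%R)//.
  by apply/funext => x; rewrite fE.
have mfE : fibre_measurable (EFin \o f).
  by move=> g; apply/measurable_EFinP; exact: mf.
have f1 : mixed_norm mu +oo f <= 1.
  rewrite mixed_norm_le// expe2 mule1.
  apply: le_trans (_ : \esum_(g in [set: V]) ((c ^+ 2)%:E * ((g \in A) && true)%:R%:E) <= _).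
    apply: le_esum => g _.
    have Nle : 'N[mu]_+oo[(fun x => (f (x, g))%:E)] <= (c * (g \in A)%:R)%:E.
      rewrite Lnorm_oo; apply/ess_supP; apply: aeW => x /=.
      by rewrite fE ger0_norm// mulr_ge0.
    apply: le_trans (_ : (c * (g \in A)%:R)%:E ^+ 2 <= _).
      by rewrite lee_sqr ?Lnorm_ge0// lee_fin mulr_ge0.
    rewrite -EFin_expe -EFinM lee_fin exprMn andbT.
    by case: (g \in A); rewrite ?expr1n ?expr0n.
  rewrite esumZl ?sqr_ge0//.
  rewrite (esum_indic_fset A xpredT) -EFinM.
  rewrite (_ : [fset _ in _ | _]%fset = A) ?cc//.
  by apply/fsetP => g; rewrite !inE andbT.
have fH : Hspace mu +oo f.
  split; last by apply: le_lt_trans f1 (ltry _).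
  exact: measurable_fibres.
have le_op : mixed_norm mu +oo (iter k That f) <= opnorm k.
  by apply: ereal_sup_ubound; exists f.
apply: le_trans (_ : mixed_norm mu +oo (iter k That f) ^+ 2 <= _); last first.
  by rewrite lee_sqr ?mixed_norm_ge0//; apply: le_trans le_op; exact: mixed_norm_ge0.
rewrite mixed_norm_sqr.
pose P g := expect (words alpha k) m (fun w => (kinv kb w g \in A)%:R%R).
pose P' g := expect (words alpha k) m (fun w => (kinv kb w g \notin A)%:R%R).
have P0 g : 0 <= P g by apply: expect_ge0.
have P'0 g : 0 <= P' g by apply: expect_ge0.
have PP' g : P g + P' g = 1.
  rewrite /P /P' -expectD// -(expect_cst m0 (massw k) ler01).
  by apply: eq_esum => w _; rewrite -natrD; case: (_ \in A).
have Pfin g : P g \is a fin_num.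
  rewrite ge0_fin_numE//; apply: le_lt_trans (ltry 1%R).
  by rewrite -(PP' g) leeDl.
have sumP' : \sum_(g <- A) P' g <= (k%:R * e * #|` A|%:R)%:E.
  rewrite -esum_fsetE// /P' /expect esumC; last by move=> *; rewrite lee_fin mulr_ge0.
  apply: le_trans (_ : flow (words alpha k) m (kinv kb) A <= _).
    rewrite (flow_out m (kappa_inv_bij GM cocycle)).
    apply: le_esum => w _; under eq_esum do rewrite EFinM.
    rewrite esumZl// EFinM lee_wpmul2l ?lee_fin//.
    rewrite -(esum_indic_fset A (fun g => kinv kb w g \notin A)).
    rewrite esum_mkcond; apply: le_esum => g _.
    have -> : (g \in [set` A]) = (g \in A).
      by apply/idP/idP => [/set_mem//|gA]; exact/mem_set.
    by case: (g \in A).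
  apply: le_trans (flow_words_le m0 massl (cylmass_massr GM)
    (kappa_inv_bij GM cocycle) k A) _.
  rewrite -mulrA EFinM lee_wpmul2l// lee_fin.
have intE (g : V) : \int[mu]_x (iter k That f (x, g))%:E = c%:E * P g.
  rewrite (integral_iter_transfer kappa GM mu_inv k g measurableT f0c mfE).
  rewrite /P /expect -esumZl// => [|w _]; last by rewrite lee_fin mulr_ge0.
  apply: eq_esum => w [_ Aw]; rewrite preimage_setT setIT.
  under eq_integral do rewrite fE.
  rewrite integral_cst; last exact: (measurable_cylinder GM Aw).
  rewrite [X in _ * X](_ : _ = (m w)%:E) -?EFinM; last exact: esym (cylmassE GM Aw).
  by congr (_%:E); ring.
have mTf (g : V) : measurable_fun [set: X] (fun x => iter k That f (x, g)).
  apply/measurable_EFinP.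
  exact: (fibre_measurable_iter_transfer kappa GM mu_inv k f0 mfE g).
have cP g : (c ^+ 2)%:E * P g ^+ 2 <= 'N[mu]_+oo[(fun x => (iter k That f (x, g))%:E)] ^+ 2.
  rewrite EFin_expe !expe2 -muleACA -!expe2 lee_sqr ?Lnorm_ge0 ?mule_ge0 ?lee_fin//.
  rewrite -intE; apply: integral_le_Lnorm_oo => // x.
  exact: (transfer_nonneg kappa GM mu_inv).
apply: le_trans (_ : \esum_(g in [set: V]) ((c ^+ 2)%:E * P g ^+ 2) <= _); last first.
  by apply: le_esum => g _; exact: cP.
apply: le_trans (_ : \sum_(g <- A) ((c ^+ 2)%:E * P g ^+ 2) <= _); last first.
  rewrite -esum_fsetE; last by move=> g; rewrite mule_ge0 ?lee_fin ?sqr_ge0// expe_ge0.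
  rewrite esum_mkcond; apply: le_esum => g _; case: ifP => // _.
  by rewrite mule_ge0 ?lee_fin ?sqr_ge0// expe_ge0.
have PE g : P g = (fine (P g))%:E by rewrite fineK.
have P'E g : P' g = (1 - fine (P g))%:E.
  have := PP' g; rewrite PE; case: (P' g) => // r [<-]; congr (_%:E) => /=; ring.
move: sumP'; under eq_bigr do rewrite P'E; rewrite sumEFin lee_fin => sumP'.
under eq_bigr do rewrite PE -EFin_expe -EFinM.
rewrite sumEFin lee_fin -mulr_sumr.
(* [x^2 >= 1 - 2 (1 - x)] makes the bound linear in the escaping mass [1 - P g]. *)
apply: le_trans (_ : c ^+ 2 * \sum_(g <- A) (1 - 2 * (1 - fine (P g))) <= _)%R.
  rewrite big_split/= sumrN -mulr_sumr.
  have -> : (\sum_(g <- A) 1 = #|` A|%:R :> R)%R.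
    by rewrite card_fset_sum1 natr_sum.
  rewrite mulrBr cc lerD2l lerN2 mulrCA ler_pM2l//.
  by apply: le_trans (ler_wpM2l (sqr_ge0 c) sumP') _; rewrite mulrCA cc mulr1.
rewrite ler_wpM2l ?sqr_ge0//; apply: ler_sum => g _.
have := sqr_ge0 (fine (P g) - 1); lra.
Qed.

End spectral_radius_one.

Lemma cvg_root (R : realType) (c : R) : 0 < c ->
  (c `^ k%:R^-1)%:E @[k --> \oo] --> 1%E.
Proof.
move=> c0.
have root_exp : (fun n : nat => expR (ln c * harmonic n)) = (fun n => c `^ n.+1%:R^-1).
  by apply/funext => n; rewrite /powR gt_eqF// mulrC.
have : expR (ln c * harmonic n) @[n --> \oo] --> expR (ln c * 0).
  apply: continuous_cvg; first exact: continuous_expR.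
  by apply: cvgMl_tmp; exact: cvg_harmonic.
rewrite root_exp mulr0 expR0 => shifted.
have : c `^ k%:R^-1 @[k --> \oo] --> (1 : R).
  by rewrite -(cvg_shiftS (fun k : nat => c `^ k%:R^-1)).
by apply: cvg_EFin => //; apply: nearW.
Qed.

Section spectral_radius_equivalence.
Local Open Scope ereal_scope.
Context {R : realType} {d : measure_display} {X : measurableType d} {V : pointedType}.
Variables (mu : probability X R) (alpha : set (set X)) (theta : X -> X).
Variables (E : set (V * V)) (kappa : X -> V -> V).
Hypothesis V_countable : countable [set: V].
Hypothesis GM : gibbs_markov_full_branches mu alpha theta.
Hypothesis mu_inv : invariant_measure mu theta.
Hypothesis cocycle : nearest_neighbour_cocycle alpha E kappa.

Local Notation kb := (kappa_inv kappa).
Local Notation m := (cylmass mu theta).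
Local Notation opnorm := (opnorm_transfer mu alpha theta kappa).
Local Notation rho := (spectral_radius mu alpha theta kappa).
Local Notation escape A := (flow (words alpha 1) m (kinv kb) A).

Let m0 := cylmass_ge0 mu theta.
Let mnil := cylmass_nil mu theta.
Let massl := cylmass_massl GM mu_inv.
Let massw := mass_words m0 mnil massl.

Lemma sumsE k (F : V -> R) g :
  sums alpha m kb k F [::] g = expect (words alpha k) m (fun w => F (kinv kb w g)).
Proof. by apply: eq_esum => w _; rewrite cats0. Qed.

Lemma opnorm_ge0 k : 0 <= opnorm k.
Proof.
have norm0 : mixed_norm mu +oo ((fun=> 0%R) : X * discrete_mtype V -> R) = 0.
  apply/le_anti; rewrite mixed_norm_ge0 andbT mixed_norm_le//.
  rewrite esum1 ?expe2 ?mul0e// => g _.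
  by rewrite [X in X * _](Lnorm0 mu) ?mul0e.
apply: (le_trans (mixed_norm_ge0 mu +oo
  (iter k (transfer mu alpha theta kappa) (fun=> 0%R)))).
apply: ereal_sup_ubound; exists (fun=> 0%R) => //=.
split; last by rewrite norm0.
by split; [exact: measurable_cst|rewrite norm0].
Qed.

Let le_root (x y : \bar R) k : 0 <= x -> x <= y -> x `^ k%:R^-1 <= y `^ k%:R^-1.
Proof.
move=> x0 xy; apply: gt0_ler_poweR => //.
- by rewrite in_itv/= x0 leey.
- by rewrite in_itv/= (le_trans x0 xy) leey.
Qed.

(** Every [opnorm k] lies between 1 and [K 0], so the roots are squeezed to 1. The almost invariant
    set may depend on [k]. *)
Lemma spectral_radius_of_flow :
  (forall e : R, (0 < e)%R -> exists2 A : {fset V}, A != fset0 &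
     escape A <= (e * #|` A|%:R)%:E) ->
  rho = 1.
Proof.
move=> inv.
have [K [_ rev pull_le _]] := mass_distortion GM mu_inv.
have K0 : (0 < K 0)%R := distortion0_gt0 mnil rev.
have upper k : opnorm k <= (K 0)%:E.
  rewrite -(mulr1 (K 0%N)) -(@sqrtr1 R).
  apply: (opnorm_le GM mu_inv (ltW K0) pull_le) => // F F0; apply: le_trans.
  rewrite (eq_esum (fun g _ => congr1 (fun x => x ^+ 2) (sumsE k F g))).
  apply: (expect_ell2_le m0 (massw k)) => // w [_ Aw].
  exact: (kinv_bij (kappa_inv_bij GM cocycle)).
have lower k : 1 <= opnorm k.
  rewrite -lee_sqr ?opnorm_ge0// expe2 mule1; apply/lee_addgt0Pr => e e0.
  have k1 : (0 < 2 * k%:R + 1 :> R)%R by rewrite ltr_wpDl// mulr_ge0.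
  have [A A0 Ae] := inv _ (divr_gt0 e0 k1).
  have := opnorm_ge V_countable GM mu_inv cocycle k A0 Ae.
  move=> /leeD2r - /(_ e%:E); apply: le_trans.
  rewrite -EFinD lee_fin -subr_ge0.
  have -> : (1 - 2 * (k%:R * (e / (2 * k%:R + 1))) + e - 1 = e / (2 * k%:R + 1))%R.
    by field; rewrite gt_eqF.
  by rewrite divr_ge0// ltW.
apply: cvg_lim => //.
apply: (squeeze_cvge _ (cvg_cst 1) (cvg_root K0)).
apply: nearW => k; apply/andP; split.
  by rewrite -(poweR1r k%:R^-1); apply: le_root.
by rewrite -poweR_EFin; apply: le_root => //; exact: opnorm_ge0.
Qed.

Lemma flow_of_spectral_radius n : (0 < n)%N -> uniform_loops theta kappa n ->
  rho = 1 -> forall c : R, (0 < c)%R -> exists K : {fset V},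
    flow (words alpha n) m (kinv kb) K < (c * #|` K|%:R)%:E.
Proof.
move=> n0 loops rho1 c c0; apply: contrapT => /forallNP flow_big.
have [delta d0 loop] := loops_mass GM mu_inv cocycle loops.
(* Capping [c] at 1 keeps [eta] at most 1. *)
pose c' := Num.min c 1%R.
have c'0 : (0 < c')%R by rewrite lt_min c0 ltr01.
have c'1 : (c' <= 1)%R by rewrite ge_min lexx orbT.
have flow_ge K : (c' * #|` K|%:R)%:E <= flow (words alpha n) m (kinv kb) K.
  apply: le_trans (_ : (c * #|` K|%:R)%:E <= _).
    by rewrite lee_fin ler_wpM2r// ge_min lexx.
  by rewrite leNgt; apply/negP; exact: flow_big.
have kwb w : words alpha n w -> bijective (kinv kb w).
  by move=> [_ Aw]; exact: (kinv_bij (kappa_inv_bij GM cocycle)).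
have loop' g : exists w, [/\ words alpha n w, (delta <= m w)%R & kinv kb w g = g].
  exact: loop.
have gap f := spectral_gap m0 (massw n) kwb c'0 d0 flow_ge loop' (f := f).
set eta := (delta / (2 + 2 * delta) * (c' ^+ 2 / 4))%R in gap.
have [K [dist rev pull_le Klim]] := mass_distortion GM mu_inv.
have K0 : (0 < K 0)%R := distortion0_gt0 mnil rev.
have eta01 : (0 < eta <= 1)%R.
  have d2 : (0 < 2 + 2 * delta)%R by rewrite addr_gt0// mulr_gt0.
  rewrite /eta mulr_gt0 ?divr_gt0 ?exprn_gt0//=.
  apply: mulr_ile1; first by rewrite divr_ge0// ltW.
  - by rewrite divr_ge0// exprn_ge0// ltW.
  - by rewrite ler_pdivrMr// mul1r; lra.
  by rewrite ler_pdivrMr// mul1r; nra.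
have [s [lam [s0 /andP[lam0 lam1] decay]]] := ell2_decay m0 (@cylmass_gt0 _ _ _ _ _ _ GM mu_inv)
  mnil massl dist rev (kappa_inv_bij GM cocycle) n0 eta01 Klim gap.
(* [lam'] lies strictly between [lam] and 1 and is positive even if [lam] is 0. With
   [p ^+ (4 * s) = lam'] the square root in [opnorm_le] leaves [opnorm k <= K0 p^(2k)] at multiples
   [k] of [s]; the [k]-th root [K0^(1/k) p^2] drops below [p] for large [k]. *)
pose lam' : R := ((1 + lam) / 2)%R.
have lam'0 : (0 < lam')%R by rewrite /lam'; lra.
pose p : R := (lam' `^ (4 * s%:R)^-1)%R.
have s4 : (0 < 4 * s%:R :> R)%R by rewrite mulr_gt0// ltr0n.
have p0 : (0 < p)%R by exact: powR_gt0.
have pE : (p ^+ (4 * s) = lam')%R.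
  rewrite -powR_mulrn ?ltW// -powRrM natrM mulVf ?gt_eqF// powRr1// ltW//.
have p1 : (p < 1)%R.
  rewrite ltNge; apply/negP => /(exprn_ege1 (4 * s)); rewrite pE /lam'; lra.
(* A divergent sequence would have as limit the default [point], which is 0 in [\bar R]; so
   [rho = 1] entails convergence. *)
have cvg1 : opnorm k `^ k%:R^-1 @[k --> \oo] --> 1.
  have [cv|/dvgP dv] := pselect (cvg (opnorm k `^ k%:R^-1 @[k --> \oo])).
    by rewrite -rho1; exact: cv.
  have : point = 1 :> \bar R by rewrite -dv.
  by move/eqP; rewrite eq_sym onee_eq0.
have above : \forall k \near \oo, p%:E < opnorm k `^ k%:R^-1.
  apply: (cvg1 [set y | p%:E < y]); apply: open_nbhs_nbhs.
  by split; [exact: open_ereal_gt_ereal|rewrite /= lte_fin].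
have below : \forall k \near \oo, ((K 0%N) `^ k%:R^-1)%:E < (p^-1)%:E.
  have near1 : nbhs (1 : \bar R) [set y | y < (p^-1)%:E].
    apply: open_nbhs_nbhs.
    by split; [exact: open_ereal_lt_ereal|rewrite /= lte_fin invf_gt1].
  exact: (cvg_root K0 near1).
have [N _ near_inf] := filterI above below.
pose k := (N.+1 * s)%N.
have k0 : (0 < k)%N by rewrite muln_gt0.
have kN : (N <= k)%N by apply: leq_trans (leqnSn N) _; rewrite leq_pmulr.
have [] := near_inf _ kN; rewrite lte_fin => pk Kp.
have op_le : opnorm k <= (K 0%N * p ^+ (2 * k))%:E.
  apply: le_trans (_ : (K 0%N * Num.sqrt (lam ^+ N.+1))%:E <= _).
    apply: (opnorm_le GM mu_inv (ltW K0) pull_le) => [|F F0 F1]; first exact: exprn_ge0.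
    by rewrite -[X in X%:E]mulr1; exact: decay.
  rewrite lee_fin ler_pM2l// -(ger0_norm (exprn_ge0 (2 * k) (ltW p0))).
  rewrite -sqrtr_sqr; apply: ler_wsqrtr; rewrite -exprM.
  rewrite (_ : (2 * k * 2)%N = (4 * s * N.+1)%N); last first.
    by rewrite /k mulnAC (mulnC N.+1) mulnA.
  rewrite (exprM p (4 * s)) pE.
  by apply: lerXn2r; rewrite ?nnegrE ?lam0 ?(ltW lam'0)// /lam'; lra.
suff : opnorm k `^ k%:R^-1 < p%:E by rewrite ltNge (ltW pk).
apply: le_lt_trans (le_root k (opnorm_ge0 k) op_le) _.
rewrite poweR_EFin lte_fin powRM ?exprn_ge0 ?ltW//.
rewrite -(powR_mulrn _ (ltW p0)) -powRrM natrM mulfK ?pnatr_eq0 -?lt0n//.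
rewrite powR_mulrn ?ltW//.
by rewrite -ltr_pdivlMr ?exprn_gt0// expr2 invfM mulrA divff ?gt_eqF// mul1r.
Qed.
End spectral_radius_equivalence.

Theorem theorem3p4 (R : realType) (d : measure_display)
    (X : measurableType d) (mu : probability X R) (alpha : set (set X))
    (theta : X -> X) (V : pointedType) (E : set (V * V))
    (kappa : X -> V -> V)
    (V_countable : countable [set: V])
    (theta_GM : gibbs_markov_full_branches mu alpha theta)
    (mu_inv : invariant_measure mu theta)
    (kappa_cocycle : nearest_neighbour_cocycle alpha E kappa)
    (T_transitive : topologically_transitive mu alpha theta kappa)
    (T_loops : exists2 n, (0 < n)%N & uniform_loops theta kappa n) :
  let That := transfer mu alpha theta kappa in
  let one (A : {fset V}) := indic_fiber R X A in
  [<-> mu_amenable mu E kappa;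
       spectral_radius mu alpha theta kappa = 1%E;
       forall eps : R, 0 < eps -> exists2 A : {fset V}, A != fset0 &
         (\int[mY mu]_y `|((That (one A) \- one A)%R y)%:E|
          <= (eps * #|` A|%:R)%:E)%E;
       forall eps : R, 0 < eps -> exists2 A : {fset V}, A != fset0 &
         (mixed_norm mu 1%E (That (one A) \- one A)%R
          <= eps%:E * mixed_norm mu 1%E (one A))%E].
Proof.
move=> That one; have [n n0 loops] := T_loops.
tfae.
- move=> /mu_amenableP/(flow_of_boundary theta_GM mu_inv kappa_cocycle).
  exact: (spectral_radius_of_flow V_countable theta_GM mu_inv kappa_cocycle).
(* Small flow along words of length [n] is turned into small flow along letters by way of the
   boundary. *)
- move=> /(flow_of_spectral_radius theta_GM mu_inv kappa_cocycle n0 loops).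
  move=> /(boundary_of_flow theta_GM mu_inv kappa_cocycle n0).
  move=> /(flow_of_boundary theta_GM mu_inv kappa_cocycle).
  exact: (L1_invariant_of_flow V_countable theta_GM mu_inv kappa_cocycle).
- exact: (mixed_invariant_of_L1 V_countable theta_GM mu_inv kappa_cocycle).
- move=> /(flow_of_mixed_invariant theta_GM mu_inv kappa_cocycle) inv.
  apply/mu_amenableP.
  (* Words of length 1 suffice here; the strict inequality is obtained by halving [c]. *)
  apply: (boundary_of_flow theta_GM mu_inv kappa_cocycle (ltn0Sn 0)) => c c0.
  have [A A0 Ac] := inv (c / 2) (divr_gt0 c0 (ltr0n _ 2)).
  exists A; apply: le_lt_trans Ac _; rewrite lte_fin ltr_pM2r ?ltr0n ?cardfs_gt0//.
  by rewrite ltr_pdivrMr// ltr_pMr// ltr1n.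
Qed.
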